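(* Let $T\in(0,\infty]$, let $\phi:[0,T)\to(0,\infty)$ be continuously differentiable with $\phi(0)=1$, let $\psi,\sigma:[0,T)\to\mathbb{R}$ be continuous, and suppose that there is some $\delta\in(0,T]$ with $\sigma(t)\neq 0$ for all $t\in(0,\delta)$. Let $(B_t)_{t\ge 0}$ be a standard Wiener process on a probability space $(\Omega,\mathcal{A},\mathbb{P})$, let $\xi\in\mathbb{R}$ be non-random, let $(Z_t)_{t\in[0,T)}$ be the pathwise unique strong solution of $$\mathrm{d}Z_t=\left(\frac{\phi'(t)}{\phi(t)}Z_t+\psi(t)\right)\mathrm{d}t+\sigma(t)\,\mathrm{d}B_t,\qquad t\in[0,T),\qquad Z_0=\xi,$$ and let $$\widetilde Z_t:=Z_t-\mathbb{E}(Z_t)=\phi(t)\int_0^t\frac{\sigma(u)}{\phi(u)}\,\mathrm{d}B_u,\qquad t\in[0,T).$$ Then there exists a strictly stationary centered Ornstein-Uhlenbeck process $R=(R_t)_{t\in\mathbb{R}}$ with $\operatorname{Cov}(R_s,R_t)=e^{-|t-s|/2}$, $s,t\in\mathbb{R}$, such that, almost surely, $$\widetilde Z_t=\phi(t)\sqrt{\int_0^t\frac{\sigma(u)^2}{\phi(u)^2}\,\mathrm{d}u}\;R\left(\ln\left(\int_0^t\frac{\sigma(u)^2}{\phi(u)^2}\,\mathrm{d}u\right)\right)\qquad\text{for all } t\in[0,T),$$ where the right-hand side for $t=0$ is understood as an almost sure limit as $t\downarrow 0$. Further, if $\mathbb{P}\big(\widetilde Z_T:=\lim_{t\uparrow T}\widetilde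 Z_t=0\big)=1$, then, almost surely, $$\widetilde Z_t=\phi(t)\sqrt{\int_0^t\frac{\sigma(u)^2}{\phi(u)^2}\,\mathrm{d}u}\;R\left(\ln\left(\int_0^t\frac{\sigma(u)^2}{\phi(u)^2}\,\mathrm{d}u\right)\right)\qquad\text{for all } t\in[0,T],$$ where the right-hand side for $t=0$ and for $t=T$ is understood as an almost sure limit as $t\downarrow 0$ and as $t\uparrow T$, respectively.
   Context: A strictly stationary centered Ornstein-Uhlenbeck process $R=(R_t)_{t\in\mathbb{R}}$ with $\operatorname{Cov}(R_s,R_t)=e^{-|t-s|/2}$ is a centered Gaussian process indexed by $\mathbb{R}$, with continuous sample paths and this covariance function; equivalently, it has the law of $(e^{-t/2}W_{e^t})_{t\in\mathbb{R}}$ for a standard Wiener process $W$. The notation $R(t)$ means $R_t$. The solution of the SDE is given explicitly by $Z_t=\phi(t)\left(\xi+\int_0^t\frac{\psi(u)}{\phi(u)}\,\mathrm{d}u+\int_0^t\frac{\sigma(u)}{\phi(u)}\,\mathrm{d}B_u\right)$, $t\in[0,T)$.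
   Formalization: The process R is asserted to exist on a product extension of the probability space (Ω,A,P); on (Ω,A,P) itself it is asserted only if T<∞ or ∫_0^t σ²/φ² du → ∞ as t↑T, since otherwise existence on (Ω,A,P) can fail (e.g. T=∞, φ=1, σ(t)=e^{-t} on Wiener space). *)

(* Defs.v *)
From HB Require Import structures.
From mathcomp Require Import all_boot all_order all_algebra.
From mathcomp Require Import all_classical all_reals all_analysis.

Set Implicit Arguments.
Unset Strict Implicit.
Unset Printing Implicit Defensive.

Import Order.TTheory GRing.Theory Num.Theory.
Import numFieldNormedType.Exports.

Local Open Scope classical_set_scope.
Local Open Scope ring_scope.

Section deterministic.
Context {R : realType}.
Implicit Types (T : \bar R) (f : R -> R).

(* [0, T), where T may be +oo; functions and processes on [0, T) are total
   functions of a real time of which only the values on this set are used. *)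
Definition time_interval T : set R := [set t | 0 <= t /\ (t%:E < T)%E].

(* The filter t ^ T; the value at -oo is irrelevant. *)
Definition from_below T : set_system R :=
  match T with
  | r%:E => r^'-
  | +oo%E => pinfty_nbhs R
  | -oo%E => ninfty_nbhs R
  end.

(* Derivative relative to D, hence one-sided at an endpoint of D. *)
Definition difference_quotient f (t s : R) : R := (f s - f t) / (s - t).

Definition derivative_within (D : set R) f (t : R) : R :=
  lim (difference_quotient f t s @[s --> within D t^']).

Definition continuously_differentiable_on (D : set R) f : Prop :=
  (forall t, D t -> cvg (difference_quotient f t s @[s --> within D t^'])) /\
  {within D, continuous (derivative_within D f)}.

(* \int_0^t (sigma / phi)^2 du *)
Definition clock (phi sigma : R -> R) (t : R) : R :=
  \int[lebesgue_measure]_(u in `[0, t]) (sigma u ^+ 2 / phi u ^+ 2).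

Definition time_changed (phi sigma : R -> R) (r : R -> R) (t : R) : R :=
  phi t * Num.sqrt (clock phi sigma t) * r (ln (clock phi sigma t)).

(* An elementary function \sum_i c_i 1_(a_i, b_i] is given by the list of its
   triples (c_i, a_i, b_i). *)
Definition elementary := seq (R * R * R).

Definition elementary_on (t : R) (s : elementary) : bool :=
  all (fun x : R * R * R => [&& 0 <= x.1.2, x.1.2 <= x.2 & x.2 <= t]) s.

Definition elementary_fun (s : elementary) (u : R) : R :=
  \sum_(x <- s) x.1.1 * \1_(`]x.1.2, x.2]) u.

End deterministic.

Section processes.
Context {R : realType} {d : measure_display} {Omega : measurableType d}.
Implicit Types (P : probability Omega R) (X Y : Omega -> R).
Implicit Types (B I Z : R -> Omega -> R) (T : \bar R).

(* X has the normal law N(m, v), the Dirac mass at m when v = 0 (for which the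
   library's normal_prob has a dummy value). *)
Definition has_normal_law P X (m v : R) : Prop :=
  measurable_fun setT X /\
  forall A : set R, measurable A ->
    P (X @^-1` A) = if v == 0 then \d_m A else normal_prob m (Num.sqrt v) A.

(* The conditions for subfamilies are the cases with some A i = setT. *)
Definition independent_variables P (n : nat) (Y : 'I_n -> Omega -> R) : Prop :=
  forall A : 'I_n -> set R, (forall i, measurable (A i)) ->
    P (\bigcap_i (Y i @^-1` A i)) = (\prod_(i < n) P (Y i @^-1` A i))%E.

(* Only the values of B at times t >= 0 matter. *)
Definition standard_wiener_process P B : Prop :=
  [/\ {ae P, forall w, B 0 w = 0},
      (forall s t : R, 0 <= s <= t ->
         has_normal_law P (fun w => B t w - B s w) 0 (t - s)),
      (forall (n : nat) (t : nat -> R), 0 <= t 0%N ->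
         {homo t : i j / (i <= j)%N >-> i <= j} ->
         independent_variables P
           (fun (i : 'I_n) w => B (t i.+1) w - B (t i) w)),
      (forall t : R, 0 <= t -> measurable_fun setT (B t)) &
      {ae P, forall w, {within [set t : R | 0 <= t], continuous (B ^~ w)}}].

(* Gaussian process indexed by the real line: every linear combination of its
   values is (possibly degenerate) normal. *)
Definition gaussian_process P (X : R -> Omega -> R) : Prop :=
  forall (n : nat) (t c : 'I_n -> R), exists m v : R,
    0 <= v /\ has_normal_law P (fun w => \sum_(i < n) c i * X (t i) w) m v.

Definition stationary_ornstein_uhlenbeck P (X : R -> Omega -> R) : Prop :=
  [/\ gaussian_process P X,
      (forall t, 'E_P[X t] = 0)%E,
      (forall s t, covariance P (X s) (X t) = (expR (- (`|t - s| / 2)))%:E) &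
      forall w, continuous (X ^~ w)].

Definition elementary_integral B (s : elementary) (w : Omega) : R :=
  \sum_(x <- s) x.1.1 * (B x.2 w - B x.1.2 w).

(* J = \int_0^t f dB for a deterministic integrand f in L^2[0, t]: J is the
   L^2(P)-limit of the integrals of elementary functions that converge to f in
   L^2[0, t]. *)
Definition is_ito_integral P B (f : R -> R) (t : R) (J : Omega -> R) : Prop :=
  measurable_fun setT J /\
  exists s : nat -> elementary,
    [/\ forall n, elementary_on t (s n),
        \int[lebesgue_measure]_(u in `[0%R, t])
           (((f u - elementary_fun (s n) u) ^+ 2)%R)%:E @[n --> \oo] --> 0%E &
        'E_P[fun w => ((J w - elementary_integral B (s n) w) ^+ 2)%R]
           @[n --> \oo] --> 0%E]%E.

Definition is_ito_integral_process P B T (f : R -> R) I : Prop :=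
  (forall t, time_interval T t -> is_ito_integral P B f t (I t)) /\
  {ae P, forall w, {within time_interval T, continuous (I ^~ w)}}.

(* Measurability with respect to the P-augmentation of
   sigma(B_s, 0 <= s <= t). *)
Definition measurable_wrt_past P B (t : R) X : Prop :=
  exists Y, {ae P, forall w, X w = Y w} /\
    forall A : set R, measurable A ->
      <<s [set C | exists s (A' : set R),
             [/\ 0 <= s <= t, measurable A' & C = B s @^-1` A'] ]>>
        (Y @^-1` A).

(* Z is a strong solution of
     dZ_t = (phi'(t) / phi(t) * Z_t + psi(t)) dt + sigma(t) dB_t  on [0, T)
   with Z_0 = xi. *)
Definition strong_solution P B T (phi psi sigma : R -> R) (xi : R) Z : Prop :=
  [/\ forall t, time_interval T t -> measurable_fun setT (Z t),
      forall t, time_interval T t -> measurable_wrt_past P B t (Z t),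
      {ae P, forall w, {within time_interval T, continuous (Z ^~ w)}},
      {ae P, forall w, Z 0 w = xi} &
      exists I, is_ito_integral_process P B T sigma I /\
        {ae P, forall w, forall t, time_interval T t ->
           Z t w = xi
             + \int[lebesgue_measure]_(u in `[0, t])
                 (derivative_within (time_interval T) phi u / phi u * Z u w
                  + psi u)
             + I t w}].

Definition centering P Z (t : R) (w : Omega) : R := Z t w - fine ('E_P[Z t])%E.

End processes.

(* Existence, on the probability space (Omega', Q), of an Ornstein-Uhlenbeck
   process X of which the process Ztilde, transported from (Omega, P) along
   pr, is the time change. *)
Definition ou_representation (R : realType)
  (T : \bar R) (phi sigma : R -> R)
  (d : measure_display) (Omega : measurableType d) (P : probability Omega R)
  (Ztilde : R -> Omega -> R)
  (d' : measure_display) (Omega' : measurableType d')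
  (Q : probability Omega' R) (pr : Omega' -> Omega) : Prop :=
  let rhs (X : R -> Omega' -> R) w := time_changed phi sigma (X ^~ w) in
  let Ztilde_T w := lim (Ztilde t w @[t --> from_below T]) in
  exists X : R -> Omega' -> R,
    [/\ stationary_ornstein_uhlenbeck Q X,
        {ae Q, forall w,
           rhs X w t @[t --> 0^'+] --> Ztilde 0 (pr w) /\
           forall t : R, 0 < t -> (t%:E < T)%E -> Ztilde t (pr w) = rhs X w t} &
        {ae P, forall w, Ztilde t w @[t --> from_below T] --> (0 : R)} ->
        {ae Q, forall w,
           [/\ rhs X w t @[t --> 0^'+] --> Ztilde 0 (pr w),
               (forall t : R, 0 < t -> (t%:E < T)%E ->
                  Ztilde t (pr w) = rhs X w t) &
               rhs X w t @[t --> from_below T] --> Ztilde_T (pr w)]}].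

(* Main.v *)
Require Import Defs.
From HB Require Import structures.
From mathcomp Require Import all_boot all_order all_algebra.
From mathcomp Require Import all_classical all_reals all_analysis.
From mathcomp Require Import measurable_realfun ring lra zify.
Import Order.TTheory GRing.Theory Num.Theory.
Import numFieldNormedType.Exports.
Local Open Scope classical_set_scope.
Local Open Scope ring_scope.

(** The solution of the equation is
      Z_t = phi(t) (xi + int_0^t psi / phi + N_t),  N_t = int_0^t (sigma / phi) dB,
    so that the centred process is phi(t) N_t. The process N has independent
    normal increments, and the variance of N_t is the clock
    A(t) = int_0^t (sigma / phi)^2: it is a Wiener process run at the time A.
    Setting W_(A(t)) := N_t therefore defines a Wiener process on the range of A,
    and X_s := e^(-s/2) W_(e^s) is a stationary Ornstein-Uhlenbeck process with
    N_t = sqrt(A(t)) X(ln A(t)).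

    If c = sup A is finite, W must be continued beyond the time c: first comes the
    integral of sigma / phi over the whole of [0, T), and then a Wiener process
    that is independent of B on [0, T). When T is finite the increments of B after
    T will do; in general a copy of B on a second factor of a product space is
    taken. When c is infinite nothing has to be added. The three cases share the
    interface [wiener_extension]; [clock_family] chooses the integrands, and
    [new_wiener] is the resulting W ([new_wiener_gaussian], [new_wiener_sqnB]).

    The identity N_t = sqrt(A(t)) X(ln A(t)) is first almost sure for each fixed t
    ([new_wiener_noise]). As X is given continuous paths by Kolmogorov's theorem
    ([continuous_modification], [ou_of_wiener]), both sides are continuous in t,
    and it suffices to know it at all rational t ([representation_of_extension]).

    The probability involved is that of Gaussian spaces. A [wiener_integral] is a
    limit in square mean of integrals of elementary functions; these are normal
    because sums of independent normal variables are ([gauss_law_conv],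
    [wiener_elementary_gaussian]), and normality and the isometry survive the
    limit. Independence is used only through the normality of linear combinations.

    That N_t, read off from Z, is the integral of sigma / phi is seen path by
    path: the increments of Z / phi over short intervals are those of the driving
    integral divided by phi, plus those of int psi / phi, up to a negligible error
    ([integrating_factor_cvg], [wiener_integral_noise]). *)

Set Implicit Arguments.
Unset Strict Implicit.
Unset Printing Implicit Defensive.

(** * Laws on the real line *)

Lemma bounded_cvg_integral d (T : measurableType d) (R : realType)
    (P : probability T R) (f_ : nat -> T -> R) (f : T -> R) :
  (forall n, measurable_fun setT (f_ n)) -> measurable_fun setT f ->
  (forall n x, 0 <= f_ n x <= 1) ->
  {ae P, forall x, f_ ^~ x @ \oo --> f x} ->
  (\int[P]_x (f_ n x)%:E)%E @[n --> \oo] --> (\int[P]_x (f x)%:E)%E.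
Proof.
move=> mf_ mf f01 ff.
have [] := @dominated_convergence _ _ _ P setT measurableT
  (fun n x => (f_ n x)%:E) (EFin \o f) (cst 1%E) => //.
- by move=> n; apply/measurable_EFinP.
- exact/measurable_EFinP.
- apply: filterS ff => x fx _; apply: cvg_EFin; first exact: nearW.
  exact: fx.
- exact: (finite_measure_integrable_cst P 1).
- apply: aeW => x n _ /=; have /andP[h0 h1] := f01 n x.
  by rewrite ger0_norm// lee_fin.
Qed.

Section law_unique.
Context {R : realType}.

Definition ramp (a : R) (k : nat) (x : R) : R :=
  Num.min 1 (k%:R * Num.max 0 (x - a)).

Lemma continuous_ramp a k : continuous (ramp a k).
Proof.
move=> x.
apply: (@continuous_min R R (cst 1) (fun x => k%:R * Num.max 0 (x - a))).
  exact: cvg_cst.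
apply: (@continuousM R R (cst k%:R) (fun x => Num.max 0 (x - a))).
  exact: cvg_cst.
apply: (@continuous_max R R (cst 0) (fun x => x - a)); first exact: cvg_cst.
by apply: continuousB; [exact: cvg_id|exact: cvg_cst].
Qed.

Lemma ramp_ge0_le1 a k x : 0 <= ramp a k x <= 1.
Proof. by rewrite /ramp le_min ler01 mulr_ge0 ?le_max ?lexx//= ge_min lexx. Qed.

Lemma ramp_cvg a x : ramp a k x @[k --> \oo] --> (\1_(`]a, +oo[) x : R).
Proof.
rewrite indicE; have [xa|ax] := leP x a.
  rewrite memNset /=; last by rewrite in_itv/= andbT; apply/negP; rewrite -leNgt.
  apply: cvg_near_cst; apply: nearW => k.
  by rewrite /ramp max_l ?subr_le0// mulr0 min_r.
rewrite mem_set /=; last by rewrite in_itv/= andbT.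
apply: cvg_near_cst; near=> k.
rewrite /ramp max_r ?subr_ge0 ?ltW// min_l//.
rewrite -ler_pdivrMr ?subr_gt0//; near: k; exact: nbhs_infty_ger.
Unshelve. all: by end_near. Qed.

(** Half-lines generate the Borel sets, and the indicator of ]a, +oo[ is the limit
    of the ramps. *)
Lemma law_unique (P Q : probability (measurableTypeR R) R) :
  (forall f : R -> R, continuous f -> (forall x, 0 <= f x <= 1) ->
     (\int[P]_x (f x)%:E = \int[Q]_x (f x)%:E)%E) ->
  forall A, measurable A -> P A = Q A.
Proof.
move=> PQ.
have half (P0 : probability (measurableTypeR R) R) a :
    (\int[P0]_x (ramp a k x)%:E)%E @[k --> \oo] --> P0 `]a, +oo[%classic.
  rewrite -[X in _ --> P0 X](setIT) -integral_indic//.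
  apply: bounded_cvg_integral => //.
  - by move=> n; apply: continuous_measurable_fun; exact: continuous_ramp.
  - by move=> n x; exact: ramp_ge0_le1.
  - by apply: aeW => x; exact: ramp_cvg.
have PQh a : P `]a, +oo[%classic = Q `]a, +oo[%classic.
  apply/(@cvg_unique _ (@ereal_hausdorff R) _ _ _ _ (half P a)).
  have PQr k : (\int[P]_x (ramp a k x)%:E = \int[Q]_x (ramp a k x)%:E)%E.
    by apply: PQ; [exact: continuous_ramp|exact: ramp_ge0_le1].
  by rewrite /= (eq_fun PQr); exact: half.
move=> A mA.
refine (@measure_unique _ R (measurableTypeR R) (@RGenOInfty.G R)
   (fun n => `](- n%:R), +oo[%classic) _ _ _ _ P Q _ _ A mA).
- exact: RGenOInfty.measurableE.
- move=> _ _ [a ->] [b ->]; exists (Num.max a b).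
  by apply/seteqP; split=> x /=; rewrite !in_itv/= !andbT gt_max => /andP.
- by move=> n; exists (- n%:R).
- rewrite -subTset => x _; exists (Num.truncn `|x|).+1 => //=.
  rewrite in_itv/= andbT ltrNl (le_lt_trans (ler_norm _))// normrN.
  exact: truncnS_gt.
- by move=> _ [a ->]; exact: PQh.
- by move=> n; apply: (le_lt_trans (probability_le1 _ _)) => //; exact: ltry.
Qed.

End law_unique.

(** * Normal densities *)

Section normal_density.
Context {R : realType}.
Local Notation mu := (@lebesgue_measure R).

Lemma ge0_integral_normal_prob (m s : R) (h : R -> \bar R) :
  measurable_fun setT h -> (forall x, 0 <= h x)%E ->
  (\int[normal_prob m s]_x h x = \int[mu]_x (h x * (normal_pdf m s x)%:E))%E.
Proof.
move=> mh h0.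
have dom := normal_prob_dominates m s.
rewrite -(Radon_Nikodym_SigmaFinite.change_of_variables dom)//.
have RNi := Radon_Nikodym_SigmaFinite.f_integrable dom.
have mp : measurable_fun setT (fun x => (normal_pdf m s x)%:E).
  by apply/measurable_EFinP; exact: measurable_normal_pdf.
apply: ae_eq_integral => //.
- apply: emeasurable_funM => //.
  exact: (measurable_int _ RNi).
- exact: emeasurable_funM.
- have : ae_eq mu setT (Radon_Nikodym_SigmaFinite.f (normal_prob m s) mu)
       (fun x => (normal_pdf m s x)%:E).
    apply: integral_ae_eq => //.
    by move=> E _ mE; rewrite -Radon_Nikodym_SigmaFinite.f_integral.
  by apply: filterS => x /= + _ => /(_ I) ->.
Qed.

Lemma integral_normal_prob (m s : R) (h : R -> R) :
  measurable_fun setT h -> (forall x, 0 <= h x) ->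
  (\int[normal_prob m s]_x (h x)%:E =
   \int[mu]_x (h x * normal_pdf m s x)%:E)%E.
Proof.
move=> mh h0; rewrite ge0_integral_normal_prob//.
exact/measurable_EFinP.
Qed.

Lemma ge0_integral_affine (s c : R) (G : R -> R) : 0 < s -> continuous G ->
  (forall x, 0 <= G x) ->
  (\int[mu]_x (G x)%:E = \int[mu]_x (G (s * x + c) * s)%:E)%E.
Proof.
move=> s0 cG G0; pose F x : R := s * x + c.
have dF (x : R) : is_derive x 1 F s.
  rewrite /F; apply: is_derive_eq.
  by rewrite addr0 /GRing.scale/= mulr1.
have F'E : F^`()%classic = cst s.
  by apply/funext => x; rewrite derive1E; apply: derive_val.
rewrite (@increasing_ge0_integration_by_substitutionT _ F G)//.
- by rewrite F'E.
- by move=> x y xy; rewrite /F ltrD2r ltr_pM2l.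
- by rewrite F'E => x; exact: cvg_cst.
- by rewrite F'E; exact: is_cvg_cst.
- by rewrite F'E; exact: is_cvg_cst.
- apply/cvgrNyPle => A; near=> x; rewrite /F -lerBrDr mulrC -(ler_pdivlMr _ _ s0).
  by near: x; apply: nbhs_ninfty_le; rewrite num_real.
- apply/cvgryPge => A; near=> x; rewrite /F -lerBlDr mulrC -(ler_pdivrMr _ _ s0).
  by near: x; apply: nbhs_pinfty_ge; rewrite num_real.
Unshelve. all: by end_near. Qed.

Local Notation p := (normal_pdf (0:R) 1).

Lemma std_normal_pdfE x : p x = normal_peak 1 * expR (- (x ^+ 2 / 2)).
Proof. by rewrite normal_pdfE ?oner_neq0// /normal_fun subr0 expr1n mulNr. Qed.

(** Dilations, symmetry and sums only use that a law has a density satisfying an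
    algebraic identity. *)
Section density.
Variables (N : probability (measurableTypeR R) R) (p : R -> R).
Hypothesis cp : continuous p.
Hypothesis p0 : forall x, 0 <= p x.
Hypothesis Np : forall h : R -> \bar R, measurable_fun setT h ->
  (forall x, 0 <= h x)%E -> (\int[N]_x h x = \int[mu]_x (h x * (p x)%:E))%E.

Let mp : measurable_fun setT p. Proof. exact: continuous_measurable_fun. Qed.

Lemma density_integral (h : R -> R) : measurable_fun setT h ->
  (forall x, 0 <= h x) ->
  (\int[N]_x (h x)%:E = \int[mu]_x (h x * p x)%:E)%E.
Proof. by move=> mh h0; rewrite Np//; exact/measurable_EFinP. Qed.

Lemma density_mass : (\int[mu]_x (p x)%:E = 1)%E.
Proof.
have N1 : (\int[N]_x (1%R)%:E = 1)%E.
  by rewrite integral_cst// mul1e; exact: probability_setT.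
rewrite -[RHS]N1 (@density_integral (fun=> 1))//.
by apply: eq_integral => x _; rewrite mul1r.
Qed.

Lemma density_scale (N' : probability (measurableTypeR R) R) (p' : R -> R)
    (s : R) (f : R -> R) : 0 < s -> continuous p' -> (forall x, 0 <= p' x) ->
  (forall h : R -> \bar R, measurable_fun setT h ->
    (forall x, 0 <= h x)%E -> (\int[N']_x h x = \int[mu]_x (h x * (p' x)%:E))%E) ->
  (forall x, p' (s * x) * s = p x) ->
  continuous f -> (forall x, 0 <= f x) ->
  (\int[N']_x (f x)%:E = \int[N]_x (f (s * x))%:E)%E.
Proof.
move=> s0 cp' p'0 N'p' p'E cf f0.
have mfs : measurable_fun setT (fun x => f (s * x)).
  apply: continuous_measurable_fun => x.
  by apply: (continuous_comp (@mulrl_continuous _ s x)); exact: cf.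
have mf : measurable_fun setT f by exact: continuous_measurable_fun.
rewrite density_integral// N'p'; last 2 first.
- exact/measurable_EFinP.
- by move=> x; rewrite lee_fin.
under eq_integral do rewrite -EFinM.
rewrite (@ge0_integral_affine s 0 (fun x => f x * p' x) s0).
- by apply: eq_integral => x _; rewrite addr0 -mulrA p'E.
- by move=> x; apply: continuousM; [exact: cf|exact: cp'].
- by move=> x; rewrite mulr_ge0.
Qed.

Lemma density_symmetric (f : R -> R) : (forall x, p (- x) = p x) ->
  measurable_fun setT f -> (forall x, 0 <= f x) ->
  (\int[N]_x (f (- x))%:E = \int[N]_x (f x)%:E)%E.
Proof.
move=> pN mf f0.
have mN : measurable_fun [set: measurableTypeR R]
    (-%R : measurableTypeR R -> measurableTypeR R).
  exact: oppr_measurable.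
have mfN : measurable_fun setT (fun x : R => f (- x)).
  exact: (measurableT_comp mf mN).
have mfp : measurable_fun setT (fun x => (f x * p x)%:E).
  by apply/measurable_EFinP; exact: measurable_funM mf mp.
rewrite !density_integral//.
rewrite [RHS](@eq_measure_integral _ _ _ _ (pushforward mu (-%R : R -> measurableTypeR R))); last first.
  by move=> A mA _; exact/esym/lebesgue_measureN.
rewrite (@ge0_integral_pushforward _ _ _ (measurableTypeR R) _ _ mN _ setT _ measurableT mfp).
  by apply: eq_integral => x _ /=; rewrite pN.
by move=> x _; rewrite lee_fin mulr_ge0.
Qed.

(** Substitute y = (ga z - al x) / be in the inner integral. By the hypothesis the
    weight p x p y then becomes p z times a density in x, of total mass 1. *)
Lemma density_sum (al be ga : R) (f : R -> R) : 0 < al -> 0 < be -> 0 < ga ->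
  (forall x z, p ((ga * z - al * x) / be) * p x =
               p z * p ((ga * x - al * z) / be)) ->
  continuous f -> (forall x, 0 <= f x) ->
  (\int[N]_x \int[N]_y (f (al * x + be * y))%:E =
   \int[N]_z (f (ga * z))%:E)%E.
Proof.
move=> al0 be0 ga0 rot cf f0.
have caff (u v : R) : continuous (fun y : R => u + v * y).
  move=> y; apply: continuousD; first exact: cvg_cst.
  exact: mulrl_continuous.
have inner x : (\int[N]_y (f (al * x + be * y))%:E =
    \int[mu]_z (f (ga * z) * p ((ga * z - al * x) / be) * (ga / be))%:E)%E.
  rewrite density_integral//; last first.
    apply: continuous_measurable_fun => y.
    by apply: (continuous_comp (caff _ _ _)); exact: cf.
  rewrite (@ge0_integral_affine (ga / be) (- (al * x / be)))//; last 3 first.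
  - by rewrite divr_gt0.
  - move=> y; apply: continuousM; last exact: cp.
    by apply: (continuous_comp (caff _ _ _)); exact: cf.
  - by move=> y; rewrite mulr_ge0.
  apply: eq_integral => z _; congr (_ * _ * _)%:E.
    by congr f; field; rewrite gt_eqF.
  by congr (p _); field; rewrite gt_eqF.
have mfga : measurable_fun setT (fun z => f (ga * z)).
  apply: continuous_measurable_fun => y.
  by apply: continuous_comp; [exact: mulrl_continuous|exact: cf].
pose j (xz : R * R) : R :=
  f (ga * xz.2) * p ((ga * xz.2 - al * xz.1) / be) * (ga / be).
have mj : measurable_fun setT j.
  apply: measurable_funM; last by [].
  apply: measurable_funM.
    exact: (measurableT_comp mfga measurable_snd).
  apply: (measurableT_comp mp); apply: measurable_funM => //.
  by apply: measurable_funB; apply: measurable_funM => //.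
have j0 xz : 0 <= j xz.
  by rewrite /j; apply: mulr_ge0; [exact: mulr_ge0|apply: divr_ge0; exact: ltW].
pose k (xz : R * R) := j xz * p xz.1.
have mk : measurable_fun setT k.
  by apply: measurable_funM => //; exact: (measurableT_comp mp measurable_fst).
have k0 xz : 0 <= k xz by rewrite /k mulr_ge0.
have kE x z : k (x, z) = (f (ga * z) * p z) *
    (p ((ga / be) * x + (- (al * z / be))) * (ga / be)).
  rewrite /k/j/= mulrAC -[X in X * _]mulrA rot !mulrA.
  by congr (_ * _ * p _ * _ / _); field; rewrite gt_eqF.
transitivity (\int[mu]_x \int[mu]_z (k (x, z))%:E)%E.
  transitivity (\int[N]_x \int[mu]_z (j (x, z))%:E)%E.
    by apply: eq_integral => x _; exact: inner.
  rewrite Np//; last 2 first.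
  - apply: (@measurable_fun_fubini_tonelli_F _ _ _ _ _ mu (fun xz => (j xz)%:E)).
    + exact/measurable_EFinP.
    + by move=> xz; rewrite lee_fin.
  - by move=> x; apply: integral_ge0 => z _; rewrite lee_fin.
  apply: eq_integral => x _; rewrite -ge0_integralZr//.
  - apply/measurable_EFinP; exact: (measurableT_comp mj (measurable_pair1 x)).
  - by move=> z _; rewrite lee_fin.
  - by rewrite lee_fin.
rewrite (@fubini_tonelli _ _ _ _ _ mu mu (fun xz => (k xz)%:E))//=; last first.
  by apply/measurable_EFinP.
rewrite density_integral//.
apply: eq_integral => z _.
transitivity (\int[mu]_x ((f (ga * z) * p z)%:E *
    (p ((ga / be) * x + (- (al * z / be))) * (ga / be))%:E))%E.
  by apply: eq_integral => x _; rewrite -EFinM kE.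
rewrite ge0_integralZl//; last 3 first.
- apply/measurable_EFinP; apply: measurable_funM => //.
  apply: (measurableT_comp mp); apply: measurable_funD => //.
- by move=> x _; rewrite lee_fin mulr_ge0// divr_ge0// ltW.
- by rewrite lee_fin mulr_ge0.
rewrite -(@ge0_integral_affine (ga / be) _ p)// ?divr_gt0//.
by rewrite density_mass mule1.
Qed.

End density.
Lemma normal_pdf_scale (s x : R) : 0 < s -> normal_pdf 0 s (s * x) * s = p x.
Proof.
move=> s0; rewrite std_normal_pdfE normal_pdfE ?gt_eqF// /normal_fun subr0.
rewrite mulrAC; congr (_ * expR _).
  rewrite /normal_peak -!mulrnAr expr1n mul1r sqrtrM ?sqr_ge0// sqrtr_sqr.
  by rewrite gtr0_norm// invfM mulrAC mulVf ?mul1r// gt_eqF.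
rewrite mulNr; congr (- _); rewrite exprMn -(mulr_natr (s ^+ 2)).
have s2 : s ^+ 2 != 0 by rewrite sqrf_eq0 gt_eqF.
by field; rewrite gt_eqF.
Qed.

(** The points (x, (ga z - al x) / be) and (z, (ga x - al z) / be) of the plane have
    the same norm, and p x p y depends on the norm of (x, y) only. *)
Lemma std_normal_pdf_rot (al be ga x z : R) : be != 0 ->
  al ^+ 2 + be ^+ 2 = ga ^+ 2 ->
  p ((ga * z - al * x) / be) * p x = p z * p ((ga * x - al * z) / be).
Proof.
move=> be0 abg; rewrite !std_normal_pdfE.
rewrite mulrACA [RHS]mulrACA -!expRD; congr (_ * expR _).
rewrite -!opprD -!mulrDl; congr (- (_ / _)).
rewrite !expr_div_n; apply: (mulIf (expf_neq0 2 be0)).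
rewrite !mulrDl !divfK ?expf_neq0//.
rewrite !sqrrB !exprMn -abg; ring.
Qed.

Lemma continuous_std_normal_pdf : continuous p.
Proof. by apply: continuous_normal_pdf; rewrite oner_neq0. Qed.

Lemma integral_normal_scale (s : R) (f : R -> R) : 0 < s -> continuous f ->
  (forall x, 0 <= f x) ->
  (\int[normal_prob 0 s]_x (f x)%:E = \int[normal_prob 0 1]_x (f (s * x))%:E)%E.
Proof.
move=> s0;
apply: (@density_scale (normal_prob 0 1) p _ (normal_prob 0 s)
  (normal_pdf 0 s) s f) => //.
- by move=> h mh h0; exact: ge0_integral_normal_prob.
- by apply: continuous_normal_pdf; rewrite gt_eqF.
- by move=> x; exact: normal_pdf_ge0.
- by move=> h mh h0; exact: ge0_integral_normal_prob.
- by move=> x; exact: normal_pdf_scale.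
Qed.

Lemma integral_std_normalN (f : R -> R) : measurable_fun setT f ->
  (forall x, 0 <= f x) ->
  (\int[normal_prob 0 1]_x (f (- x))%:E = \int[normal_prob 0 1]_x (f x)%:E)%E.
Proof.
apply: (@density_symmetric (normal_prob 0 1) p).
- exact: continuous_std_normal_pdf.
- by move=> x; exact: normal_pdf_ge0.
- by move=> h mh h0; exact: ge0_integral_normal_prob.
- by move=> x; rewrite !std_normal_pdfE sqrrN.
Qed.

Lemma integral_std_normal_sum (a b : R) (f : R -> R) : 0 <= a -> 0 <= b ->
  continuous f -> (forall x, 0 <= f x) ->
  (\int[normal_prob 0 1]_x \int[normal_prob 0 1]_y
      (f (Num.sqrt a * x + Num.sqrt b * y))%:E =
   \int[normal_prob 0 1]_z (f (Num.sqrt (a + b) * z))%:E)%E.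
Proof.
rewrite le_eqVlt => /predU1P[<- b0 cf f0|a0].
  rewrite add0r sqrtr0; under eq_integral do under eq_integral do rewrite mul0r add0r.
  by rewrite integral_cst//= [X in (_ * X)%E]integral_normal_pdf mule1.
rewrite le_eqVlt => /predU1P[<- cf f0|b0 cf f0].
  rewrite addr0 sqrtr0; under eq_integral do under eq_integral do rewrite mul0r addr0.
  apply: eq_integral => x _.
  by rewrite integral_cst//= [X in (_ * X)%E]integral_normal_pdf mule1.
have [al0 be0 ga0] : [/\ 0 < Num.sqrt a, 0 < Num.sqrt b & 0 < Num.sqrt (a + b)].
  by rewrite !sqrtr_gt0 addr_gt0.
apply: (@density_sum (normal_prob 0 1) p) => //.
- exact: continuous_std_normal_pdf.
- by move=> x; exact: normal_pdf_ge0.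
- by move=> h mh h0; exact: ge0_integral_normal_prob.
- move=> x z; apply: std_normal_pdf_rot; first by rewrite gt_eqF.
  by rewrite !sqr_sqrtr ?addr_ge0// ltW.
Qed.
End normal_density.

(** * Centered normal laws *)

Section gauss_law.
Context {R : realType}.
Local Notation std := (@normal_prob R 0 1).

Definition scaling (v : R) (x : measurableTypeR R) : measurableTypeR R :=
  Num.sqrt v * x.

Lemma measurable_scaling v : measurable_fun setT (scaling v).
Proof. exact: mulrl_measurable. Qed.

HB.instance Definition _ v :=
  isMeasurableFun.Build _ _ _ _ (scaling v) (@measurable_scaling v).

(** The law of a centered normal variable of variance [v], the point mass at
    0 for [v = 0]: a dilation of the standard normal law. *)
Definition gauss_law (v : R) : probability (measurableTypeR R) R :=
  distribution std (scaling v).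

Lemma integral_gauss_law v (h : R -> \bar R) : measurable_fun setT h ->
  (forall x, 0 <= h x)%E ->
  (\int[gauss_law v]_x h x = \int[std]_x h (Num.sqrt v * x)%R)%E.
Proof.
by move=> mh h0; rewrite (@ge0_integral_distribution _ _ _ _ _ std (scaling v)).
Qed.

End gauss_law.

Section gauss_law_theory.
Context {R : realType}.
Local Notation std := (@normal_prob R 0 1).
Local Notation p := (normal_pdf (0:R) 1).
Local Notation mu := (@lebesgue_measure R).

Lemma gauss_lawE (v : R) (A : set R) : measurable A -> 0 <= v ->
  gauss_law v A = if v == 0 then \d_(0 : R) A else normal_prob 0 (Num.sqrt v) A.
Proof.
move=> mA v0; case: ifPn => [/eqP ->|vn0].
  rewrite /gauss_law /distribution /pushforward /=.
  have [A0|A0] := pselect (A 0).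
    rewrite diracE mem_set// (_ : _ @^-1` A = setT) ?probability_setT//.
    by apply/seteqP; split=> // x _ /=; rewrite /scaling sqrtr0 mul0r.
  rewrite diracE memNset// (_ : _ @^-1` A = set0) ?measure0//.
  by apply/seteqP; split=> // x /=; rewrite /scaling sqrtr0 mul0r.
apply/esym/(@law_unique R (normal_prob 0 (Num.sqrt v)) (gauss_law v) _ A mA) => f cf f01.
have f0 x : 0 <= f x by have /andP[] := f01 x.
rewrite (@integral_gauss_law _ v (EFin \o f)).
- by rewrite integral_normal_scale// sqrtr_gt0 lt_neqAle eq_sym vn0.
- by apply/measurable_EFinP; exact: continuous_measurable_fun.
- by move=> x; rewrite lee_fin.
Qed.

Let addR (xy : measurableTypeR R * measurableTypeR R) : measurableTypeR R :=
  xy.1 + xy.2.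
Let maddR : measurable_fun setT addR.
Proof. exact: measurable_funD. Qed.
HB.instance Definition _ := isMeasurableFun.Build _ _ _ _ addR maddR.

(** Tonelli's theorem reduces this to the rotation invariance behind
    [integral_std_normal_sum]. *)
Lemma gauss_law_conv (a b : R) : 0 <= a -> 0 <= b ->
  forall A : set R, measurable A ->
  (gauss_law a \x gauss_law b)%E [set xy | A (xy.1 + xy.2)] = gauss_law (a + b) A.
Proof.
move=> a0 b0.
apply: (@law_unique R (distribution (gauss_law a \x gauss_law b)%E addR)) => f cf f01.
have f0 x : 0 <= f x by have /andP[] := f01 x.
have mf : measurable_fun setT f by exact: continuous_measurable_fun.
have mfE : measurable_fun setT (EFin \o f) by exact/measurable_EFinP.
rewrite [LHS](@ge0_integral_distribution _ _ _ _ _ (gauss_law a \x gauss_law b)%E addR)//.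
have mfa : measurable_fun setT (fun xy : measurableTypeR R * measurableTypeR R => (f (xy.1 + xy.2))%:E).
  by apply/measurable_EFinP; exact: (measurableT_comp mf maddR).
have fa0 (xy : measurableTypeR R * measurableTypeR R) : (0 <= (f (xy.1 + xy.2))%:E)%E.
  by rewrite lee_fin.
transitivity (\int[gauss_law a]_x \int[gauss_law b]_y (f (x + y))%:E)%E.
  exact: (@fubini_tonelli1 _ _ _ _ _ (gauss_law a) (gauss_law b) _ mfa fa0).
have mF : measurable_fun setT (fun x : measurableTypeR R => (\int[gauss_law b]_y (f (x + y))%:E)%E).
  exact: (@measurable_fun_fubini_tonelli_F _ _ _ _ _ (gauss_law b) _ mfa fa0).
rewrite (@integral_gauss_law _ a _ mF); last first.
  by move=> x; apply: integral_ge0 => y _; rewrite lee_fin.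
rewrite (@integral_gauss_law _ (a + b) _ mfE); last by move=> x; rewrite lee_fin.
apply: etrans (integral_std_normal_sum a0 b0 cf f0).
apply: eq_integral => x _.
apply: (@integral_gauss_law _ b (fun y : R => (f (Num.sqrt a * x + y))%:E)).
- apply/measurable_EFinP; apply: (measurableT_comp mf).
  exact: measurable_funD.
- by move=> y; rewrite lee_fin.
Qed.

Let p0 x : 0 <= p x. Proof. exact: normal_pdf_ge0. Qed.
Let cp : continuous p. Proof. exact: continuous_std_normal_pdf. Qed.
Let mp : measurable_fun setT p. Proof. exact: measurable_normal_pdf. Qed.

Lemma derive_std_normal_pdf (x : R) : is_derive x 1 p (- (x * p x)).
Proof.
rewrite (_ : p = fun x => normal_peak 1 * expR (- (x ^+ 2 / 2))); last first.
  by apply/funext => y; rewrite std_normal_pdfE.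
apply: is_derive_eq.
rewrite /GRing.scale/=; field => //.
Qed.

Lemma std_normal_tail_cvg : n%:R * p n%:R @[n --> \oo] --> (0 : R).
Proof.
apply: (@squeeze_cvgr _ _ _ _ (cst 0) (fun n => normal_peak 1 * 2 * n%:R^-1)).
- near=> n; rewrite mulr_ge0//= std_normal_pdfE.
  have n0 : 0 < n%:R :> R by rewrite ltr0n; near: n; exact: nbhs_infty_gt.
  rewrite mulrCA -mulrA ler_wpM2l ?normal_peak_ge0//.
  rewrite expRN ler_pdivrMr ?expR_gt0//.
  rewrite mulrAC ler_pdivlMr// -expr2 mulrC -ler_pdivrMr//.
  by rewrite (le_trans _ (expR_ge1Dx _))// lerDr.
- exact: cvg_cst.
- rewrite -[X in _ --> X](mulr0 (normal_peak 1 * 2)).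
  by apply: cvgMr; rewrite -(cvg_shiftS (fun n => n%:R^-1 : R)); exact: cvg_harmonic.
Unshelve. all: by end_near. Qed.

(** The function - x p(x) is a primitive of (x^2 - 1) p(x). *)
Lemma integral_std_normal_sqr_itv (n : nat) : (0 < n)%N ->
  (\int[mu]_(x in `[(- n%:R)%R, n%:R%R]) (x ^+ 2 * p x)%:E =
   \int[mu]_(x in `[(- n%:R)%R, n%:R%R]) (p x)%:E - (2 * (n%:R * p n%:R))%:E)%E.
Proof.
move=> n0.
pose F x : R := - (x * p x).
have dF (x : R) : is_derive x 1 F ((x ^+ 2 - 1) * p x).
  have dp := derive_std_normal_pdf x.
  rewrite /F; apply: is_derive_eq; rewrite /GRing.scale/=; ring.
have cx2p : continuous (fun x : R => x ^+ 2 * p x).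
  by move=> x; apply: (@continuousM R R (fun x => x ^+ 2) p); [exact: exprn_continuous|exact: cp].
have cf : continuous (fun x : R => (x ^+ 2 - 1) * p x).
  move=> x; apply: (@continuousM R R (fun x => x ^+ 2 - 1) p); last exact: cp.
  by apply: continuousB; [exact: exprn_continuous|exact: cvg_cst].
have FTC : (\int[mu]_(x in `[(- n%:R)%R, n%:R%R]) ((x ^+ 2 - 1) * p x)%:E =
    (F n%:R)%:E - (F (- n%:R))%:E)%E.
  apply: continuous_FTC2.
  - by rewrite gtrN// ltr0n.
  - exact: continuous_subspaceT.
  - have cF : continuous F.
      move=> x; apply: differentiable_continuous; apply/derivable1_diffP.
      exact: (@ex_derive _ _ _ _ _ _ _ (dF x)).
    split.
    + by move=> x _; exact: (@ex_derive _ _ _ _ _ _ _ (dF x)).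
    + exact/cvg_at_right_filter/cF.
    + exact/cvg_at_left_filter/cF.
  - by move=> x _; rewrite derive1E; exact: (@derive_val _ _ _ _ _ _ _ (dF x)).
have itv (f : R -> R) : continuous f ->
    mu.-integrable `[- n%:R, n%:R] (EFin \o f).
  move=> cg; apply: continuous_compact_integrable.
    exact: segment_compact.
  exact: continuous_subspaceT.
transitivity (\int[mu]_(x in `[(- n%:R)%R, n%:R%R]) ((p x)%:E + ((x ^+ 2 - 1) * p x)%:E))%E.
  by apply: eq_integral => x _; rewrite -EFinD; congr EFin; ring.
rewrite integralD//=; last 2 first.
- exact: (itv p).
- exact: (itv _ cf).
rewrite FTC -EFinB; congr (_ + _%:E)%E; rewrite /F.
by rewrite (_ : p (- n%:R) = p n%:R) ?std_normal_pdfE ?sqrrN//; ring.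
Qed.

Lemma std_normal_second_moment : (\int[std]_x (x ^+ 2)%:E = 1)%E.
Proof.
rewrite integral_normal_prob//; last first.
  by move=> x; exact: sqr_ge0.
have cov (f : R -> R) : measurable_fun setT f -> (forall x, 0 <= f x) ->
   (\int[mu]_(x in `[(- n%:R)%R, n%:R%R]) (f x)%:E)%E @[n --> \oo] -->
   (\int[mu]_x (f x)%:E)%E.
  move=> mf f0.
  rewrite (_ : setT = \bigcup_n `[- (n%:R : R), n%:R]%classic); last first.
    apply/esym; rewrite -subTset => x _; exists (Num.truncn `|x|).+1 => //=.
    by rewrite in_itv/= -ler_norml ltW// truncnS_gt.
  apply: ge0_nondecreasing_set_cvg_integral => //.
  - move=> m n mn; apply/subsetPset => x /=; rewrite !in_itv/= => /andP[h1 h2].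
    rewrite (le_trans _ h1) ?lerN2 ?ler_nat//= (le_trans h2)//.
    by rewrite ler_nat.
  - by move=> i; apply/measurable_EFinP; exact: measurable_funS mf.
  - by move=> i x _; rewrite lee_fin.
have := cov _ mp p0; rewrite integral_normal_pdf => hp.
have mx2p : measurable_fun setT (fun x : R => x ^+ 2 * p x).
  exact: measurable_funM.
have x2p0 x : 0 <= x ^+ 2 * p x by rewrite mulr_ge0// sqr_ge0.
apply: (@cvg_unique _ (@ereal_hausdorff R) _ _ _ _ (cov _ mx2p x2p0)).
have hlim : ((\int[mu]_(x in `[(- n%:R)%R, n%:R%R]) (p x)%:E - (2 * (n%:R * p n%:R))%:E)%E
    @[n --> \oo] --> (1 - (2 * 0)%:E)%E).
  apply: cvgeB => //; apply: cvg_EFin; first exact: nearW.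
  by apply: cvgMr; exact: std_normal_tail_cvg.
rewrite mulr0 sube0 in hlim.
apply: cvg_trans hlim; apply: near_eq_cvg; near=> n.
rewrite -integral_std_normal_sqr_itv//; near: n; exact: nbhs_infty_gt.
Unshelve. all: by end_near. Qed.

(** A multiple of the normal density of variance 2 dominates x^4 p(x). *)
Lemma std_normal_fourth_moment_lty : (\int[std]_x (x ^+ 4)%:E < +oo)%E.
Proof.
have x40 (x : R) : 0 <= x ^+ 4 by rewrite (exprM x 2 2) sqr_ge0.
rewrite integral_normal_prob//.
set q := normal_pdf (0 : R) (Num.sqrt 2).
(* With u = x^2 / 4: x^4 = 16 u^2 <= 64 e^u, because (1 + u / 2)^2 <= e^u. *)
pose C := 64 * normal_peak 1 / normal_peak (Num.sqrt 2) : R.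
have s20 : Num.sqrt 2 != 0 :> R by rewrite gt_eqF// sqrtr_gt0.
have C0 : 0 <= C by rewrite divr_ge0 ?mulr_ge0 ?normal_peak_ge0.
apply: (@le_lt_trans _ _ (\int[mu]_x (C%:E * (q x)%:E))%E).
  apply: ge0_le_integral => //.
  - by move=> x _; rewrite lee_fin mulr_ge0.
  - by apply/measurable_EFinP/measurable_funM.
  - apply: emeasurable_funM => //; apply/measurable_EFinP.
    exact: measurable_normal_pdf.
  - move=> x _; rewrite -EFinM lee_fin std_normal_pdfE /q normal_pdfE//.
    rewrite /normal_fun subr0 sqr_sqrtr// /C.
    have pk : 0 < normal_peak (Num.sqrt 2) :> R by exact: normal_peak_gt0.
    rewrite -[leRHS]mulrA (mulrA _^-1) mulVf ?gt_eqF// mul1r.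
    rewrite (mulrC 64) -[leRHS]mulrA mulrCA ler_wpM2l ?normal_peak_ge0//.
    set u := x ^+ 2 / 4.
    have -> : x ^+ 4 = 16 * u ^+ 2 by rewrite /u; field.
    have -> : - (x ^+ 2 / 2) = - u - u by rewrite /u; field.
    have -> : - x ^+ 2 / (2 *+ 2) = - u by rewrite /u; field.
    have u0 : 0 <= u by rewrite divr_ge0// sqr_ge0.
    rewrite expRD mulrA -[leRHS]mulr1 [leRHS]mulrAC ler_wpM2r ?expR_ge0//.
    rewrite expRN ler_pdivrMr ?expR_gt0// mulr1.
    have -> : expR u = expR (u / 2) ^+ 2 by rewrite -expRM_natl; congr expR; field.
    have h : 1 + u / 2 <= expR (u / 2) by exact: expR_ge1Dx.
    have : (1 + u / 2) ^+ 2 <= expR (u / 2) ^+ 2.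
      by rewrite ler_sqr// nnegrE ?expR_ge0// addr_ge0// divr_ge0.
    nra.
rewrite ge0_integralZl//.
- by rewrite integral_normal_pdf mule1 ltry.
- by apply/measurable_EFinP; exact: measurable_normal_pdf.
- by move=> x _; rewrite lee_fin normal_pdf_ge0.
Qed.

End gauss_law_theory.

(** * Centered normal random variables *)

Section gaussian_variables.
Context d (T : measurableType d) (R : realType) (P : probability T R).
Local Notation std := (@normal_prob R 0 1).
Implicit Types X Y : T -> R.

(** The normal law N(0, v), without a case distinction at v = 0; see
    [gaussian_has_normal_law]. *)
Definition gaussian X (v : R) : Prop := measurable_fun setT X /\
  forall A : set R, measurable A -> P (X @^-1` A) = gauss_law v A.

Lemma gaussian_measurable X v : gaussian X v -> measurable_fun setT X.
Proof. by case. Qed.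

Let RV X (mX : measurable_fun setT X) : {RV P >-> measurableTypeR R} :=
  HB.pack_for {mfun T >-> measurableTypeR R} (X : T -> measurableTypeR R)
    (isMeasurableFun.Build _ _ _ _ (X : T -> measurableTypeR R) mX).

Lemma gaussian_integral X v (h : R -> \bar R) : gaussian X v ->
  measurable_fun setT h -> (forall x, 0 <= h x)%E ->
  (\int[P]_w h (X w) = \int[std]_x h (Num.sqrt v * x)%R)%E.
Proof.
move=> [mX Xv] mh h0.
apply: etrans (integral_gauss_law v mh h0).
apply: etrans (esym (ge0_integral_distribution (RV mX) mh h0)) _.
by apply: eq_measure_integral => A mA _; exact: Xv.
Qed.

Lemma gaussianP X v : measurable_fun setT X ->
  (forall f : R -> R, continuous f -> (forall x, 0 <= f x <= 1) ->
     (\int[P]_w (f (X w))%:E = \int[std]_x (f (Num.sqrt v * x))%:E)%E) ->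
  gaussian X v.
Proof.
move=> mX XE; split=> // A mA.
apply: (@law_unique R (distribution P (RV mX)) (gauss_law v) _ A mA) => f cf f01.
have f0 x : (0 <= (f x)%:E)%E by have /andP[] := f01 x; rewrite lee_fin.
have mf : measurable_fun setT (EFin \o f).
  by apply/measurable_EFinP; exact: continuous_measurable_fun.
apply: etrans (ge0_integral_distribution (RV mX) mf f0) _.
apply: etrans (XE f cf f01) _.
exact: esym (integral_gauss_law v mf f0).
Qed.

Lemma gaussian_has_normal_law X v : 0 <= v ->
  gaussian X v <-> has_normal_law P X 0 v.
Proof.
by move=> v0; split=> -[mX Xv]; split=> // A mA; rewrite Xv// gauss_lawE.
Qed.

Lemma gaussian_ae X Y v : gaussian X v -> measurable_fun setT Y ->
  {ae P, forall w, X w = Y w} -> gaussian Y v.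
Proof.
move=> Xv mY XY; have mX := gaussian_measurable Xv.
apply: gaussianP => // f cf f01.
have f0 x : (0 <= (f x)%:E)%E by have /andP[] := f01 x; rewrite lee_fin.
have mf : measurable_fun setT f by exact: continuous_measurable_fun.
have mfE : measurable_fun setT (EFin \o f) by exact/measurable_EFinP.
apply: etrans (gaussian_integral Xv mfE f0).
apply: ge0_ae_eq_integral => //.
- by apply/measurable_EFinP; exact: measurableT_comp.
- by apply/measurable_EFinP; exact: measurableT_comp.
- by move=> w _; exact: f0.
- by move: XY; apply: filterS => w /= -> _.
Qed.

Lemma gaussian_scale c X v : 0 <= v -> gaussian X v ->
  gaussian (fun w => c * X w) (c ^+ 2 * v).
Proof.
move=> v0 Xv; have mX := gaussian_measurable Xv.
have mcX : measurable_fun setT (fun w => c * X w) by exact: measurable_funM.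
apply: gaussianP => // f cf f01.
have f0 x : 0 <= f x by have /andP[] := f01 x.
have mfc (k : R) : measurable_fun setT (fun x => f (k * x)).
  apply: continuous_measurable_fun => x.
  by apply: (continuous_comp (@mulrl_continuous _ k x)); exact: cf.
have mfcE (k : R) : measurable_fun setT (fun x => (f (k * x))%:E).
  exact/measurable_EFinP.
have f0E (k x : R) : (0 <= (f (k * x))%:E)%E by rewrite lee_fin.
apply: etrans (gaussian_integral Xv (mfcE c) (f0E c)) _.
rewrite sqrtrM ?sqr_ge0// sqrtr_sqr.
have [c0|c0] := leP 0 c.
  by apply: eq_integral => x _; rewrite ger0_norm// mulrA.
apply: etrans (integral_std_normalN (mfc (`|c| * Num.sqrt v)) _) => //.
by apply: eq_integral => x _; rewrite ltr0_norm// !mulNr mulrN opprK mulrA.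
Qed.

Lemma gaussian_second_moment X v : 0 <= v -> gaussian X v ->
  (\int[P]_w (X w ^+ 2)%:E = v%:E)%E.
Proof.
move=> v0 Xv.
rewrite (@gaussian_integral X v (fun x => (x ^+ 2)%:E))//; last 2 first.
- by apply/measurable_EFinP.
- by move=> x; rewrite lee_fin sqr_ge0.
under eq_integral do rewrite exprMn sqr_sqrtr// EFinM.
rewrite ge0_integralZl//; last 2 first.
- by apply/measurable_EFinP.
- by move=> x _; rewrite lee_fin sqr_ge0.
by rewrite std_normal_second_moment mule1.
Qed.

Definition std_kurtosis : R := fine (\int[std]_x (x ^+ 4)%:E)%E.

Lemma gaussian_fourth_moment X v : 0 <= v -> gaussian X v ->
  (\int[P]_w (X w ^+ 4)%:E = (std_kurtosis * v ^+ 2)%:E)%E.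
Proof.
move=> v0 Xv.
have x40 (x : R) : 0 <= x ^+ 4 by rewrite (exprM x 2 2) sqr_ge0.
rewrite (@gaussian_integral X v (fun x => (x ^+ 4)%:E))//; last first.
  exact/measurable_EFinP.
under eq_integral do rewrite exprMn (exprM _ 2 2) sqr_sqrtr// EFinM.
rewrite ge0_integralZl//; last 3 first.
- by apply/measurable_EFinP.
- by move=> x _; rewrite lee_fin.
- by rewrite lee_fin sqr_ge0.
rewrite [in RHS]mulrC [in RHS]EFinM; congr mule.
rewrite /std_kurtosis fineK// ge0_fin_numE.
  exact: std_normal_fourth_moment_lty.
by apply: integral_ge0 => x _; rewrite lee_fin.
Qed.

Lemma integrable_of_sqr X : measurable_fun setT X ->
  (\int[P]_w (X w ^+ 2)%:E < +oo)%E -> P.-integrable setT (EFin \o X).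
Proof.
move=> mX X2.
have m2 : measurable_fun setT (fun w => X w ^+ 2) by exact: measurable_funX.
have i2 : P.-integrable setT (fun w => (X w ^+ 2)%:E).
  apply/integrableP; split; first exact/measurable_EFinP.
  by under eq_integral do rewrite gee0_abs ?lee_fin ?sqr_ge0//.
have i1 : P.-integrable setT (EFin \o cst 1).
  exact: (finite_measure_integrable_cst P 1).
apply: (le_integrable measurableT _ _ (integrableD measurableT i1 i2)).
- exact/measurable_EFinP.
- move=> w _; rewrite /= lee_fin [leRHS]ger0_norm; last first.
    by rewrite addr_ge0// sqr_ge0.
  rewrite -real_normK ?num_real//; nra.
Qed.

Lemma gaussian_integrable X v : 0 <= v -> gaussian X v ->
  P.-integrable setT (EFin \o X).
Proof.
move=> v0 Xv; apply: integrable_of_sqr; first exact: gaussian_measurable Xv.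
by rewrite (gaussian_second_moment v0 Xv) ltry.
Qed.

Lemma gaussian_mean X v : 0 <= v -> gaussian X v ->
  (\int[P]_w (X w)%:E = 0)%E.
Proof.
move=> v0 Xv; have iX := gaussian_integrable v0 Xv.
have NXv : gaussian (fun w => - X w) v.
  have := gaussian_scale (-1) v0 Xv; rewrite sqrrN expr1n mul1r.
  by under eq_fun do rewrite mulN1r.
pose h (x : R) := maxe x%:E 0.
have mh : measurable_fun setT h.
  by apply: measurable_maxe => //; exact/measurable_EFinP.
have h0 x : (0 <= h x)%E by rewrite /h le_max lexx orbT.
have XN : (\int[P]_w h (X w) = \int[P]_w h (- X w)%R)%E.
  by rewrite (gaussian_integral Xv mh h0) (gaussian_integral NXv mh h0).
rewrite integralE.
have -> : ((fun w => (X w)%:E)^\+ = fun w => h (X w))%E.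
  by apply/funext => w; rewrite funeposE.
have -> : ((fun w => (X w)%:E)^\- = fun w => h (- X w)%R)%E.
  by apply/funext => w; rewrite funenegE.
rewrite -XN subee//.
have := integrable_pos_fin_num measurableT iX.
by under eq_integral do rewrite funeposE.
Qed.

End gaussian_variables.
Arguments std_kurtosis {R}.

Section gaussian_sum.
Context d (T : measurableType d) (R : realType).

(** Independence of X and Y conditionally on an event: nu is the restriction of a
    probability to that event and k its probability. This is the form in which
    sums are built up one increment at a time in [joint_law]. *)
Lemma gaussian_add_law (nu : {measure set T -> \bar R}) (k : R) (X Y : T -> R) a b :
  measurable_fun setT X -> measurable_fun setT Y -> 0 <= k -> 0 <= a -> 0 <= b ->
  (forall A B : set R, measurable A -> measurable B ->
     nu (X @^-1` A `&` Y @^-1` B) = (k%:E * (gauss_law a A * gauss_law b B))%E) ->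
  forall A : set R, measurable A ->
    nu ((fun w => X w + Y w) @^-1` A) = (k%:E * gauss_law (a + b) A)%E.
Proof.
move=> mX mY k0 a0 b0 XY A mA.
have mXY : measurable_fun setT (fun w => X w + Y w) by exact: measurable_funD.
have mXYA : measurable ((fun w => X w + Y w) @^-1` A).
  by rewrite -[X in measurable X]setTI; exact: mXY.
have nuT : nu setT = k%:E.
  have := XY setT setT measurableT measurableT.
  by rewrite !preimage_setT setIT !probability_setT !mule1.
move: k0; rewrite le_eqVlt => /predU1P[k0|k0].
  rewrite -k0 mul0e; apply/eqP; rewrite -measure_le0 (_ : 0 = nu setT)%E; last by rewrite nuT -k0.
  by apply: le_measure; rewrite ?inE.
(* By uniqueness of product measures nu / k transports to the product law. *)
pose XYm : T -> measurableTypeR R * measurableTypeR R := fun w => (X w, Y w).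
have mXYm : measurable_fun setT XYm by exact: measurable_fun_pair.
have ki0 : 0 <= k^-1 by rewrite invr_ge0 ltW.
pose m : {measure set (measurableTypeR R * measurableTypeR R) -> \bar R} :=
  mscale (NngNum ki0) (measure_function_pushforward__canonical__measure_function_Measure nu mXYm).
have mE (Z : set (measurableTypeR R * measurableTypeR R)) : measurable Z ->
    (gauss_law a \x gauss_law b)%E Z = m Z.
  apply: (@product_measure_unique _ _ _ _ _ (gauss_law a) (gauss_law b) m) => A' B' mA' mB'.
  have -> : m (A' `*` B') = ((k^-1)%:E * nu (X @^-1` A' `&` Y @^-1` B'))%E by [].
  by rewrite XY// muleA -EFinM mulVf ?gt_eqF// mul1e.
have mZ : measurable [set xy : measurableTypeR R * measurableTypeR R | A (xy.1 + xy.2)].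
  have mD : measurable_fun setT (fun xy : measurableTypeR R * measurableTypeR R =>
      (xy.1 + xy.2 : R)) by exact: measurable_funD.
  by rewrite -[X in measurable X]setTI; exact: mD.
have := mE _ mZ; rewrite gauss_law_conv// => ->.
have -> : m [set xy | A (xy.1 + xy.2)] =
    ((k^-1)%:E * nu ((fun w => X w + Y w)%R @^-1` A))%E by [].
by rewrite muleA -EFinM mulfV ?gt_eqF// mul1e.
Qed.

End gaussian_sum.

Section almost_sure_limits.
Context d (T : measurableType d) (R : realType) (P : probability T R).
Local Notation std := (@normal_prob R 0 1).

(** The integrals of a bounded continuous function converge for the variables as well
    as for the dilated standard normal laws. *)
Lemma gaussian_ae_lim (X_ : nat -> T -> R) (X : T -> R) (v_ : nat -> R) v :
  (forall n, gaussian P (X_ n) (v_ n)) -> v_ n @[n --> \oo] --> v ->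
  measurable_fun setT X -> {ae P, forall w, X_ ^~ w @ \oo --> X w} ->
  gaussian P X v.
Proof.
move=> Xv vv mX XX; apply: gaussianP => // f cf f01.
have mf : measurable_fun setT f by exact: continuous_measurable_fun.
have mfc (k : R) : measurable_fun setT (fun x : measurableTypeR R => f (k * x)).
  apply: continuous_measurable_fun => x.
  by apply: (continuous_comp (@mulrl_continuous _ k x)); exact: cf.
have f0 (x : R) : (0 <= (f x)%:E)%E by have /andP[] := f01 x; rewrite lee_fin.
have mfE : measurable_fun setT (EFin \o f) by exact/measurable_EFinP.
have lim1 : (\int[P]_w (f (X_ n w))%:E)%E @[n --> \oo] --> (\int[P]_w (f (X w))%:E)%E.
  apply: (@bounded_cvg_integral _ _ _ P (fun n w => f (X_ n w)) (f \o X)).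
  - by move=> n; apply: (measurableT_comp mf); exact: gaussian_measurable (Xv n).
  - exact: measurableT_comp.
  - by move=> n x; exact: f01.
  - apply: filterS XX => w Xw.
    by apply: (cvg_comp _ _ Xw); exact: cf.
have lim2 : (\int[std]_x (f (Num.sqrt (v_ n) * x))%:E)%E @[n --> \oo] -->
    (\int[std]_x (f (Num.sqrt v * x))%:E)%E.
  apply: (@bounded_cvg_integral _ _ _ std
     (fun n (x : measurableTypeR R) => f (Num.sqrt (v_ n) * x))
     (fun x : measurableTypeR R => f (Num.sqrt v * x))).
  - by move=> n; exact: mfc.
  - exact: mfc.
  - by move=> n x; exact: f01.
  - apply: aeW => x; apply: (cvg_comp (fun n => Num.sqrt (v_ n) * x) f); last exact: cf.
    apply: cvgMl; apply: (cvg_comp _ _ vv); exact: sqrt_continuous.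
apply: (@cvg_unique _ (@ereal_hausdorff R) _ _ _ _ lim1).
have E n : (\int[P]_w (f (X_ n w))%:E = \int[std]_x (f (Num.sqrt (v_ n) * x))%:E)%E.
  exact: gaussian_integral (Xv n) mfE f0.
by rewrite /= (eq_fun E).
Qed.

(** The sum of the U k is integrable, hence almost surely finite. *)
Lemma ae_bounded_of_geometric (U : nat -> T -> R) (C r : R) : 0 <= r < 1 ->
  (forall k, measurable_fun setT (U k)) -> (forall k w, 0 <= U k w) ->
  (forall k, \int[P]_w (U k w)%:E <= (C * r ^+ k)%:E)%E ->
  {ae P, forall w, exists K, forall k, U k w <= K}.
Proof.
move=> /andP[r0 r1] mU U0 EU.
have mUE k : measurable_fun setT (fun w => (U k w)%:E) by exact/measurable_EFinP.
have U0E k w : setT w -> (0 <= (U k w)%:E)%E by rewrite lee_fin.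
have mS : measurable_fun setT (fun w => (\sum_(k <oo) (U k w)%:E)%E).
  exact: (@ge0_emeasurable_sum _ _ _ setT (fun k w => (U k w)%:E) xpredT
    (fun k w Dw _ => U0E k w Dw) (fun k _ => mUE k)).
have S0 w : (0 <= \sum_(k <oo) (U k w)%:E)%E.
  by apply: nneseries_ge0 => k _ _; rewrite lee_fin.
have iS : P.-integrable setT (fun w => (\sum_(k <oo) (U k w)%:E)%E).
  apply/integrableP; split=> //.
  under eq_integral do rewrite gee0_abs//.
  rewrite integral_nneseries//.
  apply: (@le_lt_trans _ _ (\sum_(k <oo) (C * r ^+ k)%:E)%E).
    by apply: lee_nneseries => // k _ _; apply: integral_ge0 => w _; exact: U0E.
  have cs := @is_cvg_geometric_series R C r.
  rewrite (_ : (\sum_(k <oo) _)%E = (limn (series (geometric C r)))%:E) ?ltry//.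
  rewrite -EFin_lim; last by apply: cs; rewrite ger0_norm.
  by congr (limn _); apply/funext => n /=; rewrite /series/= sumEFin.
have := integrable_ae measurableT iS; apply: filterS => w /(_ I) Sw.
exists (fine (\sum_(k <oo) (U k w)%:E)%E) => k.
rewrite -lee_fin fineK//.
apply: le_trans (@nneseries_lim_ge _ _ xpredT 0 k.+1 _); last first.
  by move=> j _ _; rewrite lee_fin.
rewrite big_mkord big_ord_recr/= leeDr// sume_ge0// => i _.
by rewrite lee_fin.
Qed.

End almost_sure_limits.

(** * Convergence in square mean *)

Lemma lee_lincomb (R : realType) (a b c d : R) (x y : \bar R) : 0 <= c -> 0 <= d ->
  (x <= a%:E)%E -> (y <= b%:E)%E -> (c%:E * x + d%:E * y <= (c * a + d * b)%:E)%E.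
Proof.
move=> c0 d0 xa yb; rewrite [leRHS]EFinD (EFinM c) (EFinM d).
by apply: leeD; apply: lee_wpmul2l => //; rewrite lee_fin.
Qed.

Section square_integral.
Context d (T : measurableType d) (R : realType) (mu : {measure set T -> \bar R}).
Implicit Types f g : T -> R.

(** The square of the L^2 norm, possibly infinite. *)
Definition sqn f : \bar R := (\int[mu]_x (f x ^+ 2)%:E)%E.

Lemma sqn_ge0 f : (0 <= sqn f)%E.
Proof. by apply: integral_ge0 => x _; rewrite lee_fin sqr_ge0. Qed.

Lemma eq_sqn f g : (forall x, f x ^+ 2 = g x ^+ 2) -> sqn f = sqn g.
Proof. by move=> fg; apply: eq_integral => x _; rewrite fg. Qed.

Lemma measurable_sqr_EFin f : measurable_fun setT f ->
  measurable_fun setT (fun x => (f x ^+ 2)%:E).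
Proof. by move=> mf; apply/measurable_EFinP; exact: measurable_funX. Qed.

Lemma sqnZ c f : measurable_fun setT f ->
  sqn (fun x => c * f x) = ((c ^+ 2)%:E * sqn f)%E.
Proof.
move=> mf; rewrite /sqn -ge0_integralZl//.
- by apply: eq_integral => x _; rewrite exprMn EFinM.
- exact: measurable_sqr_EFin.
- by move=> x _; rewrite lee_fin sqr_ge0.
- by rewrite lee_fin sqr_ge0.
Qed.

Lemma sqnD_le (e : R) f g : 0 < e -> measurable_fun setT f -> measurable_fun setT g ->
  (sqn (fun x => f x + g x)%R <= (1 + e)%:E * sqn f + (1 + e^-1)%:E * sqn g)%E.
Proof.
move=> e0 mf mg.
have e1 : (0 <= (1 + e)%:E)%E by rewrite lee_fin addr_ge0// ltW.
have e2 : (0 <= (1 + e^-1)%:E)%E by rewrite lee_fin addr_ge0// invr_ge0 ltW.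
have sq0 (h : T -> R) x : setT x -> (0 <= (h x ^+ 2)%:E)%E by rewrite lee_fin sqr_ge0.
have m2 := measurable_sqr_EFin.
rewrite /sqn -!ge0_integralZl//; try exact: m2; try exact: sq0.
rewrite -ge0_integralD//.
- apply: ge0_le_integral => //.
  + exact: sq0.
  + by apply: m2; exact: measurable_funD.
  + by apply: emeasurable_funD; apply: emeasurable_funM => //; exact: m2.
  + move=> x _; rewrite -!EFinM -EFinD lee_fin.
    have h : 0 <= (e * f x - g x) ^+ 2 * e^-1.
      by rewrite mulr_ge0 ?sqr_ge0// invr_ge0 ltW.
    have -> : (1 + e) * f x ^+ 2 + (1 + e^-1) * g x ^+ 2 =
       (f x + g x) ^+ 2 + (e * f x - g x) ^+ 2 * e^-1.
      by field; rewrite gt_eqF.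
    by rewrite lerDl.
- by move=> x _; rewrite mule_ge0// lee_fin sqr_ge0.
- by apply: emeasurable_funM => //; exact: m2.
- by move=> x _; rewrite mule_ge0// lee_fin sqr_ge0.
- by apply: emeasurable_funM => //; exact: m2.
Qed.

Lemma sqnD_le_bound f g (a b : R) : measurable_fun setT f -> measurable_fun setT g ->
  (sqn f <= a%:E)%E -> (sqn g <= b%:E)%E ->
  (sqn (fun x => f x + g x)%R <= (2 * a + 2 * b)%:E)%E.
Proof.
move=> mf mg fa gb; apply: le_trans (sqnD_le ltr01 mf mg) _.
by rewrite invr1; apply: lee_lincomb.
Qed.

Lemma sqn_eq0_ae f : measurable_fun setT f -> sqn f = 0%E ->
  {ae mu, forall x, f x = 0}.
Proof.
move=> mf f0.
have m2 := measurable_sqr_EFin mf.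
have : (\int[mu]_x `|(f x ^+ 2)%:E| = 0)%E.
  by under eq_integral do rewrite gee0_abs ?lee_fin ?sqr_ge0//.
move/(ae_eq_integral_abs mu measurableT m2); apply: filterS => x /(_ I) [] /eqP.
by rewrite sqrf_eq0 => /eqP.
Qed.

(** [sqnD_le] with a small e: its large factor 1 + 1 / e only meets the difference,
    which vanishes in the limit. *)
Lemma sqn_cvg (f_ : nat -> T -> R) f : measurable_fun setT f ->
  (forall n, measurable_fun setT (f_ n)) -> (sqn f < +oo)%E ->
  (forall e : R, 0 < e ->
    \forall n \near \oo, (sqn (fun x => f x - f_ n x)%R <= e%:E)%E) ->
  fine (sqn (f_ n)) @[n --> \oo] --> fine (sqn f).
Proof.
move=> mf mf_ flty fe.
have ffin : sqn f \is a fin_num by rewrite ge0_fin_numE// sqn_ge0.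
set a := fine (sqn f); have aE : sqn f = a%:E by rewrite fineK.
have a0 : 0 <= a by rewrite fine_ge0// sqn_ge0.
apply/cvgrPdist_le => eps eps0.
have [e e0 [h1 h2]] : exists2 e : R, 0 < e & e * a <= eps / 4 /\ e <= 1.
  exists (Num.min 1 (eps / 4 / (a + 1))).
    by rewrite lt_min ltr01/= !divr_gt0// ltr_wpDl.
  split; last by rewrite ge_min lexx.
  apply: (@le_trans _ _ (eps / 4 / (a + 1) * a)).
    by rewrite ler_wpM2r// ge_min lexx orbT.
  rewrite mulrAC ler_pdivrMr ?ltr_wpDl// ler_wpM2l ?divr_ge0 ?ltW//.
  by rewrite ltrDl.
pose K := 1 + e^-1.
have K0 : 0 < K by rewrite addr_gt0// invr_gt0.
pose dl := eps / 4 / K / 2.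
have dl0 : 0 < dl by rewrite !divr_gt0.
have Kdl : K * dl = eps / 8 by rewrite /dl; field; rewrite gt_eqF.
have /= := fe dl dl0; apply: filterS => n hn.
have mD : measurable_fun setT (fun x => f x - f_ n x) by exact: measurable_funB.
have mD' : measurable_fun setT (fun x => f_ n x - f x) by exact: measurable_funB.
have hn' : (sqn (fun x => f_ n x - f x)%R <= dl%:E)%E.
  by rewrite (@eq_sqn _ (fun x => f x - f_ n x))// => x; rewrite -sqrrN opprB.
have up : (sqn (f_ n) <= ((1 + e) * a + K * dl)%:E)%E.
  have := sqnD_le e0 mf mD'; rewrite (@eq_sqn _ (f_ n)); last first.
    by move=> x; rewrite addrC subrK.
  move=> /le_trans; apply; apply: lee_lincomb => //; rewrite ?aE//.
    by rewrite addr_ge0// ltW.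
  exact: ltW.
have nfin : sqn (f_ n) \is a fin_num.
  by rewrite ge0_fin_numE ?sqn_ge0// (le_lt_trans up)// ltry.
set b := fine (sqn (f_ n)); have bE : sqn (f_ n) = b%:E by rewrite fineK.
have lo : (a%:E <= ((1 + e) * b + K * dl)%:E)%E.
  have := sqnD_le e0 (mf_ n) mD; rewrite (@eq_sqn _ f); last first.
    by move=> x; rewrite addrC subrK.
  rewrite aE bE => /le_trans; apply; apply: lee_lincomb => //.
    by rewrite addr_ge0// ltW.
  exact: ltW.
rewrite bE lee_fin Kdl in up; rewrite lee_fin Kdl in lo.
have b0 : 0 <= b by rewrite fine_ge0// sqn_ge0.
have eb : e * b <= 2 * (eps / 4) + eps / 8.
  apply: (@le_trans _ _ (e * ((1 + e) * a + eps / 8))).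
    by rewrite ler_wpM2l// ltW.
  have -> : e * ((1 + e) * a + eps / 8) = (1 + e) * (e * a) + e * (eps / 8) by ring.
  apply: lerD.
    by apply: ler_pM => //; [rewrite addr_ge0// ltW|rewrite mulr_ge0// ltW|lra].
  by rewrite ler_piMl// divr_ge0// ltW.
rewrite ler_norml; apply/andP; split; lra.
Qed.

Lemma fatou_bound (f_ : nat -> T -> R) f (c : \bar R) N :
  (forall n, measurable_fun setT (f_ n)) -> measurable_fun setT f ->
  {ae mu, forall x, f_ ^~ x @ \oo --> f x} ->
  (forall n, (N <= n)%N -> (sqn (f_ n) <= c)%E) -> (sqn f <= c)%E.
Proof.
move=> mf_ mf ff fc.
have m2 n : measurable_fun setT (fun x => (f_ n x ^+ 2)%:E) by exact: measurable_sqr_EFin.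
have sq0 n x : setT x -> (0 <= (f_ n x ^+ 2)%:E)%E by rewrite lee_fin sqr_ge0.
have lim x : f_ ^~ x @ \oo --> f x ->
    limn_einf (fun n => (f_ n x ^+ 2)%:E) = (f x ^+ 2)%:E.
  move=> fx; have h : (f_ n x ^+ 2)%:E @[n --> \oo] --> (f x ^+ 2)%:E.
    apply: cvg_EFin; first exact: nearW.
    by rewrite expr2; under eq_fun do rewrite expr2; exact: cvgM.
  rewrite is_cvg_limn_einfE; first exact/cvg_lim.
  by apply/cvg_ex; eexists; exact: h.
have -> : sqn f = (\int[mu]_x limn_einf (fun n => (f_ n x ^+ 2)%:E))%E.
  apply: ge0_ae_eq_integral => //.
  - exact: measurable_sqr_EFin.
  - rewrite /limn_einf; apply: measurableT_comp => //.
    by apply: measurable_fun_limn_esup => n; exact: measurableT_comp.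
  - by move=> x _; rewrite lee_fin sqr_ge0.
  - move=> x _; rewrite limn_einf_lim; apply: lime_ge; first exact: is_cvg_einfs.
    by apply: nearW => n; apply: le_ereal_inf_tmp => _ [m /= nm <-]; exact: sq0.
  - by move: ff; apply: filterS => x fx _; rewrite lim.
apply: le_trans (fatou mu measurableT m2 sq0) _.
rewrite limn_einf_lim; apply: lime_le; first exact: is_cvg_einfs.
near=> n; apply: (@le_trans _ _ (sqn (f_ n))).
  by apply: ereal_inf_lbound; exists n => //=.
by apply: fc; near: n; exact: nbhs_infty_ge.
Unshelve. all: by end_near. Qed.

End square_integral.

(** The squares of 2^n D n still have geometrically small means, of order 4^-n. *)
Lemma ae_geometric_bound d (T : measurableType d) (R : realType)
    (P : probability T R) (D : nat -> T -> R) (C : R) :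
  (forall n, measurable_fun setT (D n)) ->
  (forall n, sqn P (D n) <= (C * 16^-1 ^+ n)%:E)%E ->
  {ae P, forall w, exists K, forall n, `|D n w| <= K * 2^-1 ^+ n}.
Proof.
move=> mD DC.
have h4 : 0 <= (4^-1 : R) < 1 by rewrite invr_ge0 ler0n/= invf_lt1// ltr1n.
have := @ae_bounded_of_geometric _ _ _ P (fun n w => (2 ^+ n * D n w) ^+ 2) C _ h4.
have m2 n : measurable_fun setT (fun w => (2 ^+ n * D n w) ^+ 2).
  by apply: measurable_funX; exact: measurable_funM.
have p2 n w : 0 <= (2 ^+ n * D n w) ^+ 2 by exact: sqr_ge0.
have E2 n : (\int[P]_w ((2 ^+ n * D n w) ^+ 2)%:E <= (C * 4^-1 ^+ n)%:E)%E.
  have := sqnZ P (2 ^+ n) (mD n); rewrite /sqn => ->.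
  have -> : C * 4^-1 ^+ n = (2 ^+ n) ^+ 2 * (C * 16^-1 ^+ n).
    have -> : (16 : R) = 4 * 4 by rewrite -natrM.
    have -> : (2 : R) ^+ n ^+ 2 = 4 ^+ n by rewrite exprAC; congr (_ ^+ _); rewrite -natrX.
    by rewrite invfM exprMn mulrCA !mulrA; congr (_ * _); rewrite -mulrA -exprMn mulfV ?expr1n ?mulr1.
  by rewrite [leRHS]EFinM; apply: lee_wpmul2l; [rewrite lee_fin sqr_ge0|exact: DC].
move=> /(_ m2 p2 E2); apply: filterS => w [K hK].
exists (K + 1) => n; rewrite exprVn ler_pdivlMr ?exprn_gt0// mulrC.
have := hK n; set x := 2 ^+ n * D n w.
have -> : 2 ^+ n * `|D n w| = `|x| by rewrite /x normrM ger0_norm// exprn_ge0.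
by rewrite -real_normK ?num_real// => ?; nra.
Qed.

Lemma sqn_lt_expr_near (R : realType) (q e : R) : 0 <= q < 1 -> 0 < e ->
  \forall n \near \oo, q ^+ n <= e.
Proof.
move=> /andP[q0 q1] e0.
have : (q : R) ^+ n @[n --> \oo] --> (0 : R) by apply: cvg_expr; rewrite ger0_norm.
by move/cvgr_le; exact.
Qed.

Lemma cvg_of_geometric_bound (R : realType) (u : nat -> R) (l K : R) :
  (forall n, `|l - u n| <= K * 2^-1 ^+ n) -> u n @[n --> \oo] --> l.
Proof.
move=> uK.
have K0 : 0 <= K by have := uK 0%N; rewrite expr0 mulr1; exact: le_trans.
apply/cvgrPdist_le => e e0; near=> n; apply: le_trans (uK n) _.
apply: (@le_trans _ _ (K * (e / (K + 1)))).
  rewrite ler_wpM2l//; near: n; apply: sqn_lt_expr_near.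
    by rewrite invr_ge0 ler0n/= invf_lt1// ltr1n.
  by rewrite divr_gt0// ltr_wpDl.
by rewrite mulrCA ler_piMr ?(ltW e0)// ler_pdivrMr ?ltr_wpDl// mul1r lerDl.
Unshelve. all: by end_near. Qed.

Lemma summable_increments_cvg (R : realType) (u : nat -> R) (K r : R) :
  0 <= r < 1 -> (forall n, `|u n.+1 - u n| <= K * r ^+ n) ->
  cvgn u /\ forall n, `|limn u - u n| <= K * r ^+ n / (1 - r).
Proof.
move=> /andP[r0 r1] uK.
have r1' : 0 < 1 - r by rewrite subr_gt0.
have K0 : 0 <= K by have := uK 0%N; rewrite expr0 mulr1; exact: le_trans.
have tail n m : (n <= m)%N -> `|u m - u n| <= K * (r ^+ n - r ^+ m) / (1 - r).
  elim: m => [|m IH]; first by rewrite leqn0 => /eqP ->; rewrite !subrr normr0 mulr0 mul0r.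
  rewrite leq_eqVlt => /predU1P[->|]; first by rewrite !subrr normr0 mulr0 mul0r.
  rewrite ltnS => nm; rewrite -(subrK (u m) (u m.+1)) -addrA.
  apply: le_trans (ler_normD _ _) _; apply: le_trans (lerD (uK m) (IH nm)) _.
  rewrite le_eqVlt; apply/orP; left; apply/eqP.
  by rewrite exprS; field; rewrite gt_eqF.
have tail' n m : (n <= m)%N -> `|u m - u n| <= K * r ^+ n / (1 - r).
  move=> /tail/le_trans; apply; rewrite ler_pM2r ?invr_gt0// ler_wpM2l//.
  by rewrite lerBlDr lerDl exprn_ge0.
have geo0 : K * r ^+ n / (1 - r) @[n --> \oo] --> (0 : R).
  rewrite -(mul0r (1 - r)^-1) -(mulr0 K); apply: cvgMl; apply: cvgMr.
  by apply: cvg_expr; rewrite ger0_norm.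
have cu : cvgn u.
  apply: cauchy_cvg; apply/cauchyP => e e0.
  near \oo => N; exists (u N).
  suff h : \forall m \near \oo, ball (u N) e (u m) by exact: h.
  near=> m; rewrite -ball_normE/= distrC.
  apply: le_lt_trans (@tail' N m _) _; first by near: m; exact: nbhs_infty_ge.
  by near: N; move/cvgr_lt : geo0; exact.
split=> // n; have cun : u m - u n @[m --> \oo] --> limn u - u n.
  by apply: cvgB => //; exact: cvg_cst.
have cn : `|u m - u n| @[m --> \oo] --> `|limn u - u n| by exact: cvg_norm.
rewrite -(cvg_lim _ cn)//; apply: limr_le; first by apply/cvg_ex; eexists; exact: cn.
by near=> m; apply: tail'; near: m; exact: nbhs_infty_ge.
Unshelve. all: by end_near. Qed.

(** * The Wiener integral *)

Section elementary.
Context {R : realType}.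
Implicit Types s : @elementary R.
Local Notation mu := (@lebesgue_measure R).

Definition elementary_nonneg s :=
  all (fun x : R * R * R => (0 <= x.1.2) && (x.1.2 <= x.2)) s.

Definition scale_elementary (c : R) s : elementary :=
  [seq (c * x.1.1, x.1.2, x.2) | x <- s].

Lemma elementary_nonneg_cat s s' :
  elementary_nonneg (s ++ s') = elementary_nonneg s && elementary_nonneg s'.
Proof. exact: all_cat. Qed.

Lemma elementary_nonneg_scale c s :
  elementary_nonneg (scale_elementary c s) = elementary_nonneg s.
Proof. by rewrite /elementary_nonneg all_map. Qed.

Lemma elementary_fun_cat s s' u :
  elementary_fun (s ++ s') u = elementary_fun s u + elementary_fun s' u.
Proof. by rewrite /elementary_fun big_cat. Qed.

Lemma elementary_fun_scale c s u :
  elementary_fun (scale_elementary c s) u = c * elementary_fun s u.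
Proof.
rewrite /elementary_fun big_map mulr_sumr; apply: eq_bigr => x _ /=.
by rewrite mulrA.
Qed.

Lemma measurable_elementary_fun s : measurable_fun setT (elementary_fun s).
Proof.
apply: measurable_sum => x; exact: measurable_funM.
Qed.

End elementary.

Section wiener_integral.
Context {R : realType} {d : measure_display} {Omega : measurableType d}.
Variables (P : probability Omega R) (B : R -> Omega -> R).
Local Notation mu := (@lebesgue_measure R).
Implicit Types (f g : R -> R) (J K : Omega -> R) (s : @elementary R).

(** The integral of f over the whole half-line; integrals up to t are those of
    functions that vanish after t. One approximation for each e, instead of a
    sequence, keeps the closure properties below short. *)
Definition wiener_integral f J : Prop :=
  [/\ measurable_fun setT f, measurable_fun setT J &
    forall e : R, 0 < e -> exists s, [/\ elementary_nonneg s,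
      (sqn mu (fun u => f u - elementary_fun s u)%R <= e%:E)%E &
      (sqn P (fun w => J w - elementary_integral B s w)%R <= e%:E)%E]].

(** The isometry for elementary functions is contained in this: the variance is the
    square integral. *)
Hypothesis elementary_gaussian : forall s, elementary_nonneg s ->
  gaussian P (elementary_integral B s) (fine (sqn mu (elementary_fun s))) /\
  (sqn mu (elementary_fun s) < +oo)%E.

Let mEI s : elementary_nonneg s -> measurable_fun setT (elementary_integral B s).
Proof. by move=> /elementary_gaussian[/gaussian_measurable]. Qed.

Lemma wiener_integralD f g J K : wiener_integral f J -> wiener_integral g K ->
  wiener_integral (fun u => f u + g u) (fun w => J w + K w).
Proof.
move=> [mf mJ fJ] [mg mK gK]; split; [exact: measurable_funD..|move=> e e0].
have e4 : 0 < e / 4 by rewrite divr_gt0.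
have [s [s0 fs Js]] := fJ _ e4; have [s' [s'0 gs Ks]] := gK _ e4.
have eE : 2 * (e / 4) + 2 * (e / 4) = e by field.
exists (s ++ s'); split; first by rewrite elementary_nonneg_cat s0.
- rewrite (@eq_sqn _ _ _ mu _ (fun u => (f u - elementary_fun s u) +
    (g u - elementary_fun s' u))); last first.
    by move=> u; rewrite elementary_fun_cat opprD addrACA.
  rewrite -eE; apply: sqnD_le_bound => //;
    by apply: measurable_funB => //; exact: measurable_elementary_fun.
- rewrite (@eq_sqn _ _ _ _ _ (fun w => (J w - elementary_integral B s w) +
    (K w - elementary_integral B s' w))); last first.
    by move=> w; rewrite /elementary_integral big_cat/= opprD addrACA.
  by rewrite -eE; apply: sqnD_le_bound => //; apply: measurable_funB => //; exact: mEI.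
Qed.

Lemma wiener_integralZ c f J : wiener_integral f J ->
  wiener_integral (fun u => c * f u) (fun w => c * J w).
Proof.
move=> [mf mJ fJ]; split; [exact: measurable_funM..|move=> e e0].
have e' : 0 < e / (c ^+ 2 + 1) by rewrite divr_gt0// ltr_wpDl// sqr_ge0.
have [s [s0 fs Js]] := fJ _ e'.
have ce : ((c ^+ 2)%:E * (e / (c ^+ 2 + 1))%R%:E <= e%:E)%E.
  rewrite -EFinM lee_fin mulrCA ler_piMr ?(ltW e0)//.
  by rewrite ler_pdivrMr ?ltr_wpDl ?sqr_ge0// mul1r lerDl.
exists (scale_elementary c s); split; first by rewrite elementary_nonneg_scale.
- rewrite (@eq_sqn _ _ _ mu _ (fun u => c * (f u - elementary_fun s u))); last first.
    by move=> u; rewrite elementary_fun_scale mulrBr.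
  rewrite sqnZ; last by apply: measurable_funB => //; exact: measurable_elementary_fun.
  by apply: le_trans ce; apply: lee_wpmul2l => //; rewrite lee_fin sqr_ge0.
- rewrite (@eq_sqn _ _ _ _ _ (fun w => c * (J w - elementary_integral B s w))); last first.
    move=> w; rewrite mulrBr; congr ((_ - _) ^+ 2).
    rewrite /elementary_integral big_map mulr_sumr.
    by apply: eq_bigr => x _ /=; rewrite mulrA.
  rewrite sqnZ; last by apply: measurable_funB => //; exact: mEI.
  by apply: le_trans ce; apply: lee_wpmul2l => //; rewrite lee_fin sqr_ge0.
Qed.

Lemma wiener_integralB f g J K : wiener_integral f J -> wiener_integral g K ->
  wiener_integral (fun u => f u - g u) (fun w => J w - K w).
Proof.
move=> fJ /(wiener_integralZ (-1)) gK; have := wiener_integralD fJ gK.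
by under eq_fun do rewrite mulN1r; under [X in wiener_integral _ X]eq_fun do rewrite mulN1r.
Qed.

Lemma wiener_integral_itv a b : 0 <= a -> a <= b ->
  wiener_integral (\1_(`]a, b])) (fun w => B b w - B a w).
Proof.
move=> a0 ab; have s0 : elementary_nonneg [:: ((1 : R), a, b)] by rewrite /= a0 ab.
split; first exact: measurable_indic.
- by have := mEI s0; rewrite /elementary_integral; under eq_fun do rewrite big_seq1 mul1r.
move=> e e0; exists [:: ((1 : R), a, b)]; split=> //.
- rewrite (@eq_sqn _ _ _ _ _ (cst 0)); last first.
    by move=> u; rewrite /elementary_fun big_seq1/= mul1r subrr.
  by rewrite /sqn; under eq_integral do rewrite /cst expr0n; rewrite integral0 lee_fin ltW.
- rewrite (@eq_sqn _ _ _ _ _ (cst 0)); last first.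
    by move=> u; rewrite /elementary_integral big_seq1/= mul1r subrr.
  by rewrite /sqn; under eq_integral do rewrite /cst expr0n; rewrite integral0 lee_fin ltW.
Qed.

Lemma wiener_integral0 : wiener_integral (cst 0) (cst 0).
Proof.
have := wiener_integralZ 0 (wiener_integral_itv (lexx 0) (lexx 0)).
by under eq_fun do rewrite mul0r; under [X in wiener_integral _ X]eq_fun do rewrite mul0r.
Qed.

Lemma wiener_integral_sum (I : Type) (r : seq I) (F : I -> R -> R) (G : I -> Omega -> R) :
  (forall i, wiener_integral (F i) (G i)) ->
  wiener_integral (fun u => \sum_(i <- r) F i u) (fun w => \sum_(i <- r) G i w).
Proof.
move=> FG; elim: r => [|i r IH].
  by under eq_fun do rewrite big_nil; under [X in wiener_integral _ X]eq_fun do rewrite big_nil;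
  exact: wiener_integral0.
by under eq_fun do rewrite big_cons; under [X in wiener_integral _ X]eq_fun do rewrite big_cons;
  exact: wiener_integralD.
Qed.

Lemma wiener_integral_approx f J : measurable_fun setT f -> measurable_fun setT J ->
  (forall e : R, 0 < e -> exists g K, [/\ wiener_integral g K,
     (sqn mu (fun u => f u - g u)%R <= e%:E)%E & (sqn P (fun w => J w - K w)%R <= e%:E)%E]) ->
  wiener_integral f J.
Proof.
move=> mf mJ fJ; split=> // e e0.
have e4 : 0 < e / 4 by rewrite divr_gt0.
have [g [K [[mg mK gK] fg JK]]] := fJ _ e4; have [s [s0 gs Ks]] := gK _ e4.
have eE : 2 * (e / 4) + 2 * (e / 4) = e by field.
exists s; split=> //.
- rewrite (@eq_sqn _ _ _ mu _ (fun u => (f u - g u) + (g u - elementary_fun s u))); last first.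
    by move=> u; rewrite addrA subrK.
  rewrite -eE; apply: sqnD_le_bound => //; apply: measurable_funB => //.
  exact: measurable_elementary_fun.
- rewrite (@eq_sqn _ _ _ _ _ (fun w => (J w - K w) + (K w - elementary_integral B s w))); last first.
    by move=> w; rewrite addrA subrK.
  by rewrite -eE; apply: sqnD_le_bound => //; apply: measurable_funB => //; exact: mEI.
Qed.

Lemma wiener_integral_lty f J : wiener_integral f J -> (sqn mu f < +oo)%E.
Proof.
move=> [mf _ /(_ 1 ltr01)[s [s0 fs _]]].
have [_ slty] := elementary_gaussian s0.
have sfin : sqn mu (elementary_fun s) \is a fin_num by rewrite ge0_fin_numE// sqn_ge0.
have me := measurable_elementary_fun s.
apply: le_lt_trans (_ : (2 * 1 + 2 * fine (sqn mu (elementary_fun s)))%:E < +oo)%E; last first.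
  exact: ltry.
rewrite (@eq_sqn _ _ _ mu _ (fun u => (f u - elementary_fun s u) + elementary_fun s u)); last first.
  by move=> u; rewrite subrK.
apply: sqnD_le_bound => //; first exact: measurable_funB.
by rewrite fineK.
Qed.

Lemma wiener_integral_gaussian f J : wiener_integral f J ->
  gaussian P J (fine (sqn mu f)).
Proof.
move=> fJ; have flty := wiener_integral_lty fJ; case: fJ => mf mJ fJ.
have q0 n : 0 < (16^-1 : R) ^+ n by rewrite exprn_gt0.
have /choice[s /all_and3[s0 fs Js]] n := fJ _ (q0 n).
apply: (gaussian_ae_lim (fun n => (elementary_gaussian (s0 n)).1)) => //.
- apply: sqn_cvg => //; first by move=> n; exact: measurable_elementary_fun.
  move=> e e0; near=> n; apply: le_trans (fs n) _; rewrite lee_fin.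
  near: n; apply: sqn_lt_expr_near => //.
  by rewrite invr_ge0 ler0n/= invf_lt1// ltr1n.
- have := @ae_geometric_bound _ _ _ P
    (fun n w => J w - elementary_integral B (s n) w) 1.
  have mD n : measurable_fun setT (fun w => J w - elementary_integral B (s n) w).
    by apply: measurable_funB => //; exact: mEI.
  have hD n : (sqn P (fun w => J w - elementary_integral B (s n) w)%R
      <= (1 * 16^-1 ^+ n)%:E)%E by rewrite mul1r.
  move=> /(_ mD hD); apply: filterS => w [K hK].
  exact: cvg_of_geometric_bound hK.
Unshelve. all: by end_near. Qed.

Lemma wiener_integral_sqn f J : wiener_integral f J -> sqn P J = sqn mu f.
Proof.
move=> fJ; have flty := wiener_integral_lty fJ.
rewrite /sqn (gaussian_second_moment _ (wiener_integral_gaussian fJ)).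
  by rewrite fineK// ge0_fin_numE// sqn_ge0.
by rewrite fine_ge0// sqn_ge0.
Qed.

(** By the isometry K_ n is Cauchy in square mean; Fatou's lemma turns the almost sure
    limit into a limit in square mean. *)
Lemma wiener_integral_ae_lim f J (g_ : nat -> R -> R) (K_ : nat -> Omega -> R) :
  measurable_fun setT f -> measurable_fun setT J ->
  (forall n, wiener_integral (g_ n) (K_ n)) ->
  (forall e : R, 0 < e ->
    \forall n \near \oo, (sqn mu (fun u => f u - g_ n u)%R <= e%:E)%E) ->
  {ae P, forall w, K_ ^~ w @ \oo --> J w} -> wiener_integral f J.
Proof.
move=> mf mJ gK fg KJ; apply: wiener_integral_approx => // e e0.
have e4 : 0 < e / 4 by rewrite divr_gt0.
have eE : 2 * (e / 4) + 2 * (e / 4) = e by field.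
have [N _ hN] := fg _ e4.
have mg n : measurable_fun setT (g_ n) by have [] := gK n.
have mK n : measurable_fun setT (K_ n) by have [] := gK n.
exists (g_ N), (K_ N); split=> //.
  apply: le_trans (hN N (leqnn N)) _; rewrite lee_fin; lra.
apply: (@fatou_bound _ _ _ P (fun m w => K_ m w - K_ N w) _ _ N).
- by move=> m; exact: measurable_funB.
- exact: measurable_funB.
- by move: KJ; apply: filterS => w KJ; apply: cvgB => //; exact: cvg_cst.
- move=> m Nm; rewrite (wiener_integral_sqn (wiener_integralB (gK m) (gK N))).
  rewrite (@eq_sqn _ _ _ mu _ (fun u => (f u - g_ N u) + (-1) * (f u - g_ m u))); last first.
    by move=> u; congr (_ ^+ 2); ring.
  rewrite -eE; apply: sqnD_le_bound.
  + exact: (measurable_funB mf (mg N)).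
  + by apply: measurable_funM => //; exact: (measurable_funB mf (mg m)).
  + exact: (hN N (leqnn N)).
  + rewrite sqnZ ?sqrrN ?expr1n ?mul1e; first exact: (hN m Nm).
    exact: (measurable_funB mf (mg m)).
Qed.

(** The increments of K_ n are of order 16^-n in square mean, so that K_ n converges
    almost surely; the upper limit is a measurable choice of the limit. *)
Lemma wiener_integral_exists f (g_ : nat -> R -> R) (K_ : nat -> Omega -> R) (C : R) :
  measurable_fun setT f -> 0 <= C ->
  (forall n, wiener_integral (g_ n) (K_ n)) ->
  (forall n, sqn mu (fun u => f u - g_ n u)%R <= (C * 16^-1 ^+ n)%:E)%E ->
  exists J, wiener_integral f J.
Proof.
move=> mf C0 gK fg.
have mg n : measurable_fun setT (g_ n) by have [] := gK n.
have mK n : measurable_fun setT (K_ n) by have [] := gK n.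
exists (fun w => fine (limn_esup (fun n => (K_ n w)%:E))).
apply: (wiener_integral_ae_lim mf _ gK).
- apply: (measurableT_comp (@fine_measurable R setT measurableT)) => //.
  by apply: measurable_fun_limn_esup => n; exact/measurable_EFinP.
- move=> e e0.
  have e' : 0 < e / (C + 1) by rewrite divr_gt0// ltr_wpDl.
  near=> n; apply: le_trans (fg n) _; rewrite lee_fin.
  apply: (@le_trans _ _ (C * (e / (C + 1)))).
    rewrite ler_wpM2l//; near: n; apply: sqn_lt_expr_near => //.
    by rewrite invr_ge0 ler0n/= invf_lt1// ltr1n.
  by rewrite mulrCA ler_piMr ?(ltW e0)// ler_pdivrMr ?ltr_wpDl// mul1r lerDl.
- have := @ae_geometric_bound _ _ _ P (fun n w => K_ n.+1 w - K_ n w) (4 * C).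
  have mD n : measurable_fun setT (fun w => K_ n.+1 w - K_ n w) by exact: measurable_funB.
  have hD n : (sqn P (fun w => K_ n.+1 w - K_ n w)%R <= (4 * C * 16^-1 ^+ n)%:E)%E.
    rewrite (wiener_integral_sqn (wiener_integralB (gK n.+1) (gK n))).
    rewrite (@eq_sqn _ _ _ mu _ (fun u => (f u - g_ n u) + (-1) * (f u - g_ n.+1 u))); last first.
      by move=> u; congr (_ ^+ 2); ring.
    apply: (@le_trans _ _ (2 * (C * 16^-1 ^+ n) + 2 * (C * 16^-1 ^+ n.+1))%:E).
      apply: sqnD_le_bound.
      + exact: (measurable_funB mf (mg n)).
      + by apply: measurable_funM => //; exact: (measurable_funB mf (mg n.+1)).
      + exact: fg.
      + rewrite sqnZ ?sqrrN ?expr1n ?mul1e; first exact: fg.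
        exact: (measurable_funB mf (mg n.+1)).
    rewrite lee_fin exprS.
    have q0 : 0 <= C * 16^-1 ^+ n by rewrite mulr_ge0// exprn_ge0.
    lra.
  move=> /(_ mD hD); apply: filterS => w [k hk].
  have h2 : 0 <= (2^-1 : R) < 1 by rewrite invr_ge0 ler0n/= invf_lt1// ltr1n.
  have [cK _] := summable_increments_cvg h2 hk.
  suff -> : fine (limn_esup (fun n => (K_ n w)%:E)) = limn (K_ ^~ w) by exact: cK.
  have cE : (K_ n w)%:E @[n --> \oo] --> (limn (K_ ^~ w))%:E.
    by apply: cvg_EFin; [exact: nearW|exact: cK].
  rewrite is_cvg_limn_esupE; last by apply/cvg_ex; eexists; exact: cE.
  by rewrite (cvg_lim _ cE).
Unshelve. all: by end_near. Qed.

End wiener_integral.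

(** * Integrals of elementary functions are normal *)

Section partition.
Context {R : realType}.
Local Notation mu := (@lebesgue_measure R).

Lemma ordered_points (l : seq R) : all (fun x => 0 <= x) l ->
  exists (n : nat) (t : nat -> R), [/\ 0 <= t 0%N,
    {homo t : i j / (i <= j)%N >-> i <= j} &
    forall x, x \in l -> exists2 p, (p <= n)%N & x = t p].
Proof.
move=> l0; pose l' := sort <=%R (0 :: l).
have sl : sorted <=%R l' by apply: sort_sorted; exact: le_total.
have l'0 x : x \in l' -> 0 <= x.
  by rewrite mem_sort inE => /predU1P[->//|xl]; exact: (allP l0).
have szl : (0 < size l')%N by rewrite size_sort.
have lastl : last 0 l' \in l'.
  by case: (l') szl => // a l1 _; rewrite -[last _ _]/(last a l1) mem_last.
pose t i := nth (last 0 l') l' i.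
have tl i : t i \in l'.
  rewrite /t; have [il|il] := ltnP i (size l'); first exact: mem_nth.
  by rewrite nth_default.
exists (size l'), t; split.
- exact: l'0.
- move=> i j ij; rewrite /t; have [jl|jl] := ltnP j (size l').
    by apply: sorted_leq_nth => //; [exact: le_trans|rewrite inE (leq_ltn_trans ij)].
  rewrite [leRHS]nth_default//; have [il|il] := ltnP i (size l'); last first.
    by rewrite nth_default.
  rewrite [leLHS](set_nth_default 0)// -(nth_last 0 l').
  apply: sorted_leq_nth => //; [exact: le_trans| |].
    by rewrite inE prednK.
  by rewrite -ltnS prednK.
- move=> x xl; have xl' : x \in l' by rewrite mem_sort inE xl orbT.
  exists (index x l'); first by rewrite ltnW// index_mem.
  by rewrite /t nth_index.
Qed.

(** The values of F at the points t i clamped to [a, b] telescope. *)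
Lemma telescope_itv (t : nat -> R) n (a b : R) (F : R -> R) :
  {homo t : i j / (i <= j)%N >-> i <= j} -> a <= b ->
  (exists2 p, (p <= n)%N & a = t p) -> (exists2 p, (p <= n)%N & b = t p) ->
  F b - F a = \sum_(i < n) \1_(`]a, b]) (t i.+1) * (F (t i.+1) - F (t i)).
Proof.
move=> ht ab [p pn aE] [q qn bE].
pose G i := F (Num.min b (Num.max a (t i))).
have next c r i : c = t r -> c < t i.+1 -> c <= t i.
  move=> ->; have [ri|ir] := leqP r i; first by move=> _; exact: ht.
  by move=> h; have := ht _ _ ir; rewrite leNgt h.
have GE i : G i.+1 - G i = \1_(`]a, b]) (t i.+1) * (F (t i.+1) - F (t i)).
  rewrite /G indicE; have tS := ht _ _ (leqnSn i).
  have [ta|ta] := leP (t i.+1) a.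
    rewrite (max_l (le_trans tS ta)) memNset ?mul0r ?subrr//=.
    by rewrite in_itv/= ltNge ta.
  have ai := next _ _ _ aE ta; rewrite (max_r ai).
  have [tb|tb] := leP (t i.+1) b.
    rewrite mem_set/= ?in_itv/= ?ta ?tb// mul1r (min_r (le_trans tS tb)).
    by [].
  rewrite memNset ?mul0r; last by rewrite /= in_itv/= ta/= leNgt tb.
  by rewrite (min_l (next _ _ _ bE tb)) subrr.
under eq_bigr do rewrite -GE.
rewrite -(big_mkord xpredT (fun i => G i.+1 - G i)) telescope_sumr//.
congr (F _ - F _).
- rewrite min_l// le_max; apply/orP; right; rewrite bE; exact: ht.
- by rewrite max_l ?min_r// aE; exact: ht.
Qed.

(** The end points of s in one ordered list cut every interval of s into consecutive
    pieces. F is arbitrary, so that the identity serves for the paths of B as well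
    as for the functions v |-> 1_(u <= v), which give [elementary_fun s] at u. *)
Lemma elementary_telescope (s : @elementary R) : elementary_nonneg s ->
  exists (n : nat) (t : nat -> R), [/\ 0 <= t 0%N,
    {homo t : i j / (i <= j)%N >-> i <= j} &
    forall F : R -> R, \sum_(x <- s) x.1.1 * (F x.2 - F x.1.2) =
      \sum_(i < n) elementary_fun s (t i.+1) * (F (t i.+1) - F (t i))].
Proof.
move=> s0; pose l := [seq x.1.2 | x <- s] ++ [seq x.2 | x : R * R * R <- s].
have l0 : all (fun x => 0 <= x) l.
  rewrite all_cat !all_map; apply/andP; split; apply: sub_all s0 => x /=.
    by case/andP.
  by move=> /andP[]; exact: le_trans.
have [n [t [t0 ht tl]]] := ordered_points l0.
exists n, t; split=> // F.
under [RHS]eq_bigr do rewrite /elementary_fun mulr_suml.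
rewrite exchange_big/=; apply: eq_big_seq => x xs.
under eq_bigr do rewrite -mulrA.
rewrite -mulr_sumr; congr (_ * _); apply: telescope_itv => //.
- by have /andP[] := allP s0 _ xs.
- by apply: tl; rewrite mem_cat (map_f (fun x : R * R * R => x.1.2) xs).
- by apply: tl; rewrite mem_cat (map_f (fun x : R * R * R => x.2) xs) orbT.
Qed.

Lemma sqr_step_fun (t C : nat -> R) n u : {homo t : i j / (i <= j)%N >-> i <= j} ->
  (\sum_(i < n) C i * \1_(`]t i, t i.+1]) u) ^+ 2 =
  \sum_(i < n) C i ^+ 2 * \1_(`]t i, t i.+1]) u.
Proof.
move=> ht; elim: n => [|n IH]; first by rewrite !big_ord0 expr0n.
rewrite !big_ord_recr/=.
have [un|un] := leP u (t n).
  by rewrite indicE memNset/= ?in_itv/= ?ltNge ?un// !mulr0 !addr0 IH.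
have z i : (i < n)%N -> \1_(`]t i, t i.+1]) u = 0 :> R.
  move=> iN; rewrite indicE memNset//= in_itv/=; apply/negP; rewrite negb_and.
  by rewrite -[X in _ || X]ltNge (le_lt_trans (ht _ _ iN))// orbT.
rewrite !big1 ?add0r; last 2 first.
- by move=> i _; rewrite z// mulr0.
- by move=> i _; rewrite z// mulr0.
rewrite exprMn; congr (_ * _); rewrite indicE; case: (_ \in _) => /=.
  by rewrite expr1n.
by rewrite expr0n.
Qed.

Lemma integral_indic_itv (a b : R) : a <= b ->
  (\int[mu]_u (\1_(`]a, b]) u)%:E = (b - a)%:E)%E.
Proof.
move=> ab.
have -> : (\int[mu]_u (\1_(`]a, b]) u)%:E = mu (`]a, b] `&` setT))%E.
  exact: integral_indic.
rewrite setIT; apply: etrans (lebesgue_measure_itv _) _ => /=.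
rewrite lte_fin; case: ifPn => [_|]; first by rewrite EFinB.
rewrite -leNgt => ba; have /eqP -> : b == a by rewrite eq_le ba ab.
by rewrite subrr.
Qed.

Lemma indic_itvE (a b u : R) : a <= b -> \1_(`]a, b]) u = (u <= b)%R%:R - (u <= a)%R%:R :> R.
Proof.
move=> ab; rewrite indicE; have [ua|au] := leP u a.
  by rewrite memNset/= ?in_itv/= ?(le_trans ua ab) ?subrr// ltNge ua.
have [ub|bu] := leP u b; first by rewrite mem_set/= ?in_itv/= ?au ?ub// subr0.
by rewrite memNset/= ?subr0// in_itv/= au leNgt bu.
Qed.

Lemma sqn_elementary_fun (s : @elementary R) n (t : nat -> R) :
  {homo t : i j / (i <= j)%N >-> i <= j} -> elementary_nonneg s ->
  (forall F : R -> R, \sum_(x <- s) x.1.1 * (F x.2 - F x.1.2) =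
      \sum_(i < n) elementary_fun s (t i.+1) * (F (t i.+1) - F (t i))) ->
  sqn mu (elementary_fun s) =
    (\sum_(i < n) elementary_fun s (t i.+1) ^+ 2 * (t i.+1 - t i))%:E.
Proof.
move=> ht s0 sE.
have eE u : elementary_fun s u =
    \sum_(i < n) elementary_fun s (t i.+1) * \1_(`]t i, t i.+1]) u.
  (* For F v = 1_(u <= v) the left-hand side is [elementary_fun s u]. *)
  have := sE (fun v => (u <= v)%R%:R).
  rewrite /elementary_fun; under eq_big_seq.
    by move=> x /(allP s0) /andP[_ ab]; rewrite -indic_itvE//; over.
  move=> ->; apply: eq_bigr => i _; rewrite -indic_itvE//; exact: ht.
rewrite /sqn; under eq_integral.
  move=> u _; rewrite eE (sqr_step_fun (fun i => elementary_fun s (t i.+1)))//.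
  rewrite -sumEFin; over.
rewrite ge0_integral_sum//; last 2 first.
- by move=> i; apply/measurable_EFinP; exact: measurable_funM.
- by move=> i u _; rewrite lee_fin mulr_ge0// sqr_ge0.
rewrite -sumEFin; apply: eq_bigr => i _.
under eq_integral do rewrite EFinM.
rewrite ge0_integralZl//; last 2 first.
- by apply/measurable_EFinP.
- by rewrite lee_fin sqr_ge0.
by rewrite [RHS]EFinM integral_indic_itv// ht.
Qed.

End partition.

Section wiener_increments.
Context {R : realType} {d : measure_display} {Omega : measurableType d}.
Variables (P : probability Omega R) (B : R -> Omega -> R).
Hypothesis hB : standard_wiener_process P B.
Local Notation mu := (@lebesgue_measure R).

Section fixed_partition.
Variables (t C : nat -> R) (n : nat).
Hypotheses (t0 : 0 <= t 0%N) (ht : {homo t : i j / (i <= j)%N >-> i <= j}).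

Let D (i : nat) (w : Omega) : R := B (t i.+1) w - B (t i) w.
Let S (k : nat) (w : Omega) : R := \sum_(i < k) C i * D i w.
Let v (k : nat) : R := \sum_(i < k) C i ^+ 2 * (t i.+1 - t i).
Let Ev (A : nat -> set R) k : set Omega :=
  [set w | forall i, (k <= i < n)%N -> A i (D i w)].

Let dt0 i : 0 <= t i.+1 - t i. Proof. by rewrite subr_ge0 ht. Qed.

Let v0 k : 0 <= v k.
Proof. by apply: sumr_ge0 => i _; rewrite mulr_ge0// sqr_ge0. Qed.

Let gD i : gaussian P (D i) (t i.+1 - t i).
Proof.
apply/gaussian_has_normal_law => //; have [_ h _ _ _] := hB; apply: h.
by rewrite (le_trans t0 (ht _))//= ht.
Qed.

Let mD i : measurable_fun setT (D i). Proof. exact: gaussian_measurable (gD i). Qed.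
Let mS k : measurable_fun setT (S k).
Proof. by apply: measurable_sum => i; exact: measurable_funM. Qed.

Let mDA i (A : set R) : measurable A -> measurable (D i @^-1` A).
Proof. by move=> mA; rewrite -[X in measurable X]setTI; exact: mD. Qed.

Let mEv A k : (forall i, measurable (A i)) -> measurable (Ev A k).
Proof.
move=> mA; have -> : Ev A k =
    \bigcap_(i in [set i | (k <= i < n)%N]) (D i @^-1` A i) by [].
by apply: bigcap_measurableType => i _; exact: mDA.
Qed.

Let EvS A k : (k < n)%N -> Ev A k = D k @^-1` A k `&` Ev A k.+1.
Proof.
move=> kn; apply/seteqP; split=> w /=.
  by move=> h; split=> [|i /andP[ki iN]]; apply: h; rewrite ?leqnn ?kn// iN (ltnW ki).
move=> [h1 h2] i /andP[]; rewrite leq_eqVlt => /predU1P[<-//|ki iN].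
by apply: h2; rewrite ki.
Qed.

(** The increments from k on have to be carried along: independence of S k and the
    k-th increment alone is not enough for the induction. *)
Let joint_law k (A : nat -> set R) (A0 : set R) : (k <= n)%N ->
  (forall i, measurable (A i)) -> measurable A0 ->
  P (S k @^-1` A0 `&` Ev A k) =
    (gauss_law (v k) A0 * \prod_(k <= i < n) P (D i @^-1` A i))%E.
Proof.
elim: k A A0 => [|k IH] A A0 kn mA mA0.
  have -> : S 0 @^-1` A0 = [set w | A0 0].
    by apply/seteqP; split=> w /=; rewrite /S big_ord0.
  rewrite /v big_ord0 gauss_lawE// eqxx diracE.
  have [A00|A00] := pselect (A0 0); last first.
    rewrite memNset// mul0e (_ : _ `&` _ = set0) ?measure0//.
    by apply/seteqP; split=> w // [].
  rewrite mem_set// mul1e (_ : _ `&` _ = \bigcap_(i : 'I_n) (D i @^-1` A i)); last first.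
    apply/seteqP; split=> w /=.
      by move=> [_ h] i _; apply: h; rewrite /= ltn_ord.
    by move=> h; split=> // i /= iN; exact: (h (Ordinal iN) I).
  have [_ _ ind _ _] := hB.
  rewrite (ind n t t0 ht (fun i => A i))//.
  by rewrite (big_mkord xpredT (fun i => P (D i @^-1` A i))).
have mE := mEv k.+1 mA.
pose q := (\prod_(k.+1 <= i < n) P (D i @^-1` A i))%E.
have qfin : q \is a fin_num.
  by apply: prode_fin_num => i _; rewrite fin_num_measure//; exact: mDA.
have q0 : (0 <= q)%E by apply: prode_ge0 => i _; exact: measure_ge0.
have gCD : gaussian P (fun w => C k * D k w) (C k ^+ 2 * (t k.+1 - t k)).
  exact: gaussian_scale.
have Ck0 : 0 <= C k ^+ 2 * (t k.+1 - t k) by rewrite mulr_ge0// sqr_ge0.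
have := @gaussian_add_law _ _ _ (mrestr P mE) (fine q) (S k) (fun w => C k * D k w)
  (v k) (C k ^+ 2 * (t k.+1 - t k)) (mS k) (gaussian_measurable gCD)
  (fine_ge0 q0) (v0 k) Ck0.
have prodE (A1 A2 : set R) : measurable A1 -> measurable A2 ->
   mrestr P mE (S k @^-1` A1 `&` (fun w => C k * D k w) @^-1` A2) =
   ((fine q)%:E * (gauss_law (v k) A1 * gauss_law (C k ^+ 2 * (t k.+1 - t k)) A2))%E.
  move=> mA1 mA2; rewrite /mrestr -setIA.
  pose A' i := if i == k then (fun x => C k * x) @^-1` A2 else A i.
  have mA' i : measurable (A' i).
    rewrite /A'; case: ifP => // _; rewrite -[X in measurable X]setTI.
    exact: mulrl_measurable.
  have -> : (fun w => C k * D k w) @^-1` A2 `&` Ev A k.+1 = Ev A' k.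
    rewrite (EvS A' kn) /A' eqxx; congr (_ `&` _).
    apply/seteqP; split=> w /= h i /andP[ki iN]; have := h i;
      by rewrite (gtn_eqF ki) ki iN; exact.
  rewrite (IH A' A1 (ltnW kn))// big_ltn//.
  have -> : (\prod_(k.+1 <= i < n) P (D i @^-1` A' i) = q)%E.
    by apply: eq_big_nat => i /andP[ki _]; rewrite /A' (gtn_eqF ki).
  have -> : P (D k @^-1` A' k) = gauss_law (C k ^+ 2 * (t k.+1 - t k)) A2.
    by rewrite -(gCD.2 _ mA2) /A' eqxx.
  by rewrite fineK// muleA muleC.
have vS : v k.+1 = v k + C k ^+ 2 * (t k.+1 - t k) by rewrite /v big_ord_recr.
move=> /(_ prodE A0 mA0); rewrite fineK// vS [RHS]muleC => <-.
  rewrite /mrestr; congr (P (_ `&` _)).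
  by apply/seteqP; split=> w /=; rewrite /S big_ord_recr.
Qed.

Lemma gaussian_increment_sum :
  gaussian P (fun w => \sum_(i < n) C i * (B (t i.+1) w - B (t i) w))
    (\sum_(i < n) C i ^+ 2 * (t i.+1 - t i)).
Proof.
split; first exact: (mS n).
move=> A mA; have := @joint_law n (fun=> setT) A (leqnn n) (fun=> measurableT) mA.
rewrite big_geq// mule1 => <-; congr (P _).
apply/seteqP; split=> w /=; last by case.
by move=> h; split=> // i /andP[ni]; rewrite ltnNge ni.
Qed.

End fixed_partition.

Lemma wiener_elementary_gaussian s : elementary_nonneg s ->
  gaussian P (elementary_integral B s) (fine (sqn mu (elementary_fun s))) /\
  (sqn mu (elementary_fun s) < +oo)%E.
Proof.
move=> s0; have [n [t [t0 ht sE]]] := elementary_telescope s0.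
rewrite (sqn_elementary_fun ht s0 sE); split; last exact: ltry.
have -> : elementary_integral B s =
    (fun w => \sum_(i < n) elementary_fun s (t i.+1) * (B (t i.+1) w - B (t i) w)).
  by apply/funext => w; exact: (sE (B ^~ w)).
exact: (gaussian_increment_sum (fun i => elementary_fun s (t i.+1))).
Qed.

End wiener_increments.

(** * Continuous modifications *)

Section dyadic.
Context {R : realType}.

Definition dyadic (m : nat) (z : int) : R := z%:~R / 2 ^+ m.

Definition dyadic_floor (m : nat) (t : R) : int := Num.floor (2 ^+ m * t).

Let e2 m : 0 < (2 : R) ^+ m. Proof. exact: exprn_gt0. Qed.

Lemma dyadic_floor_bounds m (t : R) :
  (dyadic_floor m t)%:~R <= 2 ^+ m * t < (dyadic_floor m t)%:~R + 1.
Proof. by rewrite /dyadic_floor floor_le_tmp// -intrD1 floorD1_gt. Qed.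

Lemma dyadic_floor_dist m (t : R) : `|t - dyadic m (dyadic_floor m t)| <= 2^-1 ^+ m.
Proof.
have /andP[h1 h2] := dyadic_floor_bounds m t.
have E : 2 ^+ m * (t - dyadic m (dyadic_floor m t)) = 2 ^+ m * t - (dyadic_floor m t)%:~R.
  by rewrite /dyadic mulrBr; congr (_ - _); rewrite mulrC divfK// gt_eqF.
rewrite exprVn -(ler_pM2l (e2 m)) mulfV ?gt_eqF//.
rewrite -{1}(ger0_norm (ltW (e2 m))) -normrM E ger0_norm ?subr_ge0//.
by rewrite lerBlDl ltW.
Qed.

Lemma dyadic_refine m (z : int) : dyadic m z = dyadic m.+1 (2 * z).
Proof.
rewrite /dyadic exprS intrM; field.
by rewrite gt_eqF.
Qed.

Lemma dyadic_floorS m (t : R) :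
  dyadic_floor m.+1 t = 2 * dyadic_floor m t \/
  dyadic_floor m.+1 t = 2 * dyadic_floor m t + 1.
Proof.
have /andP[h1 h2] := dyadic_floor_bounds m t.
have /andP[h3 h4] := dyadic_floor_bounds m.+1 t.
set k := dyadic_floor m t in h1 h2 *; set l := dyadic_floor m.+1 t in h3 h4 *.
rewrite exprS -mulrA in h3 h4.
have a1 : (2 * k)%:~R < (l + 1)%:~R :> R by rewrite intrD intrM; lra.
have a2 : l%:~R < (2 * k + 2)%:~R :> R by rewrite intrD intrM; lra.
rewrite ltr_int in a1; rewrite ltr_int in a2.
have [b1 b2] : (2 * k <= l)%R /\ (l <= 2 * k + 1)%R by split; lia.
by have [->|] := eqVneq l (2 * k); [left|right; lia].
Qed.

Lemma dyadic_floor_range (N m : nat) (t : R) : - N%:R < t < N%:R ->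
  - (N * 2 ^ m)%:Z <= dyadic_floor m t < (N * 2 ^ m)%:Z.
Proof.
move=> /andP[t1 t2]; have /andP[h1 h2] := dyadic_floor_bounds m t.
set k := dyadic_floor m t in h1 h2 *.
have NE : ((N * 2 ^ m)%:Z)%:~R = 2 ^+ m * N%:R :> R.
  by rewrite -natrX -natrM mulnC.
have u : 2 ^+ m * t < 2 ^+ m * N%:R by rewrite ltr_pM2l.
have l : 2 ^+ m * (- N%:R) < 2 ^+ m * t by rewrite ltr_pM2l.
have a1 : (- (N * 2 ^ m)%:Z)%:~R < (k + 1)%:~R :> R.
  by rewrite intrD intrN NE -mulrN (lt_trans l).
have a2 : k%:~R < ((N * 2 ^ m)%:Z)%:~R :> R by rewrite NE (le_lt_trans h1).
rewrite ltr_int in a1; rewrite ltr_int in a2.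
by rewrite a2 andbT; lia.
Qed.

Lemma dyadic_floor_near m (s t : R) : s <= t -> t - s <= 2^-1 ^+ m ->
  dyadic_floor m t = dyadic_floor m s \/ dyadic_floor m t = dyadic_floor m s + 1.
Proof.
move=> st; rewrite exprVn -(ler_pM2l (e2 m)) mulfV ?gt_eqF// mulrBr => ts.
have st' : 2 ^+ m * s <= 2 ^+ m * t by rewrite ler_pM2l.
have /andP[h1 h2] := dyadic_floor_bounds m t.
have /andP[h3 h4] := dyadic_floor_bounds m s.
set k := dyadic_floor m t in h1 h2 *; set l := dyadic_floor m s in h3 h4 *.
have a1 : l%:~R < (k + 1)%:~R :> R by rewrite intrD; lra.
have a2 : k%:~R < (l + 2)%:~R :> R by rewrite intrD; lra.
rewrite ltr_int in a1; rewrite ltr_int in a2.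
by have [->|] := eqVneq k l; [left|right; lia].
Qed.

Section path.
Variables (y : R -> R) (rho : R).
Hypothesis rho01 : 0 <= rho < 1.
Hypothesis y_incr : forall N : nat, exists K, forall m (z : int),
  - (N * 2 ^ m)%:Z <= z < (N * 2 ^ m)%:Z ->
  `|y (dyadic m (z + 1)) - y (dyadic m z)| <= K * rho ^+ m.

Let u (t : R) m := y (dyadic m (dyadic_floor m t)).

Let u_incr (N : nat) (K : R) : (forall m (z : int),
  - (N * 2 ^ m)%:Z <= z < (N * 2 ^ m)%:Z ->
  `|y (dyadic m (z + 1)) - y (dyadic m z)| <= K * rho ^+ m) ->
  0 <= K -> forall t, - N%:R < t < N%:R -> forall m, `|u t m.+1 - u t m| <= K * rho ^+ m.
Proof.
move=> yK K0 t tN m; have /andP[r0 r1] := rho01.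
have Krho j : 0 <= K * rho ^+ j by rewrite mulr_ge0// exprn_ge0.
rewrite /u (dyadic_refine m); have [h|h] := dyadic_floorS m t.
  by rewrite h subrr normr0.
have := dyadic_floor_range m.+1 tN; rewrite h => /andP[h1 h2].
apply: (@le_trans _ _ (K * rho ^+ m.+1)); last first.
  by rewrite exprS ler_wpM2l// ler_piMl ?exprn_ge0// ltW.
apply: (yK m.+1); move: h1 h2.
rewrite (_ : (N * 2 ^ m.+1 = 2 * (N * 2 ^ m))%N); last by rewrite expnS mulnCA.
by move: (N * 2 ^ m)%N => M; lia.
Qed.

Lemma dyadic_limit (t : R) : cvgn (u t).
Proof.
have tN : - (Num.truncn `|t|).+1%:R < t < (Num.truncn `|t|).+1%:R.
  by rewrite -ltr_norml truncnS_gt.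
have [K yK] := y_incr (Num.truncn `|t|).+1.
have K0 : 0 <= K.
  have := yK 0%N 0; rewrite expr0 mulr1 expn0 muln1 => h.
  by apply: le_trans (h _); rewrite ?normr_ge0.
by have [] := summable_increments_cvg rho01 (u_incr yK K0 tN).
Qed.

(** Points at a distance of at most 2^-m have equal or adjacent dyadic floors of level
    m, so that the limits differ by at most a multiple of rho^m. *)
Lemma continuous_dyadic_limit : continuous (fun t => limn (u t)).
Proof.
move=> t; pose N := (Num.truncn (`|t| + 1)).+1.
have tN (s : R) : `|t - s| < 1 -> - N%:R < s < N%:R.
  move=> ts; rewrite -ltr_norml; apply: lt_trans (truncnS_gt _).
  rewrite -(subrK t s) (le_lt_trans (ler_normD _ _))// addrC ltrD2l distrC//.
have [K yK] := y_incr N.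
have K0 : 0 <= K.
  have := yK 0%N 0; rewrite expr0 mulr1 expn0 muln1 => h.
  by apply: le_trans (h _); rewrite ?normr_ge0.
have /andP[r0 r1] := rho01.
have r1' : 0 < 1 - rho by rewrite subr_gt0.
pose L := 2 * K / (1 - rho) + K.
have L0 : 0 <= L by rewrite addr_ge0// divr_ge0 ?mulr_ge0// ltW.
have mod_cont m s : `|t - s| < 1 -> `|t - s| <= 2^-1 ^+ m ->
    `|limn (u t) - limn (u s)| <= L * rho ^+ m.
  move=> ts1 tsm.
  have t1 : `|t - t| < 1 by rewrite subrr normr0.
  have [_ ht] := summable_increments_cvg rho01 (u_incr yK K0 (tN t t1)).
  have [_ hs] := summable_increments_cvg rho01 (u_incr yK K0 (tN s ts1)).
  have hts : `|u t m - u s m| <= K * rho ^+ m.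
    have Krho : 0 <= K * rho ^+ m by rewrite mulr_ge0// exprn_ge0.
    have key a b : - N%:R < a < N%:R -> - N%:R < b < N%:R -> a <= b ->
        b - a <= 2^-1 ^+ m -> `|u b m - u a m| <= K * rho ^+ m.
      move=> aN bN ab abm; rewrite /u.
      have [->|h] := dyadic_floor_near ab abm; first by rewrite subrr normr0.
      have /andP[h1 h2] := dyadic_floor_range m bN.
      have /andP[h3 h4] := dyadic_floor_range m aN.
      by rewrite h; apply: yK; rewrite h3 h4.
    have [st|/ltW st] := leP s t.
      apply: key => //; [exact: tN|exact: tN|].
      by rewrite (le_trans (ler_norm _)).
    rewrite distrC; apply: key => //; [exact: tN|exact: tN|].
    by rewrite (le_trans (ler_norm _))// distrC.
  rewrite (_ : limn (u t) - limn (u s) = (limn (u t) - u t m) +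
     ((u t m - u s m) - (limn (u s) - u s m))); last by ring.
  apply: le_trans (ler_normD _ _) _; apply: le_trans (lerD (ht m) (ler_normB _ _)) _.
  apply: le_trans (lerD (lexx _) (lerD hts (hs m))) _.
  by rewrite /L le_eqVlt; apply/orP; left; apply/eqP; field; rewrite gt_eqF.
apply/cvgrPdist_le => e e0; near \oo => m.
have Lm : L * rho ^+ m <= e.
  apply: (@le_trans _ _ (L * (e / (L + 1)))).
    rewrite ler_wpM2l//; near: m; apply: sqn_lt_expr_near => //.
    by rewrite divr_gt0// ltr_wpDl.
  by rewrite mulrCA ler_piMr ?(ltW e0)// ler_pdivrMr ?ltr_wpDl// mul1r lerDl.
have q0 : 0 < (2^-1 : R) ^+ m by rewrite exprn_gt0.
near=> s; apply: le_trans Lm; apply: mod_cont.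
  by near: s; apply: (@cvgr_dist_lt _ _ _ _ _ id t) => //; exact: cvg_id.
by rewrite ltW//; near: s; apply: (@cvgr_dist_lt _ _ _ _ _ id t) => //; exact: cvg_id.
Unshelve. all: by end_near. Qed.

End path.
End dyadic.

Section kolmogorov.
Context d (Omega : measurableType d) (R : realType) (P : probability Omega R).

(** Any rho < 1 with rho^4 > 1/2 would do. There are of order 2^m increments of level
    m with fourth moments of order 4^-m, hence a sum of order 2^-m, which must
    remain summable after division by rho^(4 m). *)
Let rho : R := 9 / 10.
Let rho01 : 0 <= rho < 1. Proof. by rewrite /rho; lra. Qed.

Let rho_gt0 m : 0 < rho ^+ m. Proof. by rewrite exprn_gt0// /rho; lra. Qed.

Let fourth_root_bound (x K : R) m : x ^+ 4 <= K * rho ^+ (4 * m) -> `|x| <= (K + 1) * rho ^+ m.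
Proof.
move=> xK; have r0 := rho_gt0 m.
rewrite -ler_pdivrMr//; set z := `|x| / rho ^+ m.
have z0 : 0 <= z by rewrite divr_ge0// ltW.
have zK : z ^+ 4 <= K.
  have -> : z ^+ 4 = x ^+ 4 / rho ^+ (4 * m).
    rewrite /z expr_div_n -exprM (mulnC m) -normrX ger0_norm//.
    by rewrite (exprM x 2 2) sqr_ge0.
  by rewrite ler_pdivrMr.
have : z ^+ 4 = z * z * z * z by rewrite !exprS expr0 mulr1 !mulrA.
move=> z4; rewrite z4 in zK; have [z1|z1] := leP z 1.
  have : 0 <= K by apply: le_trans zK; do 3?[apply: mulr_ge0 => //].
  by lra.
have : 0 <= z * z - 1 by nra.
by nra.
Qed.

Lemma ae_rho_bound (V : nat -> Omega -> R) (C : R) :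
  (forall m, measurable_fun setT (V m)) -> (forall m w, 0 <= V m w) ->
  (forall m, \int[P]_w (V m w)%:E <= (C * 2^-1 ^+ m)%:E)%E ->
  {ae P, forall w, exists K, forall m, V m w <= K * rho ^+ (4 * m)}.
Proof.
move=> mV V0 EV.
have r4 m : 0 < rho ^+ (4 * m) by exact: rho_gt0.
pose q : R := (2 * rho ^+ 4)^-1.
have q01 : 0 <= q < 1.
  have h : 1 < 2 * rho ^+ 4 by rewrite /rho !exprS expr0; lra.
  have h0 : 0 < 2 * rho ^+ 4 by apply: lt_trans h.
  by rewrite /q invr_ge0 (ltW h0) invf_lt1.
have := @ae_bounded_of_geometric _ _ _ P (fun m w => V m w / rho ^+ (4 * m)) C _ q01.
have mU m : measurable_fun setT (fun w => V m w / rho ^+ (4 * m)) by exact: measurable_funM.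
have U0 m w : 0 <= V m w / rho ^+ (4 * m) by rewrite divr_ge0// ltW.
have EU m : (\int[P]_w (V m w / rho ^+ (4 * m))%:E <= (C * q ^+ m)%:E)%E.
  under eq_integral do rewrite EFinM.
  rewrite ge0_integralZr//; last 3 first.
  - exact/measurable_EFinP.
  - by move=> w _; rewrite lee_fin.
  - by rewrite lee_fin invr_ge0 ltW.
  have -> : C * q ^+ m = C * 2^-1 ^+ m * (rho ^+ (4 * m))^-1.
    by rewrite /q !exprVn exprMn (exprM rho) invfM mulrA.
  rewrite [leRHS]EFinM; apply: lee_wpmul2r; last exact: EV.
  by rewrite lee_fin invr_ge0 ltW.
move=> /(_ mU U0 EU); apply: filterS => w [K hK]; exists K => m.
by rewrite -ler_pdivrMr// hK.
Qed.

Variables (Y : R -> Omega -> R) (C : R).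
Hypothesis C0 : 0 <= C.
Hypothesis mY : forall t, measurable_fun setT (Y t).
Hypothesis Y4 : forall s t,
  (\int[P]_w ((Y t w - Y s w) ^+ 4)%:E <= (C * (t - s) ^+ 2)%:E)%E.

Let x40 (x : R) : 0 <= x ^+ 4. Proof. by rewrite (exprM x 2 2) sqr_ge0. Qed.

Let m4 s t : measurable_fun setT (fun w => (Y t w - Y s w) ^+ 4).
Proof. by apply: measurable_funX; exact: measurable_funB. Qed.

Let ae_dyadic_increments : {ae P, forall w, forall N : nat, exists K, forall m (z : int),
  - (N * 2 ^ m)%:Z <= z < (N * 2 ^ m)%:Z ->
  `|Y (dyadic m (z + 1)) w - Y (dyadic m z) w| <= K * rho ^+ m}.
Proof.
apply: ae_foralln => N.
pose zi m (i : nat) : int := i%:Z - (N * 2 ^ m)%:Z.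
pose V m w := \sum_(i < (2 * N * 2 ^ m)%N) (Y (dyadic m (zi m i + 1)) w - Y (dyadic m (zi m i)) w) ^+ 4.
have mV m : measurable_fun setT (V m) by apply: measurable_sum => i; exact: m4.
have V0 m w : 0 <= V m w by apply: sumr_ge0.
have EV m : (\int[P]_w (V m w)%:E <= (2 * N%:R * C * 2^-1 ^+ m)%:E)%E.
  under eq_integral do rewrite -sumEFin.
  rewrite ge0_integral_sum//; last 2 first.
  - by move=> i; apply/measurable_EFinP; exact: m4.
  - by move=> i w _; rewrite lee_fin.
  apply: (@le_trans _ _ (\sum_(i < (2 * N * 2 ^ m)%N) (C * (2^-1 ^+ m) ^+ 2)%:E)%E).
    apply: lee_sum => i _; apply: le_trans (Y4 _ _) _; rewrite lee_fin.
    rewrite le_eqVlt; apply/orP; left; apply/eqP; congr (_ * _ ^+ 2).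
    by rewrite /dyadic intrD mulrDl addrAC subrr add0r mul1r exprVn.
  rewrite sumEFin lee_fin sumr_const card_ord -[leLHS]mulr_natl !natrM natrX.
  rewrite le_eqVlt; apply/orP; left; apply/eqP.
  rewrite exprVn; field; by rewrite gt_eqF// exprn_gt0.
have := ae_rho_bound mV V0 EV; apply: filterS => w [K hK]; exists (K + 1) => m z zN.
apply: fourth_root_bound; apply: le_trans (hK m).
have [i iN zE] : exists2 i : nat, (i < 2 * N * 2 ^ m)%N & z = zi m i.
  exists (absz (z + (N * 2 ^ m)%:Z)); last by rewrite /zi; lia.
  have : (2 * N * 2 ^ m = N * 2 ^ m + N * 2 ^ m)%N by lia.
  by move=> ->; lia.
rewrite /V (bigD1 (Ordinal iN))//= -zE lerDl sumr_ge0//.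
Qed.

(** Kolmogorov's continuity theorem with the exponents 4 and 2: X is the limit of Y
    along the dyadic floors of t, and 0 on a null set. *)
Lemma continuous_modification : exists X : R -> Omega -> R,
  [/\ forall t, measurable_fun setT (X t), forall w, continuous (X ^~ w) &
      forall t, {ae P, forall w, X t w = Y t w}].
Proof.
have [M [mM PM0 MP]] := ae_dyadic_increments.
pose u (t : R) (w : Omega) (m : nat) := Y (dyadic m (dyadic_floor m t)) w.
pose X (t : R) (w : Omega) : R := fine (limn_esup (fun m => (u t w m)%:E)) * \1_(~` M) w.
have good w : ~ M w -> forall N : nat, exists K, forall m (z : int),
  - (N * 2 ^ m)%:Z <= z < (N * 2 ^ m)%:Z ->
  `|Y (dyadic m (z + 1)) w - Y (dyadic m z) w| <= K * rho ^+ m.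
  by move=> Mw; apply: contrapT => h; apply: Mw; exact: MP.
have XE t w : ~ M w -> X t w = limn (u t w).
  move=> Mw; rewrite /X indicE mem_set// mulr1.
  have cu : cvgn (u t w) by exact: (@dyadic_limit _ (Y ^~ w) _ rho01 (good w Mw) t).
  have cE : (u t w n)%:E @[n --> \oo] --> (limn (u t w))%:E.
    by apply: cvg_EFin; [exact: nearW|exact: cu].
  rewrite is_cvg_limn_esupE; last by apply/cvg_ex; eexists; exact: cE.
  by rewrite (cvg_lim _ cE).
exists X; split.
- move=> t; apply: measurable_funM; last exact: measurable_indic (measurableC mM).
  apply: (measurableT_comp (@fine_measurable R setT measurableT)) => //.
  by apply: measurable_fun_limn_esup => n; apply/measurable_EFinP; exact: mY.
- move=> w; have [Mw|Mw] := pselect (M w).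
    rewrite (_ : X ^~ w = cst 0); first exact: cst_continuous.
    by apply/funext => t; rewrite /X indicE memNset ?mulr0//; apply.
  rewrite (_ : X ^~ w = fun t => limn (u t w)).
    exact: (@continuous_dyadic_limit _ (Y ^~ w) _ rho01 (good w Mw)).
  by apply/funext => t; exact: XE.
- move=> t.
  pose V m w := (Y (dyadic m (dyadic_floor m t)) w - Y t w) ^+ 4.
  have EV m : (\int[P]_w (V m w)%:E <= (C * 2^-1 ^+ m)%:E)%E.
    apply: le_trans (Y4 _ _) _; rewrite lee_fin ler_wpM2l//.
    rewrite -sqrrN opprB -real_normK ?num_real//.
    apply: (@le_trans _ _ ((2^-1 ^+ m) ^+ 2)).
      by rewrite ler_sqr ?nnegrE ?exprn_ge0 ?invr_ge0//; exact: dyadic_floor_dist.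
    by rewrite expr2 ler_piMl ?exprn_ge0// exprn_ile1// invf_le1// ler1n.
  have Mae : {ae P, forall w, ~ M w} by exists M; split=> // w /contrapT.
  have := ae_rho_bound (fun m => m4 _ _) (fun m w => x40 _) EV.
  move: Mae; apply: filterS2 => w Mw [K hK].
  rewrite (XE t w Mw); apply/cvg_lim => //.
  have b m : `|u t w m - Y t w| <= (K + 1) * rho ^+ m by apply: fourth_root_bound; exact: hK.
  have K1 : 0 <= K + 1.
    by have := b 0%N; rewrite expr0 mulr1; exact: le_trans.
  apply/cvgrPdist_le => e e0; near=> m; rewrite distrC; apply: le_trans (b m) _.
  apply: (@le_trans _ _ ((K + 1) * (e / (K + 1 + 1)))).
    rewrite ler_wpM2l//; near: m; apply: sqn_lt_expr_near => //.
    by rewrite divr_gt0// ltr_wpDl.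
  by rewrite mulrCA ler_piMr ?(ltW e0)// ler_pdivrMr ?ltr_wpDl// mul1r lerDl.
Unshelve. all: by end_near. Qed.

End kolmogorov.

(** * Ornstein-Uhlenbeck processes from Wiener processes *)

Section second_moments.
Context d (T : measurableType d) (R : realType) (P : probability T R).
Implicit Types X Y : T -> R.

Lemma integrable_sqr X (a : R) : measurable_fun setT X -> sqn P X = a%:E ->
  P.-integrable setT (fun w => (X w ^+ 2)%:E).
Proof.
move=> mX Xa; apply/integrableP; split; first exact: measurable_sqr_EFin.
under eq_integral do rewrite gee0_abs ?lee_fin ?sqr_ge0//.
by move: Xa; rewrite /sqn => ->; rewrite ltry.
Qed.

Lemma integrable_mul X Y (a b : R) : measurable_fun setT X -> measurable_fun setT Y ->
  sqn P X = a%:E -> sqn P Y = b%:E -> P.-integrable setT (fun w => (X w * Y w)%:E).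
Proof.
move=> mX mY Xa Yb.
apply: (le_integrable measurableT _ _
  (integrableD measurableT (integrable_sqr mX Xa) (integrable_sqr mY Yb))).
- by apply/measurable_EFinP; exact: measurable_funM.
- move=> w _; rewrite /= lee_fin [leRHS]ger0_norm ?addr_ge0 ?sqr_ge0//.
  by rewrite ler_norml; apply/andP; split; nra.
Qed.

(** All square integrals being finite, (X - Y)^2 can be expanded under the integral. *)
Lemma polarization X Y (a b c m : R) : measurable_fun setT X -> measurable_fun setT Y ->
  sqn P X = a%:E -> sqn P Y = b%:E -> sqn P (fun w => X w - Y w)%R = c%:E ->
  (\int[P]_w (X w * Y w)%:E = m%:E)%E -> c = a + b - 2 * m.
Proof.
move=> mX mY Xa Yb XYc XYm.
have iX := integrable_sqr mX Xa; have iY := integrable_sqr mY Yb.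
have mD : measurable_fun setT (fun w => X w - Y w) by exact: measurable_funB.
have iD := integrable_sqr mD XYc.
have iXY := integrable_mul mX mY Xa Yb.
have i2 := integrableZl measurableT 2 iXY.
have : (\int[P]_w ((X w ^+ 2)%:E + (Y w ^+ 2)%:E) =
        \int[P]_w (((X w - Y w) ^+ 2)%:E + 2%:E * (X w * Y w)%:E))%E.
  by apply: eq_integral => w _; rewrite -EFinM -!EFinD; congr EFin; ring.
rewrite integralD// integralD// integralZl// XYm.
move: Xa Yb XYc; rewrite /sqn => -> -> ->; rewrite -EFinM -!EFinD => -[]; lra.
Qed.

Lemma sqnB_of_mul X Y (a b m : R) : measurable_fun setT X -> measurable_fun setT Y ->
  sqn P X = a%:E -> sqn P Y = b%:E ->
  (\int[P]_w (X w * Y w)%:E = m%:E)%E ->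
  sqn P (fun w => X w - Y w)%R = (a + b - 2 * m)%:E.
Proof.
move=> mX mY Xa Yb XYm.
have mD : measurable_fun setT (fun w => X w - Y w) by exact: measurable_funB.
have Dfin : sqn P (fun w => X w - Y w)%R \is a fin_num.
  rewrite ge0_fin_numE ?sqn_ge0//.
  apply: (@le_lt_trans _ _ (2 * a + 2 * ((-1) ^+ 2 * b))%:E); last exact: ltry.
  rewrite (@eq_sqn _ _ _ P _ (fun w => X w + (-1) * Y w)); last first.
    by move=> w; rewrite mulN1r.
  apply: sqnD_le_bound => //; first exact: measurable_funM.
    by rewrite Xa.
  by rewrite sqnZ// Yb -EFinM.
rewrite -(fineK Dfin); congr EFin.
by apply: (polarization mX mY Xa Yb _ XYm); rewrite fineK.
Qed.

Lemma mul_of_sqnB X Y (a b c : R) : measurable_fun setT X -> measurable_fun setT Y ->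
  sqn P X = a%:E -> sqn P Y = b%:E -> sqn P (fun w => X w - Y w)%R = c%:E ->
  (\int[P]_w (X w * Y w)%:E = ((a + b - c) / 2)%:E)%E.
Proof.
move=> mX mY Xa Yb XYc; have iXY := integrable_mul mX mY Xa Yb.
have fXY := integrable_fin_num measurableT iXY.
rewrite -(fineK fXY); congr EFin.
by rewrite (polarization mX mY Xa Yb XYc (esym (fineK fXY))); field.
Qed.

End second_moments.

Section ornstein_uhlenbeck.
Context d (Omega : measurableType d) (R : realType) (P : probability Omega R).
Variable W : R -> Omega -> R.
Hypothesis gW : forall n (s c : 'I_n -> R), (forall i, 0 < s i) ->
  exists2 v : R, 0 <= v & gaussian P (fun w => \sum_(i < n) c i * W (s i) w) v.
Hypothesis W2 : forall s : R, 0 < s -> sqn P (W s) = s%:E.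
Hypothesis WB2 : forall s t : R, 0 < s -> 0 < t -> sqn P (fun w => W t w - W s w)%R = `|t - s|%:E.

Let Y t w := expR (- t / 2) * W (expR t) w.

Let gY n (t c : 'I_n -> R) : exists2 v : R, 0 <= v &
  gaussian P (fun w => \sum_(i < n) c i * Y (t i) w) v.
Proof.
have [v v0 gv] := gW (fun i => c i * expR (- t i / 2)) (fun i => expR_gt0 (t i)).
exists v => //; rewrite (_ : (fun w => _) =
    (fun w => \sum_(i < n) c i * expR (- t i / 2) * W (expR (t i)) w))//.
by apply/funext => w; apply: eq_bigr => i _; rewrite /Y mulrA.
Qed.

Let gW1 s : 0 < s -> exists2 v : R, 0 <= v & gaussian P (W s) v.
Proof.
move=> s0; have [v v0 gv] := @gW 1 (fun=> s) (fun=> 1) (fun=> s0).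
exists v => //; rewrite (_ : W s = (fun w => \sum_(i < 1) 1 * W s w))//.
by apply/funext => w; rewrite big_ord1 mul1r.
Qed.

Let mW s : 0 < s -> measurable_fun setT (W s).
Proof. by move=> /gW1[v _ /gaussian_measurable]. Qed.

Let mY t : measurable_fun setT (Y t).
Proof. by apply: measurable_funM => //; apply: mW; exact: expR_gt0. Qed.

Let Y2 t : sqn P (Y t) = 1%E.
Proof.
rewrite sqnZ ?W2 ?expR_gt0//; last by apply: mW; exact: expR_gt0.
rewrite -EFinM -expRM_natl -expRD; congr EFin.
by rewrite (_ : _ + _ = 0) ?expR0//; field.
Qed.

Let covY s t : (\int[P]_w (Y s w * Y t w)%:E = (expR (- (`|t - s| / 2)))%:E)%E.
Proof.
have es := expR_gt0 s; have et := expR_gt0 t.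
have h := mul_of_sqnB (mW es) (mW et) (W2 es) (W2 et) (WB2 et es).
have iW := integrable_mul (mW es) (mW et) (W2 es) (W2 et).
under eq_integral.
  move=> w _; rewrite (_ : Y s w * Y t w = (expR (- s / 2) * expR (- t / 2)) *
    (W (expR s) w * W (expR t) w)); last by rewrite /Y mulrACA.
  rewrite EFinM; over.
rewrite integralZl// h -EFinM -expRD; congr EFin.
have [st|/ltW ts] := leP s t.
  have est : expR s <= expR t by rewrite ler_expR.
  rewrite ler0_norm ?subr_le0// ger0_norm ?subr_ge0//.
  rewrite (_ : (expR s + expR t - - (expR s - expR t)) / 2 = expR s); last by field.
  by rewrite -expRD; congr expR; field.
have ets : expR t <= expR s by rewrite ler_expR.
rewrite ger0_norm ?subr_ge0// ler0_norm ?subr_le0//.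
rewrite (_ : (expR s + expR t - (expR s - expR t)) / 2 = expR t); last by field.
by rewrite -expRD; congr expR; field.
Qed.

Let YB2 s t : sqn P (fun w => Y t w - Y s w)%R = (2 - 2 * expR (- (`|t - s| / 2)))%:E.
Proof.
rewrite (sqnB_of_mul (mY t) (mY s) (Y2 t) (Y2 s) (covY t s)).
by congr EFin; rewrite distrC; ring.
Qed.

Let gYB s t : gaussian P (fun w => Y t w - Y s w) (2 - 2 * expR (- (`|t - s| / 2))).
Proof.
have [v v0 gv] := @gY 2 (fun i => if i == ord0 then t else s) (fun i => if i == ord0 then 1 else -1).
have e : (fun w => \sum_(i < 2) (if i == ord0 then 1 else -1) *
    Y (if i == ord0 then t else s) w) = (fun w => Y t w - Y s w).
  by apply/funext => w; rewrite big_ord_recl big_ord1/= mul1r mulN1r.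
rewrite e in gv.
have := gaussian_second_moment v0 gv; have := YB2 s t; rewrite /sqn => -> [vE].
by rewrite vE.
Qed.

(** Lamperti's transformation Y_t = e^(-t/2) W(e^t). W has the covariance
    min(s, t), so that Y is stationary with covariance e^(-|t - s| / 2), and
    Y_t - Y_s is normal of variance 2 - 2 e^(-|t - s| / 2) <= |t - s|; its fourth
    moment is therefore at most a multiple of |t - s|^2. *)
Lemma ou_of_wiener : exists X : R -> Omega -> R,
  stationary_ornstein_uhlenbeck P X /\
  forall s, 0 < s -> {ae P, forall w, Num.sqrt s * X (ln s) w = W s w}.
Proof.
have k0 : 0 <= std_kurtosis :> R.
  rewrite /std_kurtosis fine_ge0//; apply: integral_ge0 => x _.
  by rewrite lee_fin (exprM x 2 2) sqr_ge0.
have Y4 s t : (\int[P]_w ((Y t w - Y s w) ^+ 4)%:E <= (std_kurtosis * (t - s) ^+ 2)%:E)%E.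
  have v0 : 0 <= 2 - 2 * expR (- (`|t - s| / 2)).
    have : expR (- (`|t - s| / 2)) <= 1.
      by rewrite -expR0 ler_expR oppr_le0 divr_ge0.
    by lra.
  rewrite (gaussian_fourth_moment v0 (gYB s t)) lee_fin ler_wpM2l//.
  rewrite -(real_normK (num_real (t - s))) ler_sqr ?nnegrE//.
  have := expR_ge1Dx (- (`|t - s| / 2)); lra.
have [X [mX cX XY]] := continuous_modification k0 mY Y4.
have gX n (t c : 'I_n -> R) : exists2 v : R, 0 <= v &
    gaussian P (fun w => \sum_(i < n) c i * X (t i) w) v.
  have [v v0 gv] := gY t c; exists v => //.
  apply: (gaussian_ae gv); first by apply: measurable_sum => i; exact: measurable_funM.
  have : {ae P, forall w, forall i : 'I_n, X (t i) w = Y (t i) w}.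
    have /ae_foralln : forall k : nat, {ae P, forall w, forall i : 'I_n, i = k :> nat -> X (t i) w = Y (t i) w}.
      move=> k; have [kn|nk] := ltnP k n.
        have := XY (t (Ordinal kn)); apply: filterS => w h i ik.
        by rewrite (_ : i = Ordinal kn) //; exact: val_inj.
      by apply: aeW => w i ik; move: nk; rewrite -ik leqNgt ltn_ord.
    by apply: filterS => w h i; exact: (h i i).
  by apply: filterS => w h; apply: eq_bigr => i _; rewrite h.
have gX1 t : exists2 v : R, 0 <= v & gaussian P (X t) v.
  have [v v0 gv] := @gX 1 (fun=> t) (fun=> 1); exists v => //.
  rewrite (_ : X t = (fun w => \sum_(i < 1) 1 * X t w))//.
  by apply/funext => w; rewrite big_ord1 mul1r.
have EX t : ('E_P[X t] = 0)%E.
  by have [v v0 gv] := gX1 t; rewrite unlock; exact: gaussian_mean v0 gv.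
exists X; split; first split.
- move=> n t c; have [v v0 gv] := gX n t c; exists 0, v; split=> //.
  exact/gaussian_has_normal_law.
- exact: EX.
- move=> s t; rewrite unlock !EX/= unlock.
  rewrite -covY; apply: ae_eq_integral => //.
  + by apply/measurable_EFinP; apply: measurable_funM => //; apply: measurable_funB.
  + by apply/measurable_EFinP; exact: measurable_funM.
  + move: (XY s) (XY t); apply: filterS2 => w Xs Xt _.
    apply: (@etrans _ _ ((X s w - 0) * (X t w - 0))%:E); first by [].
    by rewrite !subr0 Xs Xt.
- exact: cX.
- move=> s s0; have := XY (ln s); apply: filterS => w ->.
  rewrite /Y lnK ?posrE// mulrA (_ : Num.sqrt s * _ = 1) ?mul1r//.
  have es : s = expR (ln s / 2) ^+ 2.
    by rewrite -expRM_natl -{1}(@lnK _ s) ?posrE//; congr expR; field.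
  rewrite {1}es sqrtr_sqr ger0_norm ?expR_ge0// -expRD (_ : _ + _ = 0) ?expR0//.
  by field.
Qed.

End ornstein_uhlenbeck.

(** * Calculus on the time interval *)

Section calculus.
Context {R : realType}.
Implicit Types (f g F : R -> R) (a b t : R).
Local Notation mu := (@lebesgue_measure R).

Lemma within_cvg_at (D : set R) f x : {within D, continuous f} -> D x ->
  f @ within D (nbhs x) --> f x.
Proof. by move=> /subspace_continuousP; exact. Qed.

Lemma within_inv (D : set R) f : {within D, continuous f} ->
  (forall x, D x -> f x != 0) -> {within D, continuous (fun u => (f u)^-1)}.
Proof.
move=> cf f0; apply/subspace_continuousP => x Dx.
by apply: cvgV; [exact: f0|exact: within_cvg_at cf Dx].
Qed.

Lemma within_mul (D : set R) f g : {within D, continuous f} -> {within D, continuous g} ->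
  {within D, continuous (fun u => f u * g u : R)}.
Proof.
move=> c1 c2; apply/subspace_continuousP => x xt.
by apply: cvgM; [exact: within_cvg_at c1 xt|exact: within_cvg_at c2 xt].
Qed.

Lemma within_add (D : set R) f g : {within D, continuous f} -> {within D, continuous g} ->
  {within D, continuous (fun u => f u + g u : R)}.
Proof.
move=> c1 c2; apply/subspace_continuousP => x xt.
by apply: cvgD; [exact: within_cvg_at c1 xt|exact: within_cvg_at c2 xt].
Qed.

Lemma segment_uniform f t e : {within `[0, t], continuous f} -> 0 < e ->
  exists2 d, 0 < d & forall x y, 0 <= x <= t -> 0 <= y <= t -> `|x - y| < d ->
    `|f x - f y| <= e.
Proof.
move=> cf e0.
pose Q (d : R) (x : R) := forall y, 0 <= x <= t -> 0 <= y <= t -> `|x - y| < d -> `|f x - f y| <= e.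
have := (compact_near_coveringP `[0, t]).1 (@segment_compact R 0 t).
move=> /(_ _ (0 : R)^'+ Q _) h.
suff : \forall d \near 0^'+, `[0, t] `<=` Q d.
  move=> H; have : \forall d \near (0 : R)^'+, (0 < d) /\ `[0, t] `<=` Q d.
    by near=> d; split; [near: d; exact: nbhs_right_gt|near: d; exact: H].
  move=> /filter_ex [d [d0 dQ]]; exists d => // x y xt yt.
  by apply: dQ => //; rewrite /= in_itv.
apply: h => x xt.
have /cvgrPdist_lt := within_cvg_at cf xt.
move=> /(_ (e / 2)); rewrite divr_gt0// => /(_ isT).
rewrite near_withinE => /nbhs_ballP[/= r r0 rf].
have r2 : 0 < r / 2 by rewrite divr_gt0.
exists (ball x (r / 2), [set d | 0 < d < r / 2]) => /=.
  split; first exact: nbhsx_ballx.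
  by near=> d; apply/andP; split; near: d; [exact: nbhs_right_gt|exact: nbhs_right_lt].
move=> [x' d] /= [xx' /andP[d0 dr]] y x't yt x'y.
rewrite -ball_normE/= in xx'.
have fx' : `|f x - f x'| < e / 2.
  apply: rf; rewrite /= ?in_itv// -ball_normE/=; lra.
have fy : `|f x - f y| < e / 2.
  apply: rf; rewrite /= ?in_itv// -ball_normE/=.
  rewrite -(subrK x' x) -addrA; apply: le_lt_trans (ler_normD _ _) _; lra.
rewrite -(subrK (f x) (f x')) -addrA; apply: le_trans (ler_normD _ _) _.
rewrite (distrC (f x')); lra.
Unshelve. all: by end_near. Qed.

Lemma segment_bounded f t : {within `[0, t], continuous f} ->
  exists2 M, 0 < M & forall x, 0 <= x <= t -> `|f x| <= M.
Proof.
move=> cf; have := compact_bounded (continuous_compact cf (@segment_compact R 0 t)).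
move=> [M [_ hM]]; exists (`|M| + 1); first by rewrite ltr_wpDl.
move=> x xt; apply: (hM (`|M| + 1)); last by exists x => //; rewrite /= in_itv.
by rewrite ltr_pwDr// ler_norm.
Qed.

Lemma segment_integrable f t : {within `[0, t], continuous f} ->
  mu.-integrable `[0, t] (EFin \o f).
Proof. by apply: continuous_compact_integrable; exact: segment_compact. Qed.

Lemma segmentW f t s : s <= t -> {within `[0, t], continuous f} ->
  {within `[0, s], continuous f}.
Proof.
move=> st; apply: continuous_subspaceW => x /=; rewrite !in_itv/= => /andP[->].
by move=> /le_trans; exact.
Qed.

(** Phrased like [C1_mean_value], so that phi, the drift of Z and the integral of
    psi / phi can be treated alike in [integrating_factor_local]. *)
Lemma integral_mean_value f t a b : {within `[0, t], continuous f} ->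
  0 <= a -> a <= b -> b <= t ->
  exists2 c, a <= c <= b &
    \int[mu]_(u in `[0, b]) f u - \int[mu]_(u in `[0, a]) f u = f c * (b - a).
Proof.
move=> cf a0 ab bt; have t0 : 0 <= t by rewrite (le_trans a0)// (le_trans ab).
pose F x := \int[mu]_(u in `[0, x]) f u.
have cF : {within `[0, t], continuous F}.
  exact: parameterized_integral_continuous t0 (segment_integrable cf).
have [||c] := @MVT_segment R F f a b ab.
- move=> x; rewrite in_itv/= => /andP[ax xb].
  have x0t : x \in `]0, t[ by rewrite in_itv/=; apply/andP; split; lra.
  have t0' : 0 < t by move: x0t; rewrite in_itv/=; lra.
  have cfx : {for x, continuous f}.
    by have [h _ _] := (continuous_within_itvP f t0').1 cf; exact: h.
  have [||| dF F'] := @continuous_FTC1 R f (BLeft 0) x t _ (segment_integrable cf).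
  + lra.
  + by rewrite /Order.lt/=; lra.
  + exact: cfx.
  + by apply: (DeriveDef dF); rewrite -derive1E; exact: F'.
- apply: continuous_subspaceW cF => x /=; rewrite !in_itv/=; lra.
- by rewrite in_itv/= => cab h; exists c.
Qed.

Lemma shift_dnbhs (x : R) : (fun h => h + x) @ (0 : R)^' --> x^'.
Proof.
move=> A; rewrite /dnbhs /within/= => /nbhs_ballP[/= r r0 rA].
apply/nbhs_ballP; exists r => // h; rewrite /= -ball_normE/= sub0r normrN => hr h0.
apply: rA; first by rewrite -ball_normE/= opprD addrCA subrr addr0 normrN.
by apply: contra h0 => /eqP hx; apply/eqP; lra.
Qed.

Lemma difference_quotient_is_derive f x (l : R) :
  difference_quotient f x s @[s --> x^'] --> l -> is_derive x 1 f l.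
Proof.
move=> fl; have h : h^-1 *: ((f \o shift x) (h *: (1 : R)) - f x) @[h --> 0^'] --> l.
  have := cvg_comp _ _ (@shift_dnbhs x) fl; apply: cvg_trans.
  apply: near_eq_cvg; near=> h.
  by rewrite /difference_quotient /= addrK mulrC /GRing.scale/= mulr1.
by apply: DeriveDef; [apply/cvg_ex; exists l|rewrite /derive; apply: cvg_lim].
Unshelve. all: by end_near. Qed.

Section time_interval.
Variable T : \bar R.
Local Notation D := (time_interval T).

Lemma time_interval_sub t : D t -> `[0, t] `<=` D.
Proof.
move=> [_ tT] x /=; rewrite in_itv/= => /andP[x0 xt]; split=> //.
by apply: le_lt_trans tT; rewrite lee_fin.
Qed.

Lemma time_interval_le t s : 0 <= s <= t -> D t -> D s.
Proof. by move=> st /time_interval_sub; apply; rewrite /= in_itv. Qed.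

Lemma within_segment f t : {within D, continuous f} -> D t ->
  {within `[0, t], continuous f}.
Proof. by move=> cf Dt; apply: continuous_subspaceW cf; exact: time_interval_sub. Qed.

Lemma time_interval_above t : D t -> exists2 s, t < s & D s.
Proof.
move=> [t0 tT]; case: T tT => [r||] tT.
- rewrite lte_fin in tT; exists ((t + r) / 2); first by lra.
  by split; [lra|rewrite lte_fin; lra].
- by exists (t + 1); [lra|split; [lra|exact: ltry]].
- by move: tT; rewrite ltNge leNye.
Qed.

Lemma integral_within_continuous f : {within D, continuous f} ->
  {within D, continuous (fun t => \int[mu]_(u in `[0, t]) f u)}.
Proof.
move=> cf; apply/subspace_continuousP => x Dx.
have [y xy Dy] := time_interval_above Dx; have [x0 _] := Dx.
have cfy := within_segment cf Dy.
have [M M0 hM] := segment_bounded cfy.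
have hy : \forall s \near x, s <= y.
  have := open_nbhs_nbhs (conj (@open_lt R y) xy); apply: filterS => z; exact: ltW.
apply/cvgrPdist_le => e e0; rewrite near_withinE; near=> s => Ds.
have sy : s <= y by near: s; exact: hy.
have s0 : 0 <= s by case: Ds.
suff h : `|\int[mu]_(u in `[0, x]) f u - \int[mu]_(u in `[0, s]) f u| <= M * `|x - s|.
  apply: le_trans h _; rewrite -ler_pdivlMl// mulrC.
  near: s; apply: cvgr_dist_le; first exact: cvg_id.
  by rewrite divr_gt0.
have [xs|/ltW sx] := leP x s.
  have [c /andP[xc cs] h] := integral_mean_value cfy x0 xs sy.
  rewrite distrC h normrM (distrC x) ler_wpM2r//; apply: hM.
  by rewrite (le_trans x0 xc) (le_trans cs).
have [c /andP[xc cs] h] := integral_mean_value cfy s0 sx (ltW xy).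
rewrite h normrM ler_wpM2r//; apply: hM.
by rewrite (le_trans s0 xc) (le_trans cs (ltW xy)).
Unshelve. all: by end_near. Qed.

Lemma time_interval_nbhs x : 0 < x -> D x -> nbhs x D.
Proof.
move=> x0 [_ xT].
have xT' : nbhs x [set y : R | (y%:E < T)%E].
  case: T xT => [r||] /=.
  - by rewrite lte_fin => xr; exact: (open_nbhs_nbhs (conj (@open_lt R r) xr)).
  - by move=> _; apply: (filterS _ filterT) => y _ /=; rewrite ltry.
  - by rewrite ltNge leNye.
have x0' : nbhs x [set y : R | 0 < y] by exact: (open_nbhs_nbhs (conj (@open_gt R 0) x0)).
by apply: filterS2 x0' xT' => y y0 yT; split=> //; exact: ltW.
Qed.

Lemma time_interval_dnbhs x : 0 < x -> D x -> within D x^' = x^'.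
Proof.
move=> x0 Dx; have nD := time_interval_nbhs x0 Dx.
apply/seteqP; split=> A.
  change ((\forall y \near within D (within [set y | y != x] (nbhs x)), A y) ->
    \forall y \near within [set y | y != x] (nbhs x), A y).
  rewrite !near_withinE; apply: filterS2 nD => y Dy h yx; exact: h.
change ((\forall y \near within [set y | y != x] (nbhs x), A y) ->
  \forall y \near within D (within [set y | y != x] (nbhs x)), A y).
by rewrite !near_withinE; apply: filterS => y h yx _; exact: h.
Qed.

Lemma time_interval_right : (0 < T)%E -> \forall x \near 0^'+, D x.
Proof.
move=> T0; have h : \forall x \near (0 : R), (x%:E < T)%E.
  case: T T0 => [r||] /=.
  - by rewrite lte_fin => xr; exact: (open_nbhs_nbhs (conj (@open_lt R r) xr)).
  - by move=> _; apply: (filterS _ filterT) => y _ /=; rewrite ltry.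
  - by rewrite ltNge leNye.
near=> x; split; first by apply: ltW; near: x; exact: nbhs_right_gt.
by near: x; apply: (@cvg_within _ (nbhs (0 : R))).
Unshelve. all: by end_near. Qed.

Lemma within_continuous_interior f x : {within D, continuous f} -> 0 < x -> D x ->
  {for x, continuous f}.
Proof.
move=> cf x0 Dx; have := within_cvg_at cf Dx; apply: cvg_trans.
by apply: cvg_app => A; rewrite /within/=; move: (time_interval_nbhs x0 Dx);
  apply: filterS2 => y Dy; exact.
Qed.

Lemma within_continuous_right0 f : (0 < T)%E -> {within D, continuous f} ->
  f @ 0^'+ --> f 0.
Proof.
move=> T0 cf; have D0 : D 0 by split.
have := within_cvg_at cf D0; apply: cvg_trans.
apply: cvg_app => A; rewrite /within/= => hA.
near=> x; have : D x by near: x; exact: time_interval_right.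
by near: x; exact: (@cvg_within _ (nbhs (0 : R))).
Unshelve. all: by end_near. Qed.

(** At interior points the derivative relative to the time interval is the usual one,
    and at 0 the mean value theorem only asks for continuity. *)
Lemma C1_mean_value f a b : continuously_differentiable_on D f ->
  {within D, continuous f} ->
  0 <= a -> a <= b -> D b ->
  exists2 c, a <= c <= b & f b - f a = derivative_within D f c * (b - a).
Proof.
move=> [cdf _] cf a0 ab Db.
have [||c] := @MVT_segment R f (derivative_within D f) a b ab.
- move=> x; rewrite in_itv/= => /andP[ax xb].
  have Dx : D x by apply: time_interval_le Db; lra.
  have x0 : 0 < x by lra.
  apply: difference_quotient_is_derive; have /cvg_ex[l hl] := cdf x Dx.
  by rewrite /derivative_within (time_interval_dnbhs x0 Dx) in hl *; rewrite (cvg_lim _ hl).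
- apply: continuous_subspaceW cf => x /=; rewrite in_itv/= => /andP[ax xb].
  by apply: time_interval_le Db; rewrite (le_trans a0).
- by rewrite in_itv/= => cab h; exists c.
Qed.

Lemma C1_continuous f : continuously_differentiable_on D f -> {within D, continuous f}.
Proof.
move=> [cdf _]; apply/subspace_continuousP => x Dx.
have /cvg_ex[/= l hl] := cdf x Dx.
have bl : \forall s \near x, D s -> s != x -> `|difference_quotient f x s| <= `|l| + 1.
  move/cvgrPdist_lt : hl => /(_ 1 ltr01).
  change ((\forall s \near within D (within [set s | s != x] (nbhs x)),
    `|l - difference_quotient f x s| < 1) ->
    \forall s \near x, D s -> s != x -> `|difference_quotient f x s| <= `|l| + 1).
  rewrite !near_withinE; apply: filterS => s h Ds sx; have := h sx Ds => {}h.
  rewrite -[X in `|X|](subrK l) addrC; apply: le_trans (ler_normD _ _) _.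
  by rewrite lerD2l distrC ltW.
apply/cvgrPdist_le => e e0; rewrite near_withinE; near=> s => Ds.
have [->|sx] := eqVneq s x; first by rewrite subrr normr0 ltW.
have sx0 : s - x != 0 by rewrite subr_eq0.
have : `|difference_quotient f x s| <= `|l| + 1 by move: Ds sx; near: s.
rewrite /difference_quotient normf_div ler_pdivrMr ?normr_gt0// distrC => /le_trans; apply.
have l1 : 0 < `|l| + 1 by rewrite ltr_wpDl.
rewrite -ler_pdivlMl// distrC mulrC; near: s; apply: cvgr_dist_le => //.
by rewrite divr_gt0.
Unshelve. all: by end_near. Qed.

End time_interval.
End calculus.

(** * Variation of constants along a path *)

Section partition.
Context {R : realType}.
Implicit Types (t : R) (n i : nat).

Definition mesh_point t n i : R := t * (i%:R / n.+1%:R).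

Lemma mesh_point0 t n : mesh_point t n 0 = 0.
Proof. by rewrite /mesh_point mul0r mulr0. Qed.

Lemma mesh_pointn t n : mesh_point t n n.+1 = t.
Proof. by rewrite /mesh_point divff ?mulr1// pnatr_eq0. Qed.

Lemma mesh_pointS t n i : mesh_point t n i.+1 = mesh_point t n i + t / n.+1%:R.
Proof. by rewrite /mesh_point -(@natr1 R i); ring. Qed.

Lemma mesh_point_itv t n i : 0 <= t -> (i <= n.+1)%N -> 0 <= mesh_point t n i <= t.
Proof.
move=> t0 iN; have n0 : 0 < n.+1%:R :> R by rewrite ltr0n.
rewrite /mesh_point; apply/andP; split; first by rewrite mulr_ge0// divr_ge0// ltW.
by rewrite ler_piMr// ler_pdivrMr// mul1r ler_nat.
Qed.

Lemma mesh_cvg t d : 0 < d -> \forall n \near \oo, t / n.+1%:R < d.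
Proof.
move=> d0; have h : t * (@harmonic R) n @[n --> \oo] --> t * 0.
  by apply: cvgMr; exact: cvg_harmonic.
by rewrite mulr0 in h; move/cvgr_lt : h; exact.
Qed.

End partition.

Section integrating_factor.
Context {R : realType}.
Variables (t : R) (phi dphi psi z i H : R -> R).
Hypothesis t0 : 0 <= t.
Let g u := dphi u / phi u * z u + psi u.
Let mean_value_on (F : R -> R -> R) (f : R -> R) := forall a b, 0 <= a -> a <= b -> b <= t ->
  exists2 c, a <= c <= b & F a b = f c * (b - a).
Hypothesis phi_gt0 : forall u, 0 <= u <= t -> 0 < phi u.
Hypothesis cphi : {within `[0, t], continuous phi}.
Hypothesis cdphi : {within `[0, t], continuous dphi}.
Hypothesis cpsi : {within `[0, t], continuous psi}.
Hypothesis cz : {within `[0, t], continuous z}.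
Hypothesis phi_mv : mean_value_on (fun a b => phi b - phi a) dphi.
Hypothesis z_mv : mean_value_on (fun a b => z b - z a - (i b - i a)) g.
Hypothesis H_mv : mean_value_on (fun a b => H b - H a) (fun u => psi u / phi u).

Let cinv : {within `[0, t], continuous (fun u => (phi u)^-1)}.
Proof. by apply: within_inv => // u; rewrite /= in_itv/= => /phi_gt0/gt_eqF ->. Qed.

Let cg : {within `[0, t], continuous g}.
Proof. by apply: within_add => //; apply: within_mul => //; apply: within_mul => //; exact: cinv. Qed.

Lemma norm_mulB (x y x' y' M e : R) : `|x - x'| <= e -> `|y - y'| <= e -> `|y| <= M -> `|x'| <= M ->
  `|x * y - x' * y'| <= 2 * M * e.
Proof.
move=> xx yy yM xM; rewrite (_ : _ - _ = (x - x') * y + x' * (y - y')); last by ring.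
apply: le_trans (ler_normD _ _) _; rewrite !normrM.
have : `|x - x'| * `|y| <= e * M by apply: ler_pM.
have : `|x'| * `|y - y'| <= M * e by apply: ler_pM.
lra.
Qed.

(** To first order in b - a, the change of 1 / phi cancels the drift
    (phi' / phi) z, and what remains of the drift is psi / phi. Uniform continuity
    makes the error uniform over [0, t]. *)
Lemma integrating_factor_local e : 0 < e -> exists2 d, 0 < d &
  forall a b, 0 <= a -> a <= b -> b <= t -> b - a < d ->
  `|z b / phi b - z a / phi a - (i b - i a) / phi b - (H b - H a)| <= e * (b - a).
Proof.
move=> e0.
have cp := cinv; have ch := within_mul cpsi cp; have czp := within_mul cz cp.
have [M1 M10 hM1] := segment_bounded cg; have [M2 M20 hM2] := segment_bounded cp.
have [M3 M30 hM3] := segment_bounded cdphi; have [M4 M40 hM4] := segment_bounded czp.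
pose M := M1 + M2 + M3 + M4; have M0 : 0 < M by rewrite /M; lra.
have {}hM1 x : 0 <= x <= t -> `|g x| <= M by move=> /hM1/le_trans; apply; rewrite /M; lra.
have {}hM2 x : 0 <= x <= t -> `|(phi x)^-1| <= M by move=> /hM2/le_trans; apply; rewrite /M; lra.
have {}hM3 x : 0 <= x <= t -> `|dphi x| <= M by move=> /hM3/le_trans; apply; rewrite /M; lra.
have {}hM4 x : 0 <= x <= t -> `|z x / phi x| <= M by move=> /hM4/le_trans; apply; rewrite /M; lra.
(* The three error terms below are at most 2 M h, M (2 M h) and h. *)
pose C := 2 * M + M * (2 * M) + 1; have C0 : 0 < C by rewrite /C; nra.
pose h := e / C; have h0 : 0 < h by rewrite divr_gt0.
have [d1 d10 hd1] := segment_uniform cg h0; have [d2 d20 hd2] := segment_uniform cp h0.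
have [d3 d30 hd3] := segment_uniform cdphi h0; have [d4 d40 hd4] := segment_uniform ch h0.
exists (Num.min (Num.min d1 d2) (Num.min d3 d4)); first by rewrite !lt_min d10 d20 d30.
move=> a b a0 ab bt; rewrite !lt_min => /andP[/andP[ba1 ba2] /andP[ba3 ba4]].
have [c1 c1ab z1] := z_mv a0 ab bt; have [c2 c2ab f2] := phi_mv a0 ab bt.
have [c3 c3ab H3] := H_mv a0 ab bt.
have At : 0 <= a <= t by rewrite a0 (le_trans ab bt).
have bt' : 0 <= b <= t by rewrite (le_trans a0 ab).
have ct c : a <= c <= b -> 0 <= c <= t.
  by move=> /andP[ac cb]; rewrite (le_trans a0 ac) (le_trans cb bt).
have cd (d : R) c : b - a < d -> a <= c <= b -> `|c - a| < d.
  move=> bad /andP[ac cb]; rewrite ger0_norm ?subr_ge0//.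
  by apply: le_lt_trans bad; rewrite lerD2r.
have bb : a <= b <= b by rewrite ab lexx.
have pa := phi_gt0 At; have pb := phi_gt0 bt'.
rewrite H3 (_ : z b / phi b - z a / phi a - (i b - i a) / phi b =
  (g c1 / phi b - z a / phi a * ((phi b)^-1 * dphi c2)) * (b - a)); last first.
  have -> : (g c1 / phi b - z a / phi a * ((phi b)^-1 * dphi c2)) * (b - a) =
    (g c1 * (b - a)) / phi b - z a / phi a / phi b * (dphi c2 * (b - a)) by ring.
  by rewrite -z1 -f2; field; rewrite !gt_eqF.
rewrite -mulrBl normrM [`|b - a|]ger0_norm ?subr_ge0// ler_wpM2r ?subr_ge0//.
rewrite (_ : _ - _ = (g c1 / phi b - g a / phi a) - z a / phi a *
  ((phi b)^-1 * dphi c2 - (phi a)^-1 * dphi a) - (psi c3 / phi c3 - psi a / phi a)); last first.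
  by rewrite /g; ring.
have b1 : `|g c1 / phi b - g a / phi a| <= 2 * M * h.
  by apply: norm_mulB; [apply: hd1|apply: hd2|apply: hM2|apply: hM1]=> //; rewrite ?cd ?ct//.
have b2 : `|(phi b)^-1 * dphi c2 - (phi a)^-1 * dphi a| <= 2 * M * h.
  by apply: norm_mulB; [apply: hd2|apply: hd3|apply: hM3|apply: hM2]=> //; rewrite ?cd ?ct//.
have b3 : `|psi c3 / phi c3 - psi a / phi a| <= h.
  by apply: hd4=> //; rewrite ?cd ?ct//.
have b4 := hM4 a At.
have b5 : `|z a / phi a * ((phi b)^-1 * dphi c2 - (phi a)^-1 * dphi a)| <= M * (2 * M * h).
  by rewrite normrM; apply: ler_pM.
apply: le_trans (ler_normB _ _) _; apply: le_trans (lerD (ler_normB _ _) (lexx _)) _.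
have -> : e = 2 * M * h + M * (2 * M * h) + h.
  transitivity (C * h); first by rewrite mulrC divfK ?gt_eqF.
  by rewrite /C; ring.
by apply: lerD => //; exact: lerD.
Qed.

(** Riemann-Stieltjes sums of 1 / phi against i. Although i may be of unbounded
    variation, they converge because the equation ties i to z up to continuously
    differentiable terms. *)
Lemma integrating_factor_cvg :
  \sum_(k < n.+1) (i (mesh_point t n k.+1) - i (mesh_point t n k)) / phi (mesh_point t n k.+1)
    @[n --> \oo] --> z t / phi t - z 0 / phi 0 - (H t - H 0).
Proof.
apply/cvgrPdist_le => e e0.
have e' : 0 < e / (t + 1) by rewrite divr_gt0// ltr_wpDl.
have [d d0 hd] := integrating_factor_local e'.
near=> n; pose u := mesh_point t n.
have ud : t / n.+1%:R < d by near: n; exact: mesh_cvg.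
have tel (F : R -> R) : F t - F 0 = \sum_(k < n.+1) (F (u k.+1) - F (u k)).
  rewrite -(big_mkord xpredT (fun k => F (u k.+1) - F (u k))) telescope_sumr//.
  by rewrite /u mesh_pointn mesh_point0.
rewrite (tel (fun x => z x / phi x)) (tel H) -!sumrB.
apply: le_trans (ler_norm_sum _ _ _) _.
apply: (@le_trans _ _ (\sum_(k < n.+1) e / (t + 1) * (u k.+1 - u k))).
  apply: ler_sum => k _.
  have /andP[k0 kt] := mesh_point_itv t0 (ltnW (ltn_ord k)).
  have /andP[_ kt'] := mesh_point_itv t0 (ltn_ord k).
  have uS : u k.+1 - u k = t / n.+1%:R by rewrite /u mesh_pointS addrC addKr.
  have uS0 : 0 <= t / n.+1%:R by rewrite divr_ge0.
  have -> : z (u k.+1) / phi (u k.+1) - z (u k) / phi (u k) - (H (u k.+1) - H (u k)) -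
    (i (u k.+1) - i (u k)) / phi (u k.+1) = z (u k.+1) / phi (u k.+1) - z (u k) / phi (u k)
      - (i (u k.+1) - i (u k)) / phi (u k.+1) - (H (u k.+1) - H (u k)) by ring.
  by apply: hd; rewrite ?uS// -subr_ge0 uS.
rewrite -mulr_sumr -(tel id) subr0 mulrAC ler_pdivrMr ?ltr_wpDl//.
by rewrite ler_wpM2l ?ltW//; lra.
Unshelve. all: by end_near. Qed.

End integrating_factor.

(** * The noise of the linear equation *)

Section cut.
Context {R : realType}.
Implicit Types (f g : R -> R) (a b t u : R).
Local Notation mu := (@lebesgue_measure R).

(** Half-open at 0, like the intervals of elementary functions. *)
Definition cut f t u := f u * \1_(`]0, t]) u.

Lemma measurable_cut f t : {within `[0, t], continuous f} -> measurable_fun setT (cut f t).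
Proof.
move=> cf; have mf : measurable_fun `[0, t] f.
  by apply: subspace_continuous_measurable_fun.
have -> : cut f t = (fun u => (f \_ `[0, t]) u * \1_(`]0, t]) u).
  apply/funext => u; rewrite /cut patchE indicE; case: ifPn => // ut.
  rewrite memNset ?mulr0//= => h; move: ut; rewrite notin_setE; apply.
  by move: h; rewrite /= !in_itv/= => /andP[/ltW -> ->].
by apply: measurable_funM; [exact/(measurable_restrictT _ _).1|exact: measurable_indic].
Qed.

Lemma cut_sub f a b u : 0 <= a -> a <= b -> cut f b u - cut f a u = f u * \1_(`]a, b]) u.
Proof.
move=> a0 ab; rewrite /cut !indic_itvE ?(le_trans a0)//; ring.
Qed.

Lemma sqn_indic f a b : sqn mu (fun u => f u * \1_(`]a, b]) u)%R =
  (\int[mu]_(u in `]a, b]) (f u ^+ 2)%:E)%E.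
Proof.
rewrite /sqn [RHS]integral_mkcond; apply: eq_integral => u _.
by rewrite patchE indicE; case: ifP => _; rewrite ?mulr1 ?mulr0 ?expr0n.
Qed.

Lemma sqn_cut f t : {within `[0, t], continuous f} ->
  sqn mu (cut f t) = (\int[mu]_(u in `[0%R, t]) (f u ^+ 2))%:E.
Proof.
move=> cf; have cf2 : {within `[0, t], continuous (fun u => f u ^+ 2)}.
  by have := within_mul cf cf.
have i2 := segment_integrable cf2.
rewrite /cut sqn_indic /Rintegral fineK; last exact: integrable_fin_num i2.
apply: integral_itv_obnd_cbnd.
have [mi _] := integrableP _ _ _ i2; move: mi; apply: measurable_funS => //.
exact: subset_itv_oc_cc.
Qed.

Lemma sqn_cut_sub f a b : {within `[0, b], continuous f} -> 0 <= a -> a <= b ->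
  sqn mu (fun u => cut f b u - cut f a u) =
  (\int[mu]_(u in `[0%R, b]) (f u ^+ 2) - \int[mu]_(u in `[0%R, a]) (f u ^+ 2))%:E.
Proof.
move=> cf a0 ab; have ca := segmentW ab cf.
rewrite EFinB -(sqn_cut cf) -(sqn_cut ca) -(@eq_sqn _ _ _ mu (fun u => f u * \1_(`]a, b]) u));
  last by move=> u; rewrite -cut_sub.
have fin : sqn mu (cut f a) \is a fin_num by rewrite sqn_cut.
have -> : sqn mu (cut f b) = (sqn mu (cut f a) + sqn mu (fun u => f u * \1_(`]a, b]) u)%R)%E.
  rewrite /sqn -ge0_integralD//; last 4 first.
  - by move=> u _; rewrite lee_fin sqr_ge0.
  - by apply: measurable_sqr_EFin; exact: measurable_cut.
  - by move=> u _; rewrite lee_fin sqr_ge0.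
  - apply: measurable_sqr_EFin; under eq_fun do rewrite -(cut_sub f _ a0 ab).
    by apply: measurable_funB; exact: measurable_cut.
  apply: eq_integral => u _; rewrite -EFinD -(cut_sub f u a0 ab); congr EFin.
  rewrite /cut !indic_itvE ?(le_trans a0)//.
  have [ua|au] := leP u a; first by rewrite (le_trans ua ab); ring.
  by rewrite (lt_geF (le_lt_trans a0 au)); ring.
by rewrite addeAC subee ?add0e.
Qed.

End cut.

Section ito.
Context {R : realType} {d : measure_display} {Omega : measurableType d}.
Variables (P : probability Omega R) (B : R -> Omega -> R).
Local Notation mu := (@lebesgue_measure R).

(** Elementary functions on [0, t] vanish outside ]0, t]. *)
Lemma wiener_integral_of_ito (f : R -> R) (t : R) (J : Omega -> R) : {within `[0, t], continuous f} ->
  is_ito_integral P B f t J -> wiener_integral P B (cut f t) J.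
Proof.
move=> cf [mJ [s [st fs Js]]]; split=> //; first exact: measurable_cut.
move=> e e0.
have near_le (v : nat -> \bar R) : v n @[n --> \oo] --> 0%E -> \forall n \near \oo, (v n <= e%:E)%E.
  move=> h; have := h [set x | (x < e%:E)%E] => /(_ _).
  have h0 : nbhs (0%E : \bar R) [set x | (x < e%:E)%E].
    by apply: open_nbhs_nbhs; split; [exact: open_ereal_lt_ereal|rewrite /= lte_fin].
  move=> /(_ h0) h'; near=> n; apply: ltW; near: n; exact: h'.
have [n [fn Jn]] : exists n, (\int[mu]_(u in `[0%R, t])
           (((f u - elementary_fun (s n) u) ^+ 2)%R)%:E <= e%:E)%E /\
    ('E_P[fun w => ((J w - elementary_integral B (s n) w) ^+ 2)%R] <= e%:E)%E.
  have [n [h1 h2]] := filter_ex (filterI (near_le _ fs) (near_le _ Js)).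
  by exists n.
exists (s n); split.
- by apply: sub_all (st n) => x /and3P[-> ->].
- apply: le_trans fn; rewrite /sqn [leRHS]integral_mkcond.
  have mf : measurable_fun `[0, t] f by apply: subspace_continuous_measurable_fun.
  have me := measurable_elementary_fun (s n).
  apply: ge0_le_integral => //.
  + by move=> u _; rewrite lee_fin sqr_ge0.
  + by apply: measurable_sqr_EFin; apply: measurable_funB => //; exact: measurable_cut.
  + apply/(measurable_restrictT _ _).1 => //; apply/measurable_EFinP.
    by apply: measurable_funX; apply: measurable_funB => //; exact: measurable_funTS.
  + move=> u _; rewrite patchE /cut; have [u0t|u0t] := boolP (u \in `]0, t]%classic).
      rewrite ifT ?indicE ?u0t ?mulr1//; move: u0t; rewrite !inE/=.
      exact: subset_itv_oc_cc.
    rewrite indicE (negbTE u0t) mulr0 (_ : elementary_fun (s n) u = 0).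
      by case: ifP => _; rewrite ?subr0 ?expr0n// lee_fin sqr_ge0.
    rewrite /elementary_fun big_seq big1// => x xs.
    have /and3P[x0 xx xt] := allP (st n) x xs.
    rewrite indicE memNset ?mulr0//= => ux; move: u0t; rewrite notin_setE; apply.
    move: ux; rewrite /= !in_itv/= => /andP[xu ux].
    by rewrite (le_lt_trans x0 xu) (le_trans ux xt).
- by move: Jn; rewrite unlock.
Unshelve. all: by end_near. Qed.

End ito.

Section solution.
Context {R : realType} (T : \bar R) (phi psi sigma : R -> R).
Local Notation D := (time_interval T).
Hypothesis T0 : (0 < T)%E.
Hypothesis phi_gt0 : forall t, D t -> 0 < phi t.
Hypothesis phi_C1 : continuously_differentiable_on D phi.
Hypothesis phi0 : phi 0 = 1.
Hypothesis psi_cont : {within D, continuous psi}.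
Hypothesis sigma_cont : {within D, continuous sigma}.
Context (d : measure_display) (Omega : measurableType d) (P : probability Omega R).
Variables (B : R -> Omega -> R) (xi : R) (Z : R -> Omega -> R).
Hypothesis hB : standard_wiener_process P B.
Hypothesis hZ : strong_solution P B T phi psi sigma xi Z.
Local Notation mu := (@lebesgue_measure R).

Let k u := sigma u / phi u.
Let H t := \int[mu]_(u in `[0, t]) (psi u / phi u).
(** The integral of sigma / phi, read off from Z so as to have its continuous paths. *)
Definition noise t w := Z t w / phi t - xi - H t.

Let cphi : {within D, continuous phi}. Proof. exact: C1_continuous. Qed.

Let phi_neq0 t : D t -> phi t != 0. Proof. by move=> /phi_gt0/gt_eqF ->. Qed.

Let ciphi : {within D, continuous (fun u => (phi u)^-1)}.
Proof. exact: within_inv. Qed.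

Let ch : {within D, continuous (fun u => psi u / phi u)}.
Proof. exact: within_mul. Qed.

Lemma kernel_continuous : {within D, continuous k}.
Proof. exact: within_mul. Qed.

Let eg := wiener_elementary_gaussian hB.

Let D0 : D 0. Proof. by split. Qed.

Let integral00 f : \int[mu]_(u in `[0, 0]) f u = 0.
Proof. by rewrite set_itv1 Rintegral_set1. Qed.

(** The sums of [integrating_factor_cvg] are Wiener integrals, of functions that
    converge to sigma / phi uniformly on ]0, t] and hence in L^2; so their pathwise
    limit is the Wiener integral of sigma / phi. *)
Lemma wiener_integral_noise t : D t -> wiener_integral P B (cut k t) (noise t).
Proof.
move=> Dt; have [t0 _] := Dt.
have [mZ _ cZ Z0 [I [[ito cI] Zeq]]] := hZ.
have seg f := @within_segment R T f t.
have sub s : 0 <= s <= t -> D s by move=> st; exact: time_interval_le Dt.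
have witoI s : D s -> wiener_integral P B (cut sigma s) (I s).
  by move=> Ds; apply: wiener_integral_of_ito; [exact: within_segment|exact: ito].
have wI a b : 0 <= a -> a <= b -> b <= t ->
    wiener_integral P B (fun u => sigma u * \1_(`]a, b]) u) (fun w => I b w - I a w).
  move=> a0 ab bt; have Db := sub b; have Da := sub a.
  have := wiener_integralB eg (witoI b _) (witoI a _).
  under eq_fun do rewrite cut_sub//; apply.
    by apply: Db; rewrite (le_trans a0).
  by apply: Da; rewrite a0 (le_trans ab).
pose u n i := mesh_point t n i.
pose g_ n x := \sum_(i < n.+1) (phi (u n i.+1))^-1 * (sigma x * \1_(`]u n i, u n i.+1]) x).
pose K_ n w := \sum_(i < n.+1) (phi (u n i.+1))^-1 * (I (u n i.+1) w - I (u n i) w).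
have uitv n i : (i <= n.+1)%N -> 0 <= u n i <= t by move=> ?; exact: mesh_point_itv.
have uS n i : u n i <= u n i.+1 by rewrite /u mesh_pointS lerDl divr_ge0.
have gK n : wiener_integral P B (g_ n) (K_ n).
  apply: (@wiener_integral_sum _ _ _ _ _ eg _ _ (fun (i : 'I_n.+1) x => _) (fun (i : 'I_n.+1) w => _)) => i.
  apply: wiener_integralZ => //; apply: wI => //.
    by have /andP[] := uitv n i (ltnW (ltn_ord i)).
  by have /andP[] := uitv n i.+1 (ltn_ord i).
have mk : measurable_fun setT (cut k t) by apply: measurable_cut; by apply: seg => //; exact: kernel_continuous.
have mN : measurable_fun setT (noise t).
  by apply: measurable_funB => //; apply: measurable_funB => //; apply: measurable_funM => //; exact: mZ.
apply: (wiener_integral_ae_lim eg mk mN gK).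
- move=> e e0.
  have [M M0 hM] := segment_bounded (seg _ sigma_cont Dt).
  pose c := e / (t + 1); have c0 : 0 < c by rewrite divr_gt0// ltr_wpDl.
  have eta0 : 0 < Num.sqrt c / M by rewrite divr_gt0// sqrtr_gt0.
  have [dl dl0 hdl] := segment_uniform (seg _ ciphi Dt) eta0.
  near=> n.
  have un : t / n.+1%:R < dl by near: n; exact: mesh_cvg.
  have part x : \sum_(i < n.+1) \1_(`]u n i, u n i.+1]) x = \1_(`]0, t]) x :> R.
    under eq_bigr do rewrite indic_itvE//.
    rewrite -(big_mkord xpredT (fun i => (x <= u n i.+1)%R%:R - (x <= u n i)%R%:R)) telescope_sumr//.
    by rewrite indic_itvE// /u mesh_pointn mesh_point0.
  (* On each interval of the partition the two functions differ by sigma times an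
     increment of 1 / phi. *)
  have bnd x : `|cut k t x - g_ n x| <= `|Num.sqrt c * \1_(`]0, t]) x|.
    rewrite /cut -part mulr_sumr -sumrB mulr_sumr.
    rewrite [leRHS]ger0_norm; last first.
      by apply: sumr_ge0 => i _; rewrite mulr_ge0 ?sqrtr_ge0// indicE.
    apply: le_trans (ler_norm_sum _ _ _) _; apply: ler_sum => i _.
    rewrite indicE; have [xi_|] := boolP (x \in _); last by rewrite !mulr0 subrr normr0.
    rewrite !mulr1 /k (_ : _ - _ = sigma x * ((phi x)^-1 - (phi (u n i.+1))^-1)); last by ring.
    move: xi_; rewrite inE/= in_itv/= => /andP[ux xu].
    have /andP[ui0 uit] := uitv n i (ltnW (ltn_ord i)).
    have /andP[_ uit'] := uitv n i.+1 (ltn_ord i).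
    have xt : 0 <= x <= t by rewrite (le_trans ui0 (ltW ux)) (le_trans xu).
    rewrite normrM -[leRHS](@mulfVK _ M) ?gt_eqF// mulrC.
    apply: ler_pM => //; last exact: hM.
    apply: hdl => //; first exact: uitv.
    rewrite ler0_norm ?subr_le0// opprB; apply: le_lt_trans un.
    have : u n i.+1 = u n i + t / n.+1%:R by exact: mesh_pointS.
    by move=> ->; rewrite addrAC gerDr subr_le0 ltW.
  apply: (@le_trans _ _ (sqn mu (fun x => Num.sqrt c * \1_(`]0, t]) x))).
    apply: ge0_le_integral => //.
    + by move=> x _; rewrite lee_fin sqr_ge0.
    + by apply: measurable_sqr_EFin; apply: measurable_funB => //; have [] := gK n.
    + by apply: measurable_sqr_EFin; apply: measurable_funM.
    + by move=> x _; rewrite lee_fin -[leLHS]real_normK ?num_real// -[leRHS]real_normK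
        ?num_real// ler_sqr ?nnegrE.
  rewrite sqnZ//.
  rewrite sqr_sqrtr ?(ltW c0)//.
  have -> : sqn mu (\1_(`]0, t])) = t%:E.
    rewrite -[in RHS](subr0 t) -integral_indic_itv//; apply: eq_integral => x _.
    by rewrite indicE; case: (_ \in _); rewrite ?expr1n ?expr0n.
  rewrite -EFinM lee_fin /c mulrAC ler_pdivrMr ?ltr_wpDl//.
  by rewrite ler_wpM2l ?(ltW e0)// lerDl.
- move: cZ Z0 Zeq; apply: filterS3 => w cZw Z0w Zw.
  have K_E n : K_ n w = \sum_(i < n.+1) (I (u n i.+1) w - I (u n i) w) / phi (u n i.+1).
    by apply: eq_bigr => i _; rewrite mulrC.
  under eq_fun do rewrite K_E.
  have -> : noise t w = Z t w / phi t - Z 0 w / phi 0 - (H t - H 0).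
    by rewrite /noise Z0w phi0 divr1 /H integral00 subr0.
  pose g x := derivative_within D phi x / phi x * Z x w + psi x.
  have cg : {within D, continuous g}.
    by have [_ cd] := phi_C1; exact: (within_add (within_mul (within_mul cd ciphi) cZw) psi_cont).
  apply: (@integrating_factor_cvg R t phi (derivative_within D phi) psi (Z ^~ w) (I ^~ w) H t0).
  + by move=> x /sub/phi_gt0.
  + exact: (seg _ cphi Dt).
  + by have [_ cd] := phi_C1; exact: (seg _ cd Dt).
  + exact: (seg _ psi_cont Dt).
  + exact: (seg _ cZw Dt).
  + move=> a b a0 ab bt; apply: (C1_mean_value phi_C1 cphi a0 ab); apply: sub.
    by rewrite (le_trans a0).
  + move=> a b a0 ab bt.
    have [c cab hc] := integral_mean_value (seg _ cg Dt) a0 ab bt.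
    exists c => //; rewrite -hc Zw ?Zw; [ring|..].
    * by apply: sub; rewrite a0 (le_trans ab).
    * by apply: sub; rewrite (le_trans a0).
  + move=> a b a0 ab bt; exact: integral_mean_value (seg _ ch Dt) a0 ab bt.
Unshelve. all: by end_near. Qed.

Lemma noise_mean t : D t -> (\int[P]_w (noise t w)%:E = 0)%E.
Proof.
move=> Dt; have wN := wiener_integral_noise Dt.
have gN := wiener_integral_gaussian eg wN; apply: gaussian_mean gN.
by rewrite fine_ge0// sqn_ge0.
Qed.

Lemma centering_noise t w : D t -> centering P Z t w = phi t * noise t w.
Proof.
move=> Dt; have [mZ _ _ _ _] := hZ.
have wN := wiener_integral_noise Dt; have gN := wiener_integral_gaussian eg wN.
have v0 : 0 <= fine (sqn mu (cut k t)) by rewrite fine_ge0// sqn_ge0.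
have iN := gaussian_integrable v0 gN.
have ZE v : Z t v = phi t * (xi + H t) + phi t * noise t v.
  by rewrite /noise; field; exact: phi_neq0.
have EZ : ('E_P[Z t] = (phi t * (xi + H t))%:E)%E.
  rewrite unlock; under eq_integral do rewrite ZE EFinD (EFinM _ (noise _ _)).
  rewrite integralD//.
  - rewrite integralZl// noise_mean// mule0 adde0 integral_cst//.
    by rewrite -[RHS]mule1; congr (_ * _)%E; exact: probability_setT.
  - exact: finite_measure_integrable_cst.
  - exact: integrableZl.
by rewrite /centering EZ/= ZE; ring.
Qed.

Lemma noise_continuous : {ae P, forall w, {within D, continuous (noise ^~ w)} /\ noise 0 w = 0}.
Proof.
have [_ _ cZ Z0 _] := hZ; move: cZ Z0; apply: filterS2 => w cZw Z0w; split; last first.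
  by rewrite /noise Z0w phi0 divr1 /H integral00 subrr subr0.
have cH : {within D, continuous (fun t => - xi - H t)}.
  have cH := integral_within_continuous ch.
  by apply/subspace_continuousP => x Dx; apply: cvgB; [exact: cvg_cst|exact: within_cvg_at cH Dx].
have -> : noise ^~ w = (fun t => Z t w / phi t + (- xi - H t)).
  by apply/funext => t; rewrite /noise addrA.
by apply: within_add => //; exact: within_mul.
Qed.

End solution.

(** * Inverting the clock *)

Section clock_family.
Context {R : realType} (T : \bar R) (k : R -> R).
Local Notation D := (time_interval T).
Hypothesis T0 : (0 < T)%E.
Hypothesis ck : {within D, continuous k}.
Context (d : measure_display) (Omega : measurableType d) (P : probability Omega R).
Variables (B : R -> Omega -> R) (N : R -> Omega -> R).
Hypothesis hB : standard_wiener_process P B.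
Hypothesis hN : forall t, D t -> wiener_integral P B (cut k t) (N t).
Local Notation mu := (@lebesgue_measure R).

(** The variance of the integral of k over [0, t]. *)
Definition energy t := \int[mu]_(u in `[0, t]) (k u ^+ 2).
Local Notation A := energy.

Let ck2 : {within D, continuous (fun u => k u ^+ 2)}.
Proof. exact: (within_mul ck ck). Qed.

Lemma energy_continuous : {within D, continuous A}.
Proof. exact: integral_within_continuous. Qed.

Lemma energy0 : A 0 = 0.
Proof. by rewrite /A set_itv1 Rintegral_set1. Qed.

Lemma energy_le s t : 0 <= s -> s <= t -> D t -> A s <= A t.
Proof.
move=> s0 st Dt; have [c _ h] := integral_mean_value (within_segment ck2 Dt) s0 st (lexx t).
by rewrite -subr_ge0 /A h mulr_ge0 ?sqr_ge0 ?subr_ge0.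
Qed.

Lemma sqn_cut_energy t : D t -> sqn mu (cut k t) = (A t)%:E.
Proof. by move=> Dt; apply: sqn_cut; exact: within_segment. Qed.

Lemma sqn_sub_sym (f g : R -> R) :
  sqn mu (fun u => f u - g u)%R = sqn mu (fun u => g u - f u)%R.
Proof. by apply: eq_sqn => u; rewrite -sqrrN opprB. Qed.

Lemma sqn_cut_dist s t : D s -> D t ->
  sqn mu (fun u => cut k t u - cut k s u)%R = `|A t - A s|%:E.
Proof.
move=> Ds Dt; have [s0 _] := Ds; have [t0 _] := Dt.
wlog st : s t Ds Dt s0 t0 / s <= t.
  move=> h; have [st|/ltW ts] := leP s t; first exact: h.
  by rewrite sqn_sub_sym distrC; exact: h.
rewrite sqn_cut_sub ?ger0_norm//; last exact: within_segment.
by rewrite subr_ge0 energy_le.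
Qed.

Lemma energy_gt0 (delta : \bar R) : (0 < delta)%E ->
  (forall t : R, 0 < t -> (t%:E < delta)%E -> k t <> 0) ->
  forall t, D t -> 0 < t -> 0 < A t.
Proof.
move=> d0 kn0 t Dt t0.
have [b [b0 bt bd]] : exists b, [/\ 0 < b, b <= t & (b%:E < delta)%E].
  case: delta d0 {kn0} => [r||]; rewrite ?lte_fin.
  - move=> r0; exists (Num.min t (r / 2)).
    rewrite lte_fin lt_min t0 divr_gt0// ge_min lexx; split=> //.
    by rewrite gt_min; apply/orP; right; lra.
  - by exists t; rewrite ltry.
  - by rewrite ltNge leNye.
have b2 : 0 <= b / 2 by lra.
have b2b : b / 2 <= b by lra.
have Db : D b by apply: time_interval_le Dt; rewrite (ltW b0).
have [c /andP[bc cb] h] := integral_mean_value (within_segment ck2 Db) b2 b2b (lexx b).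
apply: lt_le_trans (energy_le (ltW b0) bt Dt).
apply: le_lt_trans (_ : A (b / 2) < A b).
  rewrite -energy0; apply: energy_le => //.
  by apply: time_interval_le Db; rewrite b2.
rewrite -subr_gt0 /A h mulr_gt0 ?subr_gt0//; last by lra.
rewrite lt_neqAle sqr_ge0 andbT eq_sym sqrf_eq0; apply/eqP; apply: kn0; first by lra.
by apply: le_lt_trans bd; rewrite lee_fin.
Qed.

(** The new Wiener process at the time s consists of the integral J s of f s with
    respect to B and of an independent Wiener process at the time m s. The second
    and third conditions make s |-> (f s, m s) isometric, and by the last one the time A t of the clock belongs to the integral of k over ]0, t]. *)
Definition clock_family (U : set R) (f : R -> R -> R) (J : R -> Omega -> R) (m : R -> R) :=
  [/\ forall s, 0 < s -> wiener_integral P B (f s) (J s) /\ (forall u, ~ D u -> f s u = 0),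
      forall s, 0 < s -> U (m s) /\ (sqn mu (f s) + (m s)%:E = s%:E)%E,
      forall s t, 0 < s -> s <= t ->
        (sqn mu (fun u => f t u - f s u)%R + `|m t - m s|%:E = (t - s)%:E)%E &
      forall t, D t -> 0 < t -> 0 < A t ->
        sqn mu (fun u => f (A t) u - cut k t u)%R = 0%E /\ m (A t) = 0].

Lemma cut_out t u : D t -> ~ D u -> cut k t u = 0.
Proof.
move=> Dt Du; rewrite /cut indicE memNset ?mulr0//= => ut; apply: Du.
by apply: (time_interval_sub Dt); exact: subset_itv_oc_cc ut.
Qed.

Lemma energy_onto s t : 0 <= s -> D t -> s <= A t -> exists2 u, D u & A u = s.
Proof.
move=> s0 Dt sA; have [t0 _] := Dt.
have cA := within_segment energy_continuous Dt.
have [|c ct cs] := @IVT R A 0 t s t0 cA.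
  by rewrite energy0 min_l ?max_r ?s0//; exact: le_trans sA.
exists c => //; apply: time_interval_le Dt; first by move: ct; rewrite in_itv/=.
Qed.

(** Every s > 0 is A u for some u; let f s be k cut at u. *)
Lemma unbounded_clock_family : (forall s, exists2 t, D t & s <= A t) ->
  exists f J, clock_family [set 0] f J (fun=> 0).
Proof.
move=> unb.
have /choice[tau htau] : forall s : R, exists u : R, 0 < s -> D u /\ A u = s.
  move=> s; have [s0|s0] := ltP 0 s; last by exists 0.
  have [t Dt sA] := unb s; have [u Du uA] := energy_onto (ltW s0) Dt sA.
  by exists u.
exists (fun s => cut k (tau s)), (fun s => N (tau s)); split.
- move=> s s0; have [Ds _] := htau s s0.
  by split=> [|u Du]; [exact: hN|exact: cut_out].
- by move=> s s0; have [Ds As] := htau s s0; rewrite sqn_cut_energy// As adde0.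
- move=> s t s0 st; have [Ds As] := htau s s0; have [Dt At] := htau t (lt_le_trans s0 st).
  by rewrite sqn_cut_dist// As At subrr normr0 adde0 ger0_norm// subr_ge0.
- move=> t Dt t0 At0; have [Ds As] := htau _ At0; split=> //.
  by rewrite sqn_cut_dist// As subrr normr0.
Qed.

Lemma time_interval_exhaust : exists u : nat -> R, [/\ forall n, D (u n),
  {homo u : i j / (i <= j)%N >-> i <= j} & forall t, D t -> \forall n \near \oo, t <= u n].
Proof.
have homoP (v : nat -> R) : (forall n, v n <= v n.+1) -> {homo v : i j / (i <= j)%N >-> i <= j}.
  by move=> h; apply: homo_leq => // a b c; exact: le_trans.
rewrite /time_interval; case: T T0 => [r||] T0'.
- rewrite lte_fin in T0'; exists (fun n => r - r / n.+1%:R); split.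
  + move=> n; split; last by rewrite lte_fin ltrBlDr ltrDl divr_gt0.
    by rewrite subr_ge0 ler_piMr ?(ltW T0')// invf_le1// ler1n.
  + apply: homoP => n; rewrite lerD2l lerN2 ler_wpM2l ?(ltW T0')//.
    by rewrite lef_pV2 ?posrE// ler_nat.
  + move=> t [t0]; rewrite lte_fin => tr.
    have rt : 0 < r - t by rewrite subr_gt0.
    near=> n; have : r / n.+1%:R < r - t by near: n; exact: mesh_cvg.
    by move=> /ltW; rewrite lerBrDl -lerBrDr.
- exists (fun n => n%:R); split.
  + by move=> n; split; [exact: ler0n|exact: ltry].
  + by apply: homoP => n; rewrite ler_nat.
  + by move=> t _; exact: nbhs_infty_ger.
- by move: T0'; rewrite ltNge leNye.
Unshelve. all: by end_near. Qed.

(** Times s below c = sup A are treated as in the unbounded case. From c on, f s is k on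
    the whole of [0, T), square integrable because c is finite, and the remaining
    time s - c goes to the independent process. *)
Lemma bounded_clock_family : (exists s, forall t, D t -> A t <= s) ->
  exists f J m, clock_family [set u | 0 <= u] f J m.
Proof.
move=> [b hb].
have D0 : D 0 by split.
pose c := sup (A @` D).
have hasup : has_sup (A @` D) by split; [exists (A 0), 0|exists b => _ [t Dt <-]; exact: hb].
have Ac t : D t -> A t <= c by move=> Dt; apply: (sup_upper_bound hasup); exists t.
have c0 : 0 <= c by rewrite -energy0; exact: Ac.
have cadh e : 0 < e -> exists2 t, D t & c - e < A t.
  by move=> e0; have [_ [t Dt <-] h] := sup_adherent e0 hasup; exists t.
pose kT u := k u * \1_(D `&` [set u | 0 < u]) u.
have [v [Dv hv exh]] := time_interval_exhaust.
have kT_cut t u : D t -> u <= t -> kT u = cut k t u.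
  move=> Dt ut; rewrite /kT /cut !indicE; congr (_ * (_ : bool)%:R).
  apply/idP/idP; rewrite !inE/= in_itv/=; first by move=> [_ ->]; rewrite ut.
  by move=> /andP[u0 _]; split=> //; apply: time_interval_le Dt; rewrite (ltW u0).
have kTcvg u : cut k (v n) u @[n --> \oo] --> kT u.
  have [Du|Du] := pselect (D u).
    apply: (@cvg_near_cst _ _ _ _ _ _ _) => //; near=> n; rewrite -kT_cut//.
    by near: n; exact: exh.
  have kTu : kT u = 0 by rewrite /kT indicE memNset ?mulr0// => -[].
  have cutu : (fun n => cut k (v n) u) = cst 0 by apply/funext => n; rewrite cut_out.
  by rewrite kTu cutu; exact: cvg_cst.
have mcut t : D t -> measurable_fun setT (cut k t).
  by move=> Dt; apply: measurable_cut; exact: within_segment.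
have mkT : measurable_fun setT kT.
  exact: (measurable_fun_cvg (fun n => mcut (v n) (Dv n)) (fun u _ => kTcvg u)).
(* Fatou's lemma gives the upper bound, domination of the cuts the lower one. *)
have sqn_kT t : D t -> sqn mu (fun u => kT u - cut k t u)%R = (c - A t)%:E.
  move=> Dt; apply/eqP; rewrite eq_le; apply/andP; split.
    have [M _ hM] := exh t Dt.
    apply: (@fatou_bound _ _ _ mu (fun n u => cut k (v n) u - cut k t u) _ _ M).
    - by move=> n; apply: measurable_funB; exact: mcut.
    - by apply: measurable_funB => //; exact: mcut.
    - by apply: aeW => u; apply: cvgB => //; exact: cvg_cst.
    - move=> n Mn; rewrite sqn_cut_dist// lee_fin ger0_norm ?subr_ge0.
        by rewrite lerD2r Ac.
      by apply: energy_le => //; [case: Dt|exact: hM].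
  apply/lee_addgt0Pr => e e0; have [s Ds cs] := cadh e e0.
  have [n hn] : exists n, t <= v n /\ s <= v n.
    by have [n h] := filter_ex (filterI (exh t Dt) (exh s Ds)); exists n.
  apply: (@le_trans _ _ (sqn mu (fun u => cut k (v n) u - cut k t u)%R + e%:E)%E).
    rewrite sqn_cut_dist// -EFinD lee_fin.
    apply: (@le_trans _ _ (A (v n) - A t + e)); last by rewrite lerD2r ler_norm.
    have : A s <= A (v n) by apply: energy_le => //; [case: Ds|case: hn].
    by move: cs; lra.
  rewrite leeD2r//; apply: ge0_le_integral => //.
  - by move=> u _; rewrite lee_fin sqr_ge0.
  - by apply: measurable_sqr_EFin; apply: measurable_funB; exact: mcut.
  - by apply: measurable_sqr_EFin; apply: measurable_funB => //; exact: mcut.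
  - move=> u _; rewrite lee_fin; have [uv|vu] := leP u (v n); first by rewrite (kT_cut (v n)).
    have cut0 x : x < u -> cut k x u = 0.
      by move=> xu; rewrite /cut indicE memNset ?mulr0//= in_itv/= leNgt xu andbF.
    by rewrite !cut0 ?(le_lt_trans hn.1 vu)// subrr expr0n sqr_ge0.
have [J0 J0w] : exists J, wiener_integral P B kT J.
  have h16 n : 0 < (16^-1 : R) ^+ n by rewrite exprn_gt0.
  have /choice[s hs] : forall n : nat, exists s : R, D s /\ c - 16^-1 ^+ n < A s.
    by move=> n; have [t Dt h] := cadh _ (h16 n); exists t.
  apply: (@wiener_integral_exists _ _ _ P B (wiener_elementary_gaussian hB) kT
    (fun n => cut k (s n)) (fun n => N (s n)) 1) => //.
    by move=> n; apply: hN; case: (hs n).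
  move=> n; have [Ds cs] := hs n; rewrite sqn_kT// mul1r lee_fin; lra.
have /choice[tau htau] : forall s : R, exists u : R, 0 < s < c -> D u /\ A u = s.
  move=> s; have [/andP[s0 sc]|] := boolP (0 < s < c); last by exists 0.
  have cs0 : 0 < c - s by rewrite subr_gt0.
  have [t Dt sA] := cadh _ cs0; have st : s <= A t by move: sA; rewrite opprB addrC subrK => /ltW.
  by have [u Du uA] := energy_onto (ltW s0) Dt st; exists u.
have sqn_kT0 : sqn mu kT = c%:E.
  rewrite -(subr0 c) -energy0 -sqn_kT//; apply: eq_sqn => u.
  by rewrite /cut set_itvoc0 indic0 mulr0 subr0.
have sqn_f0 (f : R -> R) : sqn mu (fun u => f u - f u)%R = 0%E.
  by rewrite /sqn; under eq_integral do rewrite subrr expr0n; exact: integral0.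
exists (fun s => if s < c then cut k (tau s) else kT), (fun s => if s < c then N (tau s) else J0),
  (fun s => if s < c then 0 else s - c); split.
- move=> s s0; have [sc|cs] := ltP s c.
    have [|Ds _] := htau s; first by rewrite s0.
    by split=> [|u Du]; [exact: hN|exact: cut_out].
  by split=> // u Du; rewrite /kT indicE memNset ?mulr0// => -[].
- move=> s s0; have [sc|cs] := ltP s c.
    have [|Ds As] := htau s; first by rewrite s0.
    by split; rewrite /= ?lexx// sqn_cut_energy// As adde0.
  by split; rewrite /= ?subr_ge0// sqn_kT0 -EFinD addrC subrK.
- move=> s t s0 st; have t0 := lt_le_trans s0 st.
  have [tc|ct] := ltP t c.
    have sc := le_lt_trans st tc; rewrite sc.
    have [|Ds As] := htau s; first by rewrite s0.
    have [|Dt At] := htau t; first by rewrite t0.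
    by rewrite sqn_cut_dist// As At subrr normr0 adde0 ger0_norm// subr_ge0.
  have [sc|cs] := ltP s c.
    have [|Ds As] := htau s; first by rewrite s0.
    rewrite sqn_kT// As subr0 ger0_norm ?subr_ge0// -EFinD; congr EFin; ring.
  rewrite sqn_f0 add0e; congr EFin; rewrite ger0_norm; [ring|].
  by move: st; lra.
- move=> t Dt t0 At0; have [Atc|cAt] := ltP (A t) c.
    have [|Ds As] := htau (A t); first by rewrite At0.
    by rewrite sqn_cut_dist// As subrr normr0.
  have Atc : A t = c by apply/eqP; rewrite eq_le cAt Ac.
  by rewrite sqn_kT// Atc subrr.
Unshelve. all: by end_near. Qed.

End clock_family.

(** * Continuing the Wiener process independently *)

Section transport.
Context {R : realType} {d d' : measure_display}.
Context {Omega : measurableType d} {Omega' : measurableType d'}.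
Variables (P : probability Omega R) (Q : probability Omega' R) (pr : Omega' -> Omega).

Definition law_preserving : Prop := measurable_fun setT pr /\
  forall A : set Omega, measurable A -> Q (pr @^-1` A) = P A.

Hypothesis pr_law : law_preserving.

Lemma law_preserving_ae (E : Omega -> Prop) :
  {ae P, forall w, E w} -> {ae Q, forall w, E (pr w)}.
Proof.
move=> [A [mA A0 EA]]; exists (pr @^-1` A); split.
- by rewrite -[X in measurable X]setTI; exact: pr_law.1.
- by rewrite pr_law.2.
- by move=> w nE; apply: EA.
Qed.

Lemma law_preserving_gaussian X v : gaussian P X v -> gaussian Q (fun w => X (pr w)) v.
Proof.
move=> [mX Xv]; split; first exact: measurableT_comp mX pr_law.1.
move=> A mA; rewrite -(Xv A mA) -(pr_law.2 (X @^-1` A))//.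
by rewrite -[X in measurable X]setTI; exact: mX.
Qed.

End transport.

Section product.
Context {R : realType} {d d' : measure_display}.
Context {Omega : measurableType d} {Omega' : measurableType d'}.
Variables (P : probability Omega R) (P' : probability Omega' R).
Local Notation Q := (P \x P')%E.

Lemma fst_law_preserving : law_preserving P Q (fun w : Omega * Omega' => w.1).
Proof.
split; first exact: measurable_fst.
move=> A mA; have -> : (fun w : Omega * Omega' => w.1) @^-1` A = A `*` setT.
  by apply/seteqP; split=> w //= [].
apply: etrans (product_measure1E P P' mA measurableT) _.
rewrite -[RHS]mule1; congr (_ * _)%E.
exact: probability_setT.
Qed.

Lemma gaussian_product X Y a b : 0 <= a -> 0 <= b ->
  gaussian P X a -> gaussian P' Y b ->
  gaussian Q (fun w : Omega * Omega' => X w.1 + Y w.2) (a + b).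
Proof.
move=> a0 b0 [mX Xa] [mY Yb].
have mX1 : measurable_fun setT (fun w : Omega * Omega' => X w.1) := measurableT_comp mX measurable_fst.
have mY2 : measurable_fun setT (fun w : Omega * Omega' => Y w.2) := measurableT_comp mY measurable_snd.
split; first exact: measurable_funD.
have prodE (A1 A2 : set R) : measurable A1 -> measurable A2 ->
    Q ((fun w : Omega * Omega' => X w.1) @^-1` A1 `&` (fun w => Y w.2) @^-1` A2) =
    (1%:E * (gauss_law a A1 * gauss_law b A2))%E.
  move=> mA1 mA2; rewrite mul1e -Xa// -Yb//.
  have -> : (fun w : Omega * Omega' => X w.1) @^-1` A1 `&` (fun w => Y w.2) @^-1` A2 =
    (X @^-1` A1) `*` (Y @^-1` A2) by [].
  by apply: product_measure1E; rewrite -[X in measurable X]setTI; [exact: mX|exact: mY].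
move=> A mA; rewrite -[RHS]mul1e.
exact: (gaussian_add_law mX1 mY2 ler01 a0 b0 prodE).
Qed.

End product.

Section extension.
Context {R : realType} {d d' : measure_display}.
Context {Omega : measurableType d} {Omega' : measurableType d'}.
Variables (P : probability Omega R) (B : R -> Omega -> R) (D : set R).
Variables (Q : probability Omega' R) (pr : Omega' -> Omega).
Local Notation mu := (@lebesgue_measure R).

(** M is a Wiener process on the times in U, living on Q and independent of the
    integrals with respect to B of functions supported in D. Independence is
    expressed by the normal laws and the square means of sums; U is either {0} or
    the half-line. *)
Definition wiener_extension (U : set R) (M : R -> Omega' -> R) : Prop :=
  [/\ law_preserving P Q pr,
      U 0 /\ (forall u, U u -> 0 <= u),
      forall w, M 0 w = 0,
      forall f J n (c u : 'I_n -> R), wiener_integral P B f J ->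
        (forall x, ~ D x -> f x = 0) -> (forall i, U (u i)) ->
        exists2 v : R, 0 <= v &
          gaussian Q (fun w => J (pr w) + \sum_(i < n) c i * M (u i) w) v &
      forall f J u u', wiener_integral P B f J -> (forall x, ~ D x -> f x = 0) ->
        U u -> U u' ->
        (sqn Q (fun w => J (pr w) + (M u w - M u' w))%R = sqn mu f + `|u - u'|%:E)%E].

End extension.

Section extensions.
Context {R : realType} {d : measure_display} {Omega : measurableType d}.
Variables (P : probability Omega R) (B : R -> Omega -> R).
Hypothesis hB : standard_wiener_process P B.
Local Notation mu := (@lebesgue_measure R).
Let eg := wiener_elementary_gaussian hB.

Let fine_sqn_ge0 f : 0 <= fine (sqn mu f).
Proof. by rewrite fine_ge0// sqn_ge0. Qed.

Lemma sqn_gaussian d' (Omega' : measurableType d') (Q : probability Omega' R) X v :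
  0 <= v -> gaussian Q X v -> sqn Q X = v%:E.
Proof. exact: gaussian_second_moment. Qed.

Lemma trivial_extension (D : set R) d' (Omega' : measurableType d') (Q : probability Omega' R)
    (pr : Omega' -> Omega) : law_preserving P Q pr ->
  wiener_extension P B D Q pr [set 0] (fun _ _ => 0).
Proof.
move=> lp; split => //.
- by split=> // u ->.
- move=> f J n c u fJ _ _; exists (fine (sqn mu f)) => //.
  have := law_preserving_gaussian lp (wiener_integral_gaussian eg fJ).
  have -> // : (fun w => J (pr w) + \sum_(i < n) c i * 0) = (fun w => J (pr w)).
  by apply/funext => w; rewrite big1 ?addr0// => i _; rewrite mulr0.
- move=> f J u u' fJ _ -> ->.
  rewrite (@eq_sqn _ _ _ Q _ (fun w => J (pr w))); last by move=> w; rewrite subrr addr0.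
  rewrite (sqn_gaussian _ (law_preserving_gaussian lp (wiener_integral_gaussian eg fJ)))//.
  rewrite fineK ?subrr ?normr0 ?adde0// ge0_fin_numE ?sqn_ge0//.
  exact: (wiener_integral_lty eg fJ).
Qed.

Lemma sqn_indic_sub (a u u' : R) : 0 <= u -> 0 <= u' ->
  sqn mu (fun x => \1_(`]a, a + u]) x - \1_(`]a, a + u']) x) = `|u - u'|%:E.
Proof.
wlog uu : u u' / u' <= u.
  move=> h u0 u0'; have [|/ltW] := leP u' u => uu; first exact: h.
  by rewrite (@eq_sqn _ _ _ mu _ (fun x => \1_(`]a, a + u']) x - \1_(`]a, a + u]) x)) 1?distrC ?h// => x;
    rewrite -sqrrN opprB.
move=> u0 u0'; rewrite ger0_norm ?subr_ge0//.
rewrite (_ : u - u' = (a + u) - (a + u')); last by ring.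
rewrite -integral_indic_itv ?lerD2l//; apply: eq_integral => x _; congr EFin.
rewrite !indic_itvE ?lerDl ?lerD2l//.
rewrite (_ : _ - _ - _ = (x <= a + u)%R%:R - (x <= a + u')%R%:R); last by ring.
have [xu|_] := leP x (a + u'); first by rewrite (le_trans xu) ?lerD2l// subrr expr0n.
by rewrite subr0; case: (x <= _); rewrite ?expr1n ?expr0n.
Qed.

(** An increment of B after T is the integral of an indicator supported after T, so its
    sums with integrals over [0, T) are integrals of functions with disjoint
    supports. *)
Lemma later_increments_extension (T : R) : 0 < T ->
  wiener_extension P B (time_interval T%:E) P (fun w => w) [set u | 0 <= u]
    (fun u w => B (T + u) w - B T w).
Proof.
move=> T0.
have wM u : 0 <= u -> wiener_integral P B (\1_(`]T, T + u])) (fun w => B (T + u) w - B T w).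
  by move=> u0; apply: wiener_integral_itv => //; [exact: ltW|rewrite lerDl].
have offT f (x : R) : (forall x, ~ time_interval T%:E x -> f x = 0) -> T < x -> f x = 0 :> R.
  by move=> fD Tx; apply: fD => -[_]; rewrite lte_fin ltNge (ltW Tx).
split.
- by split.
- by split=> [|u]; rewrite /= ?lexx.
- by move=> w; rewrite addr0 subrr.
- move=> f J n c u fJ _ u0.
  pose g x := f x + \sum_(i < n) c i * \1_(`]T, T + u i]) x.
  exists (fine (sqn mu g)) => //; apply: (wiener_integral_gaussian eg).
  apply: (wiener_integralD eg fJ).
  apply: (@wiener_integral_sum _ _ _ _ _ eg _ _ (fun (i : 'I_n) x => _) (fun (i : 'I_n) w => _)) => i.
  by apply: (wiener_integralZ eg); apply: wM; exact: u0.
- move=> f J u u' fJ fD u0 u0'.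
  have wD := wiener_integralB eg (wM u u0) (wM u' u0').
  rewrite (wiener_integral_sqn eg (wiener_integralD eg fJ wD)).
  have [mf _ _] := fJ; have [md _ _] := wD.
  rewrite -(sqn_indic_sub T u0 u0') /sqn -ge0_integralD//; last 4 first.
  + by move=> x _; rewrite lee_fin sqr_ge0.
  + exact: measurable_sqr_EFin.
  + by move=> x _; rewrite lee_fin sqr_ge0.
  + exact: measurable_sqr_EFin.
  apply: eq_integral => x _; rewrite -EFinD; congr EFin.
  rewrite !indic_itvE ?lerDl//; have [xT|Tx] := leP x T.
    by rewrite !(le_trans xT) ?lerDl// !subrr addr0 expr0n addr0.
  by rewrite (offT _ _ fD Tx) !add0r expr0n add0r.
Qed.

(** The second coordinate carries an independent copy of B. *)
Lemma product_extension (D : set R) :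
  wiener_extension P B D (P \x P)%E (fun w : Omega * Omega => w.1) [set u | 0 <= u]
    (fun u w => B u w.2 - B 0 w.2).
Proof.
have wM u : 0 <= u -> wiener_integral P B (\1_(`]0, u])) (fun w => B u w - B 0 w).
  by move=> u0; apply: wiener_integral_itv.
split.
- exact: fst_law_preserving.
- by split=> [|u]; rewrite /= ?lexx.
- by move=> w; rewrite subrr.
- move=> f J n c u fJ _ u0.
  have wS : wiener_integral P B (fun x => \sum_(i < n) c i * \1_(`]0, u i]) x)
      (fun w => \sum_(i < n) c i * (B (u i) w - B 0 w)).
    apply: (@wiener_integral_sum _ _ _ _ _ eg _ _ (fun (i : 'I_n) x => _) (fun (i : 'I_n) w => _)) => i.
    by apply: (wiener_integralZ eg); apply: wM; exact: u0.
  have := gaussian_product (fine_sqn_ge0 _) (fine_sqn_ge0 _) (wiener_integral_gaussian eg fJ)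
    (wiener_integral_gaussian eg wS).
  by move=> h; eexists; last exact: h; rewrite addr_ge0.
- move=> f J u u' fJ fD u0 u0'.
  have wD := wiener_integralB eg (wM u u0) (wM u' u0').
  have := gaussian_product (fine_sqn_ge0 _) (fine_sqn_ge0 _) (wiener_integral_gaussian eg fJ)
    (wiener_integral_gaussian eg wD).
  move=> /(sqn_gaussian (addr_ge0 (fine_sqn_ge0 _) (fine_sqn_ge0 _))) ->.
  have fin g K : wiener_integral P B g K -> sqn mu g \is a fin_num.
    by move=> gK; rewrite ge0_fin_numE ?sqn_ge0//; exact: (wiener_integral_lty eg gK).
  rewrite EFinD !fineK ?(fin _ _ fJ) ?(fin _ _ wD)//.
  have := sqn_indic_sub 0 u0 u0'; rewrite !add0r => <-.
  by [].
Qed.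

End extensions.

(** * The new Wiener process *)

Section new_wiener.
Context {R : realType} (T : \bar R) (k : R -> R).
Local Notation D := (time_interval T).
Context {d d' : measure_display}.
Context {Omega : measurableType d} {Omega' : measurableType d'}.
Variables (P : probability Omega R) (B N : R -> Omega -> R).
Variables (Q : probability Omega' R) (pr : Omega' -> Omega).
Hypothesis hB : standard_wiener_process P B.
Hypothesis hN : forall t, D t -> wiener_integral P B (cut k t) (N t).
Variables (U : set R) (M : R -> Omega' -> R).
Hypothesis hM : wiener_extension P B D Q pr U M.
Variables (f : R -> R -> R) (J : R -> Omega -> R) (m : R -> R).
Hypothesis hf : clock_family T k P B U f J m.
Local Notation mu := (@lebesgue_measure R).
Let eg := wiener_elementary_gaussian hB.

Definition new_wiener s w := J s (pr w) + M (m s) w.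

Lemma new_wiener_gaussian n (s c : 'I_n -> R) : (forall i, 0 < s i) ->
  exists2 v : R, 0 <= v & gaussian Q (fun w => \sum_(i < n) c i * new_wiener (s i) w) v.
Proof.
move=> s0; have [wJ mU _ _] := hf; have [_ _ _ gM _] := hM.
have wS : wiener_integral P B (fun x => \sum_(i < n) c i * f (s i) x)
    (fun w => \sum_(i < n) c i * J (s i) w).
  apply: (@wiener_integral_sum _ _ _ _ _ eg _ _ (fun (i : 'I_n) x => _) (fun (i : 'I_n) w => _)) => i.
  by apply: (wiener_integralZ eg); have [] := wJ _ (s0 i).
have [||v v0 gv] := gM _ _ n c (fun i => m (s i)) wS.
- by move=> x Dx; rewrite big1// => i _; have [_ ->] := wJ _ (s0 i); rewrite ?mulr0.
- by move=> i; have [] := mU _ (s0 i).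
- exists v => //; rewrite (_ : (fun w => _) = (fun w => \sum_(i < n) c i * J (s i) (pr w) +
    \sum_(i < n) c i * M (m (s i)) w))//.
  by apply/funext => w; rewrite -big_split; apply: eq_bigr => i _; rewrite /new_wiener mulrDr.
Qed.

Lemma new_wiener_sqn s : 0 < s -> sqn Q (new_wiener s) = s%:E.
Proof.
move=> s0; have [wJ mU _ _] := hf; have [_ [U0 Uge0] M0 _ sM] := hM.
have [wJs offJ] := wJ s s0; have [Ums <-] := mU s s0.
rewrite (@eq_sqn _ _ _ Q _ (fun w => J s (pr w) + (M (m s) w - M 0 w))); last first.
  by move=> w; rewrite M0 subr0.
by rewrite (sM _ _ _ _ wJs)// subr0 ger0_norm// Uge0.
Qed.

Lemma new_wiener_sqnB s t : 0 < s -> 0 < t ->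
  sqn Q (fun w => new_wiener t w - new_wiener s w)%R = `|t - s|%:E.
Proof.
wlog st : s t / s <= t.
  move=> h s0 t0; have [|/ltW] := leP s t => st; first exact: h.
  rewrite (@eq_sqn _ _ _ Q _ (fun w => new_wiener s w - new_wiener t w)) 1?distrC ?h//.
  by move=> w; rewrite -sqrrN opprB.
move=> s0 t0; have [wJ mU dJ _] := hf; have [_ _ _ _ sM] := hM.
have [wJs offs] := wJ s s0; have [wJt offt] := wJ t t0.
rewrite ger0_norm ?subr_ge0// -dJ//.
rewrite -(sM _ _ _ _ (wiener_integralB eg wJt wJs))//; last 3 first.
- by move=> x Dx; rewrite offs ?offt ?subrr.
- by have [] := mU t t0.
- by have [] := mU s s0.
by apply: eq_sqn => w; rewrite /new_wiener opprD addrACA.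
Qed.

(** The integrands on both sides are at L^2 distance 0. *)
Lemma new_wiener_noise t : D t -> 0 < t -> 0 < energy k t ->
  {ae Q, forall w, new_wiener (energy k t) w = N t (pr w)}.
Proof.
move=> Dt t0 At0; have [wJ _ _ mJ] := hf; have [lp _ M0 _ _] := hM.
have [fN mA] := mJ t Dt t0 At0; have [wJt _] := wJ _ At0.
have wD := wiener_integralB eg wJt (hN Dt); have [_ mD _] := wD.
have := @sqn_eq0_ae _ _ _ P _ mD; rewrite (wiener_integral_sqn eg wD) => /(_ fN).
move=> /(law_preserving_ae lp); apply: filterS => w /eqP.
by rewrite subr_eq0 => /eqP; rewrite /new_wiener mA M0 addr0.
Qed.

End new_wiener.

(** * The representation *)

Section from_below.
Context {R : realType}.
Implicit Types (T : \bar R).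

Lemma from_below_proper T : (0 < T)%E -> ProperFilter (from_below T).
Proof. by case: T => [r||] //= _; exact: _. Qed.

Lemma from_below_interior T : (0 < T)%E ->
  \forall t \near from_below T, 0 < t /\ time_interval T t.
Proof.
case: T => [r||] //=.
- rewrite lte_fin => r0; near=> t.
  have t0 : 0 < t by near: t; exact: nbhs_left_gt.
  by do !split=> //; [exact: ltW|rewrite lte_fin; near: t; exact: nbhs_left_lt].
- move=> _; near=> t.
  have t0 : 0 < t by near: t; exact: nbhs_pinfty_gt.
  by split=> //; split; rewrite ?ltry// ltW.
Unshelve. all: by end_near. Qed.

Lemma ae_forall_rat d (Omega : measurableType d) (Q : probability Omega R)
    (E : rat -> Omega -> Prop) :
  (forall q, {ae Q, forall w, E q w}) -> {ae Q, forall w, forall q, E q w}.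
Proof.
move=> hE; have /ae_foralln h : forall n : nat,
    {ae Q, forall w, forall q : rat, unpickle n = Some q -> E q w}.
  move=> n; case: (unpickle n) => [q|]; last by apply: aeW.
  by move: (hE q); apply: filterS => w Eq q' [<-].
by apply: filterS h => w h q; apply: (h (pickle q)); rewrite pickleK.
Qed.

Lemma eq_on_rationals (f g : R -> R) (V : set R) t : nbhs t V ->
  {for t, continuous f} -> {for t, continuous g} ->
  (forall q : rat, V (ratr q) -> f (ratr q) = g (ratr q)) -> f t = g t.
Proof.
move=> Vt cf cg fg; apply: contrapT => /eqP; rewrite -subr_eq0 -normr_gt0 => d0.
have cd : {for t, continuous (fun x => f x - g x)} by exact: cvgB.
have : \forall x \near t, 0 < `|f x - g x|.
  exact: (cvgr_gt _ (cvg_norm cd) _ d0).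
move=> h; have /nbhs_ballP[r /= r0 hr] : nbhs t (V `&` [set x | 0 < `|f x - g x|]).
  exact: filterI.
have [q] : exists q : rat, ratr q \in `]t, t + r[.
  by apply: rat_in_itvoo; rewrite ltrDl.
rewrite in_itv/= => /andP[tq qr].
have [|Vq] := hr (ratr q).
  by rewrite -ball_normE/= ltr0_norm ?subr_lt0// opprB ltrBlDl.
by rewrite /= fg// subrr normr0 ltxx.
Qed.

End from_below.

Section representation.
Context {R : realType} (T : \bar R) (phi psi sigma : R -> R).
Local Notation D := (time_interval T).
Hypothesis T0 : (0 < T)%E.
Hypothesis phi_gt0 : forall t, D t -> 0 < phi t.
Hypothesis phi_C1 : continuously_differentiable_on D phi.
Hypothesis phi0 : phi 0 = 1.
Hypothesis psi_cont : {within D, continuous psi}.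
Hypothesis sigma_cont : {within D, continuous sigma}.
Hypothesis sigma_neq0 : exists delta : \bar R, (0 < delta <= T)%E /\
  forall t : R, 0 < t -> (t%:E < delta)%E -> sigma t <> 0.
Context (d : measure_display) (Omega : measurableType d) (P : probability Omega R).
Variables (B : R -> Omega -> R) (xi : R) (Z : R -> Omega -> R).
Hypothesis hB : standard_wiener_process P B.
Hypothesis hZ : strong_solution P B T phi psi sigma xi Z.
Local Notation mu := (@lebesgue_measure R).

Let k u := sigma u / phi u.
Let N := noise phi psi xi Z.

Let ck : {within D, continuous k}.
Proof. exact: kernel_continuous phi_gt0 phi_C1 sigma_cont. Qed.

Lemma clock_energy t : clock phi sigma t = energy k t.
Proof.
by rewrite /clock /energy; congr Rintegral; apply/funext => u; rewrite /k expr_div_n.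
Qed.

Lemma clock_gt0 t : D t -> 0 < t -> 0 < energy k t.
Proof.
have [delta [/andP[d0 dT] sn]] := sigma_neq0.
apply: (energy_gt0 ck d0) => s s0 sd; apply/eqP; rewrite /k mulf_neq0 ?invr_eq0//.
  by apply/eqP; exact: sn.
by rewrite gt_eqF// phi_gt0//; split; [exact: ltW|exact: lt_le_trans dT].
Qed.

Let hN t : D t -> wiener_integral P B (cut k t) (N t).
Proof. exact: wiener_integral_noise. Qed.

Section on_extension.
Context {d' : measure_display} {Omega' : measurableType d'}.
Variables (Q : probability Omega' R) (pr : Omega' -> Omega).
Variables (U : set R) (M : R -> Omega' -> R).
Hypothesis hM : wiener_extension P B D Q pr U M.
Variables (f : R -> R -> R) (J : R -> Omega -> R) (m : R -> R).
Hypothesis hf : clock_family T k P B U f J m.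

Let lp : law_preserving P Q pr. Proof. by case: hM. Qed.

(** Both sides of the identity are continuous on (0, T), so that rational times suffice.
    The limits at 0 and T are then those of the centred process itself. *)
Lemma representation_of_extension : ou_representation T phi sigma P (centering P Z) Q pr.
Proof.
have [X [ouX XW]] := ou_of_wiener (new_wiener_gaussian hB hM hf) (new_wiener_sqn hM hf)
  (new_wiener_sqnB hB hM hf).
have [_ _ _ cX] := ouX.
have XN t : D t -> 0 < t -> {ae Q, forall w,
    Num.sqrt (energy k t) * X (ln (energy k t)) w = N t (pr w)}.
  move=> Dt t0; have At0 := clock_gt0 Dt t0.
  move: (XW _ At0) (new_wiener_noise hB hN hM hf Dt t0 At0).
  by apply: filterS2 => w -> ->.
have ratXN : {ae Q, forall w, forall q : rat, D (ratr q) -> 0 < ratr q :> R ->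
    Num.sqrt (energy k (ratr q)) * X (ln (energy k (ratr q))) w = N (ratr q) (pr w)}.
  apply: ae_forall_rat => q.
  have [[Dq q0]|nq] := pselect (D (ratr q) /\ 0 < ratr q :> R).
    by move: (XN _ Dq q0); apply: filterS => w h _ _.
  by apply: aeW => w Dq q0; case: nq.
have cN := law_preserving_ae lp (noise_continuous phi_gt0 phi_C1 phi0 psi_cont hZ).
have main : {ae Q, forall w,
    time_changed phi sigma (X ^~ w) t @[t --> 0^'+] --> centering P Z 0 (pr w) /\
    forall t : R, 0 < t -> (t%:E < T)%E ->
      centering P Z t (pr w) = time_changed phi sigma (X ^~ w) t}.
  move: ratXN cN; apply: filterS2 => w hq [cNw N0w].
  have D0 : D 0 by split.
  have ZN t v : D t -> centering P Z t v = phi t * N t v by move=> Dt; exact: (centering_noise phi_gt0 phi_C1 phi0 psi_cont sigma_cont hB hZ).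
  have eqt t : D t -> 0 < t -> centering P Z t (pr w) = time_changed phi sigma (X ^~ w) t.
    move=> Dt t0; rewrite ZN// /time_changed clock_energy -mulrA; congr (_ * _).
    have At0 := clock_gt0 Dt t0.
    have cA : {for t, continuous (energy k)}.
      exact: (within_continuous_interior (energy_continuous ck) t0 Dt).
    apply: (@eq_on_rationals _ (fun t => N t (pr w))
      (fun t => Num.sqrt (energy k t) * X (ln (energy k t)) w) (D `&` [set s | 0 < s])).
    - apply: filterI; first exact: time_interval_nbhs.
      exact: (open_nbhs_nbhs (conj (@open_gt R 0) t0)).
    - exact: (within_continuous_interior cNw t0 Dt).
    - apply: cvgM.
        by apply: (@continuous_comp _ _ _ (energy k) Num.sqrt) => //; exact: sqrt_continuous.
      apply: (@continuous_comp _ _ _ (fun t => ln (energy k t)) (X ^~ w)); last exact: cX.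
      by apply: (@continuous_comp _ _ _ (energy k) (@ln R)) => //; exact: continuous_ln.
    - by move=> q [Dq q0]; rewrite hq.
  split; last by move=> t t0 tT; apply: eqt => //; split=> //; exact: ltW.
  have cphi := C1_continuous phi_C1.
  have lim0 : phi t * N t (pr w) @[t --> 0^'+] --> centering P Z 0 (pr w).
    by rewrite ZN//; apply: cvgM; [exact: within_continuous_right0 T0 cphi|exact: within_continuous_right0 T0 cNw].
  move: lim0; apply: cvg_trans; apply: near_eq_cvg; near=> t.
  have Dt : D t by near: t; exact: time_interval_right.
  by rewrite -ZN// eqt//; near: t; exact: nbhs_right_gt.
exists X; split=> // /(law_preserving_ae lp) limT.
move: main limT; apply: filterS2 => w [lim0 eqt] limTw.
have pT := from_below_proper T0.
split=> //; rewrite (cvg_lim _ limTw)//.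
move: limTw; apply: cvg_trans; apply: near_eq_cvg.
move: (from_below_interior T0); apply: filterS => t [t0 [_ tT]].
exact: eqt.
Unshelve. all: by end_near. Qed.

End on_extension.

Lemma energy_dichotomy : (forall s, exists2 t, D t & s <= energy k t) \/
  (exists s, forall t, D t -> energy k t <= s).
Proof.
have [h|h] := pselect (forall s, exists2 t, D t & s <= energy k t); first by left.
right; move/existsNP: h => [s h]; exists s => t Dt.
by rewrite leNgt; apply/negP => st; apply: h; exists t => //; exact: ltW.
Qed.

Lemma representation_on_product : ou_representation T phi sigma P (centering P Z)
  (P \x P)%E (fun w : Omega * Omega => w.1).
Proof.
have [unb|bd] := energy_dichotomy.
  have [f [J hf]] := unbounded_clock_family ck hN unb.
  exact: (representation_of_extension (trivial_extension hB D (fst_law_preserving P P)) hf).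
have [f [J [m hf]]] := bounded_clock_family T0 ck hB hN bd.
exact: (representation_of_extension (product_extension hB D) hf).
Qed.

Lemma id_law_preserving : law_preserving P P (fun w => w).
Proof. by split=> //; exact: measurable_id. Qed.

(** If T is infinite, the clock is assumed to run to infinity and B suffices;
    if T is finite, B can be continued by its own increments after T. *)
Lemma representation_on_same_space :
  (T < +oo)%E \/ clock phi sigma t @[t --> from_below T] --> +oo ->
  ou_representation T phi sigma P (centering P Z) P (fun w => w).
Proof.
move=> hT; have [unb|bd] := energy_dichotomy.
  have [f [J hf]] := unbounded_clock_family ck hN unb.
  exact: (representation_of_extension (trivial_extension hB D id_law_preserving) hf).
have Tfin : (T < +oo)%E.
  case: hT => // hT; have [s hs] := bd.
  have pT := from_below_proper T0.
  have : \forall t \near from_below T, s < clock phi sigma t by move/cvgryPgt : hT; exact.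
  move=> h; have [t [[t0 Dt] st]] := filter_ex (filterI (from_below_interior T0) h).
  by move: (hs t Dt); rewrite -clock_energy leNgt st.
have [f [J [m hf]]] := bounded_clock_family T0 ck hB hN bd.
have TE : T = (fine T)%:E by rewrite fineK// ge0_fin_numE// ltW.
have fT0 : 0 < fine T by rewrite -lte_fin -TE.
have := later_increments_extension hB fT0; rewrite -TE => hM.
exact: (representation_of_extension hM hf).
Qed.

End representation.

Unset Implicit Arguments.
Set Strict Implicit.
Set Printing Implicit Defensive.

Theorem theorem2p1 (R : realType) (T : \bar R) (hT : (0 < T)%E)
  (phi psi sigma : R -> R)
  (phi_gt0 : forall t, time_interval T t -> 0 < phi t)
  (phi_C1 : continuously_differentiable_on (time_interval T) phi)
  (phi0 : phi 0 = 1)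
  (psi_cont : {within time_interval T, continuous psi})
  (sigma_cont : {within time_interval T, continuous sigma})
  (sigma_neq0 : exists delta : \bar R, (0 < delta <= T)%E /\
     forall t : R, 0 < t -> (t%:E < delta)%E -> sigma t <> 0)
  (d : measure_display) (Omega : measurableType d) (P : probability Omega R)
  (B : R -> Omega -> R) (hB : standard_wiener_process P B)
  (xi : R) (Z : R -> Omega -> R)
  (hZ : strong_solution P B T phi psi sigma xi Z) :
  (exists (d' : measure_display) (Omega' : measurableType d')
          (P' : probability Omega' R),
     ou_representation T phi sigma P (centering P Z)
       (P \x P')%E (fun w : Omega * Omega' => w.1)) /\
  ((T < +oo)%E \/ clock phi sigma t @[t --> from_below T] --> +oo ->
     ou_representation T phi sigma P (centering P Z) P (fun w => w)).
Proof.
split; last exact: (representation_on_same_space hT phi_gt0 phi_C1 phi0 psi_cont sigma_cont sigma_neq0 hB hZ).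
exists d, Omega, P.
exact: (representation_on_product hT phi_gt0 phi_C1 phi0 psi_cont sigma_cont sigma_neq0 hB hZ).
Qed.
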